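(* Suppose the running cost $f$ is strictly convex (case (I) of the context) and $0<\sigma_1\le\sigma_2$. Let $\theta(y)=c-f'(y)/\rho$ for $y\in[0,1]$, $u(x,i;y)=\sup_{\tau\ge0}\mathbb{E}_{(x,i)}[e^{-\rho\tau}(X_\tau-\theta(y))]$, and $$F(x,y,i):=\int_0^yu(x,i;z)\,dz-\frac{f(y)}{\rho}.$$ Then $F$ is a classical solution to the Hamilton-Jacobi-Bellman equation $$\max\Big\{(\mathcal{G}-\rho)F(x,y,i)-f(y),\ (x-c)-F_y(x,y,i)\Big\}=0\quad\text{for all }(x,y,i)\in\mathbb{R}\times(0,1]\times\{1,2\}.$$ Moreover, it satisfies the boundary condition $F(x,0,i)=0$ for $(x,i)\in\mathbb{R}\times\{1,2\}$.
   Context: Let $(\Omega,\mathcal{F},\mathbb{P})$ be a complete probability space carrying a one-dimensional Brownian motion $W$ and an independent continuous-time Markov chain $\varepsilon$ with state space $\{1,2\}$ and generator $\begin{pmatrix}-\lambda_1&\lambda_1\\ \lambda_2&-\lambda_2\end{pmatrix}$, $\lambda_1,\lambda_2>0$; $\mathbb{F}$ is the augmented filtration generated by $(W,\varepsilon)$. $dX_t=\sigma_{\varepsilon_t}dW_t$, $X_0=x$, with $\sigma_1,\sigma_2>0$; $\mathbb{E}_{(x,i)}$ is expectation given $X_0=x,\varepsilon_0=i$. Constants $\rho,c>0$. The supremum defining $u$ is over all $\mathbb{P}_{(x,i)}$-a.s. finite $\mathbb{F}$-stopping times. Case (I): $f:\mathbb{R}\to\mathbb{R}_+$ is increasing, $f(0)=0$,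 and $f$ is strictly convex and continuously differentiable on $[0,1]$. $\mathcal{G}$ is the generator of $(X,\varepsilon)$, acting for fixed $y$ as $\mathcal{G}h(x,y,i)=\frac12\sigma_i^2h_{xx}(x,y,i)+\lambda_i\big(h(x,y,3-i)-h(x,y,i)\big)$. ''Classical solution'' means that the derivatives $F_{xx}$, $F_y$ exist and are continuous and the equation holds pointwise. *)

(* Defs.v *)
From HB Require Import structures.
From mathcomp Require Import all_boot all_order all_algebra.
From mathcomp Require Import all_classical all_reals all_analysis.
Set Implicit Arguments.
Unset Strict Implicit.
Unset Printing Implicit Defensive.
Import Order.TTheory GRing.Theory Num.Theory.
Import numFieldNormedType.Exports.
Local Open Scope classical_set_scope.
Local Open Scope ring_scope.

Section RealFunctions.
Context {R : realType}.
Implicit Types (D : set R) (g : R -> R).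

(* Derivative of the restriction of [g] to [D]: it is one-sided at the end
   points of an interval [D], and the usual derivative in its interior. *)
Definition quotient_on D g (y : R) : set_system R :=
  (fun z => (g z - g y) / (z - y)) @ within D y^'.

Definition derivable_on D g y : Prop := cvg (quotient_on D g y).

Definition derive_on D g (y : R) : R := lim (quotient_on D g y).

Definition continuously_differentiable_on D g : Prop :=
  (forall y, D y -> derivable_on D g y) /\
  {within D, continuous (derive_on D g)}.

Definition strictly_convex_on D g : Prop :=
  forall a b t, D a -> D b -> a != b -> 0 < t < 1 ->
    g (t * a + (1 - t) * b) < t * g a + (1 - t) * g b.

End RealFunctions.

(* Continuous-time processes are functions [Z : R -> T -> E] of which only the
   restriction to nonnegative times is meaningful. *)
Section Processes.
Context {R : realType} (d : measure_display) (T : measurableType d).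
Variable P : probability T R.

Definition independent_systems (G H : set_system T) : Prop :=
  forall A B, G A -> H B -> P (A `&` B) = (P A * P B)%E.

(* The events [Z s \in B] for [s \in I] and [B \in EE]. *)
Definition events {E : Type} (EE : set_system E) (Z : R -> T -> E)
    (I : set R) : set_system T :=
  \bigcup_(s in I) preimage_set_system [set: T] (Z s) EE.

Definition measurable_wrt (G : set_system T) (Z : T -> R) : Prop :=
  forall B : set R, measurable B -> G (Z @^-1` B).

Definition continuous_paths (Z : R -> T -> R) : Prop :=
  {ae P, forall w, {within `[0, +oo[, continuous (Z ^~ w)}}.

Definition brownian_motion (W : R -> T -> R) : Prop :=
  [/\ forall t, 0 <= t -> measurable_fun [set: T] (W t),
      {ae P, forall w, W 0 w = 0},
      continuous_paths W,
      forall s t, 0 <= s < t -> forall B : set R, measurable B ->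
        P ((fun w => W t w - W s w) @^-1` B) =
        normal_prob 0 (Num.sqrt (t - s)) B &
      forall s t, 0 <= s < t ->
        independent_systems
          <<s events measurable W `[0, s] >>
          (preimage_set_system [set: T] (fun w => W t w - W s w) measurable)].

(* The matrix exponential e^{tQ}, entry by entry. *)
Definition transition_matrix m (Q : 'M[R]_m.+1) (t : R) : 'M[R]_m.+1 :=
  \matrix_(i, j) limn (series (fun k => t ^+ k / k`!%:R * (Q ^+ k) i j)).

Definition markov_chain m (Q : 'M[R]_m.+1) (eps : R -> T -> 'I_m.+1) : Prop :=
  [/\ forall t i, 0 <= t -> measurable [set w | eps t w = i],
      {ae P, forall w,
        (forall t, 0 <= t -> \forall s \near t^'+, eps s w = eps t w) /\
        (forall t, 0 < t -> exists j, \forall s \near t^'-, eps s w = j)} &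
      forall s t i j A, 0 <= s <= t -> <<s events [set: set _] eps `[0, s] >> A ->
        P (A `&` [set w | eps s w = i /\ eps t w = j]) =
        ((transition_matrix Q (t - s) i j)%:E *
         P (A `&` [set w | eps s w = i]))%E].

Definition augmented_filtration m (W : R -> T -> R) (eps : R -> T -> 'I_m.+1)
    (t : R) : set_system T :=
  <<s events measurable W `[0, t] `|` events [set: set _] eps `[0, t]
      `|` P.-negligible >>.

(* The step process \sum_(k < size) coef_k 1_{]time_k, time_(k+1)]}. *)
Record step_process := StepProcess {
  sp_size : nat;
  sp_time : nat -> R;
  sp_coef : nat -> T -> R }.

Definition adapted_step_process (FF : R -> set_system T) (H : step_process) :
    Prop :=
  0 <= sp_time H 0 /\
  forall k, (k < sp_size H)%N ->
    [/\ sp_time H k <= sp_time H k.+1,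
        measurable_wrt (FF (sp_time H k)) (sp_coef H k) &
        exists M, forall w, `|sp_coef H k w| <= M].

Definition sp_value (H : step_process) (t : R) (w : T) : R :=
  \sum_(k < sp_size H)
    sp_coef H k w * \1_(`]sp_time H k, sp_time H k.+1]%classic) t.

Definition sp_integral (H : step_process) (W : R -> T -> R) (t : R) (w : T) :
    R :=
  \sum_(k < sp_size H) sp_coef H k w *
    (W (Num.min (sp_time H k.+1) t) w - W (Num.min (sp_time H k) t) w).

(* [J] is the Ito integral \int_0^. h_s dW_s: the continuous adapted process
   which is the L^2-limit of the integrals of adapted step processes
   converging to [h] in L^2(P \x ds) on bounded time intervals. *)
Definition ito_integral (FF : R -> set_system T) (W h J : R -> T -> R) : Prop :=
  [/\ forall t, 0 <= t -> measurable_wrt (FF t) (J t),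
      continuous_paths J &
      exists H : nat -> step_process,
        (forall n, adapted_step_process FF (H n)) /\
        forall t, 0 <= t ->
          (\int[P]_w \int[lebesgue_measure]_(s in `[0%R, t])
             ((sp_value (H n) s w - h s w) ^+ 2)%:E @[n --> \oo] --> 0)%E /\
          (\int[P]_w ((sp_integral (H n) W t w - J t w) ^+ 2)%:E
             @[n --> \oo] --> 0)%E].

Definition stopping_time (FF : R -> set_system T) (tau : T -> \bar R) : Prop :=
  (forall w, (0 <= tau w)%E) /\
  forall t, 0 <= t -> FF t [set w | (tau w <= t%:E)%E].

(* E[Z | A] for an event A of positive probability. *)
Definition expectation_given (A : set T) (Z : T -> R) : \bar R :=
  (\int[P]_(w in A) (Z w)%:E * ((fine (P A))^-1)%:E)%E.

End Processes.

(* The regimes 1 and 2 are [ord0] and [ord_max] in ['I_2]; the regime 3 - i is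
   [rev_ord i]. *)
Section RegimeSwitching.
Context {R : realType}.
Implicit Types (sigma lambda : 'I_2 -> R) (F : R -> R -> 'I_2 -> R).

Definition regime_rates lambda : 'M[R]_2 :=
  \matrix_(i, j) (if i == j then - lambda i else lambda i).

Section Stopping.
Context (d : measure_display) (T : measurableType d).
Variables (P : probability T R) (W : R -> T -> R) (eps : R -> T -> 'I_2).

(* dX_t = sigma_(eps_t) dW_t, X_0 = x *)
Definition regime_switching_diffusion sigma (x : R) (X : R -> T -> R) : Prop :=
  ito_integral P (augmented_filtration P W eps) W
    (fun t w => sigma (eps t w)) (fun t w => X t w - x).

(* sup_tau E_(x,i)[e^{-rho tau} (X_tau - theta)] for [X] started at [x]; the
   value given to the payoff on the null event [tau = +oo] is irrelevant. *)
Definition stopping_value (rho : R) (X : R -> T -> R) (i : 'I_2) (theta : R) :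
    \bar R :=
  ereal_sup [set v | exists tau : T -> \bar R,
    [/\ stopping_time (augmented_filtration P W eps) tau,
        {ae P, forall w, eps 0 w = i -> (tau w < +oo)%E} &
        v = expectation_given P [set w | eps 0 w = i]
              (fun w => expR (- rho * fine (tau w)) *
                        (X (fine (tau w)) w - theta))]].

End Stopping.

Definition F_x F (x y : R) (i : 'I_2) : R := derive1 (fun x' => F x' y i) x.

Definition F_xx F (x y : R) (i : 'I_2) : R :=
  derive1 (fun x' => F_x F x' y i) x.

Definition F_y F (x y : R) (i : 'I_2) : R :=
  derive_on `[0, 1] (fun y' => F x y' i) y.

Definition generator sigma lambda F (x y : R) (i : 'I_2) : R :=
  sigma i ^+ 2 / 2 * F_xx F x y i +
  lambda i * (F x y (rev_ord i) - F x y i).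

Definition hjb_classical_solution sigma lambda (rho c : R) (f : R -> R) F :
    Prop :=
  [/\ forall x y i, 0 < y <= 1 ->
        [/\ derivable (fun x' => F x' y i) x 1,
            derivable (fun x' => F_x F x' y i) x 1 &
            derivable_on `[0, 1] (fun y' => F x y' i) y],
      forall i, {within [set p : R * R | 0 < p.2 <= 1],
                  continuous (fun p => F_xx F p.1 p.2 i)},
      forall i, {within [set p : R * R | 0 < p.2 <= 1],
                  continuous (fun p => F_y F p.1 p.2 i)} &
      forall x y i, 0 < y <= 1 ->
        Num.max (generator sigma lambda F x y i - rho * F x y i - f y)
                ((x - c) - F_y F x y i) = 0].

End RegimeSwitching.

(* Main.v *)
Require Import Defs.
From HB Require Import structures.
From mathcomp Require Import all_boot all_order all_algebra.
From mathcomp Require Import all_classical all_reals all_analysis.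
From mathcomp Require Import measurable_realfun ring lra.
Set Implicit Arguments.
Unset Strict Implicit.
Unset Printing Implicit Defensive.
Import Order.TTheory GRing.Theory Num.Theory.
Import numFieldNormedType.Exports.
Local Open Scope classical_set_scope.
Local Open Scope ring_scope.

(** Let [v] be the value of the stopping problem with payoff [y]. Subtracting theta from X gives
    u(x,i;y) = v(x - theta(y), i), so F(x,y,i) is the integral of v(x - theta(z), i) over z in
    [0,y], minus f(y)/rho. The function [v] is C^1 in space. Above a threshold a_i it equals the
    payoff and satisfies (G - rho)v <= 0; below a_i it satisfies (G - rho)v = 0. Its second
    derivative jumps at a_i.

    Differentiation in y gives x - c - F_y = (x - theta(y)) - v(x - theta(y), i), which is
    nonpositive and vanishes when x - theta(y) >= a_i. In (G - rho)F - f the terms in f cancel; what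
    remains is the integral over z in [0,y] of (G - rho)v at (x - theta(z), i), which is
    nonpositive. Strict convexity of f makes theta strictly decreasing. So if x - theta(y) < a_i,
    every x - theta(z) with z <= y lies below the threshold and the integral vanishes: one of the
    two entries is always zero. The same monotonicity confines the z for which x - theta(z) is close
    to a_i to a short interval, so that F_xx exists and is continuous although v'' jumps
    ([value_integral1_derive], [value_integral2_continuous]).

    The function [v] is explicit ([value_solution_exists]). Below a_1 both regimes continue and v is
    a sum of two exponentials; between a_1 and a_2 only regime 2 continues. Smooth fit leaves two
    equations for a_1 and a_2 - a_1, solved by the intermediate value theorem ([free_boundaries]).

    That [v] is the value is [verification]. A one-step expansion on a grid of mesh h = k^4, with
    error of order k^5, does the work of Ito's formula ([one_step]). It is applied to averages of v
    over [y - delta, y], which have a Lipschitz second derivative and inherit the variational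
    inequality ([average_near_solution]). Summed with the discount, the errors are of order k.
    Rounding a stopping time up to the grid and applying Fatou's lemma bounds every payoff
    ([stopping_time_payoff_le]); the first grid time in the stopping region, cut off at a far
    horizon, nearly attains the bound ([grid_stopping_value]). The estimates on X come straight from
    the definition of the Ito integral as a limit of step integrals ([ito_increment_approx]). *)

(** * Expectations, integrability and square integrability *)

Section Expectation.
Context d (T : measurableType d) (R : realType) (P : probability T R).
Implicit Types (f g V Y : T -> R) (A : set T).

Definition integrable_rv f : Prop := P.-integrable [set: T] (EFin \o f).

Definition square_integrable_rv f : Prop :=
  measurable_fun [set: T] f /\ integrable_rv (fun w => f w ^+ 2).

Local Notation L1 := integrable_rv.
Local Notation L2 := square_integrable_rv.
Local Notation "'Ex' f" := (Rintegral P [set: T] f) (at level 10, f at level 9).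

Lemma integrable_rv_measurable f : L1 f -> measurable_fun [set: T] f.
Proof. by move=> /integrableP[/measurable_EFinP]. Qed.

Lemma integrable_rv_le f g : measurable_fun [set: T] f ->
  (forall w, `|f w| <= g w) -> L1 g -> L1 f.
Proof.
move=> mf fg ig; apply: (le_integrable _ _ _ ig) => //.
  exact/measurable_EFinP.
by move=> w _ /=; rewrite lee_fin (le_trans (fg w))// ler_norm.
Qed.

Lemma integrable_rv_bounded f M : measurable_fun [set: T] f ->
  (forall w, `|f w| <= M) -> L1 f.
Proof.
move=> mf fM; apply: (@integrable_rv_le _ (cst M)) => //.
exact: finite_measure_integrable_cst.
Qed.

Lemma integrable_rvD f g : L1 f -> L1 g -> L1 (fun w => f w + g w).
Proof. by move=> f1 g1; exact: (integrableD measurableT f1 g1). Qed.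

Lemma integrable_rvB f g : L1 f -> L1 g -> L1 (fun w => f w - g w).
Proof. by move=> f1 g1; exact: (integrableB measurableT f1 g1). Qed.

Lemma integrable_rvZ c f : L1 f -> L1 (fun w => c * f w).
Proof. by move=> f1; exact: (integrableZl measurableT c f1). Qed.

Lemma integrable_rv_norm f : L1 f -> L1 (fun w => `|f w|).
Proof. by move=> f1; exact: (integrable_norm f1). Qed.

Lemma integrable_rv_sum (I : Type) (s : seq I) (h : I -> T -> R) :
  (forall i, L1 (h i)) -> L1 (fun w => \sum_(i <- s) h i w).
Proof.
move=> h1; elim: s => [|i s IH].
  under [X in L1 X]eq_fun do rewrite big_nil.
  by apply: (@integrable_rv_bounded _ 0) => //= w; rewrite normr0.
under [X in L1 X]eq_fun do rewrite big_cons.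
exact: integrable_rvD.
Qed.

Lemma integrable_rvM_bounded f g M : measurable_fun [set: T] f ->
  (forall w, `|f w| <= M) -> L1 g -> L1 (fun w => f w * g w).
Proof.
move=> mf fM g1; apply: (@integrable_rv_le _ (fun w => M * `|g w|)).
- by apply: measurable_funM => //; exact: integrable_rv_measurable.
- by move=> w; rewrite normrM ler_wpM2r.
- exact/integrable_rvZ/integrable_rv_norm.
Qed.

Lemma norm_indic_le1 A w : `|\1_A w : R| <= 1.
Proof. by rewrite indicE; case: (_ \in _); rewrite ?normr1 ?normr0. Qed.

Lemma integrable_rv_indicM f A : measurable A -> L1 f -> L1 (fun w => \1_A w * f w).
Proof.
move=> mA f1; apply: (@integrable_rvM_bounded _ _ 1) => // w.
exact: norm_indic_le1.
Qed.

Lemma square_integrableM f g : L2 f -> L2 g -> L1 (fun w => f w * g w).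
Proof.
move=> [mf f2] [mg g2].
apply: (@integrable_rv_le _ (fun w => f w ^+ 2 + g w ^+ 2)); last exact: integrable_rvD.
  exact: measurable_funM.
move=> w; rewrite normrM -(real_normK (num_real (f w))).
rewrite -(real_normK (num_real (g w))).
set a := `|f w|; set b := `|g w|.
have a0 : 0 <= a by exact: normr_ge0.
have b0 : 0 <= b by exact: normr_ge0.
nra.
Qed.

Lemma square_integrableD f g : L2 f -> L2 g -> L2 (fun w => f w + g w).
Proof.
move=> f2 g2; split; first by apply: measurable_funD; [case: f2|case: g2].
rewrite (_ : (fun w => _) =
    (fun w => f w ^+ 2 + g w ^+ 2 + 2 * (f w * g w))); last first.
  by apply/funext => w; ring.
apply: integrable_rvD; first by apply: integrable_rvD; [case: f2|case: g2].
exact/integrable_rvZ/square_integrableM.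
Qed.

Lemma square_integrableZ c f : L2 f -> L2 (fun w => c * f w).
Proof.
move=> [mf f2]; split; first exact: measurable_funM.
under [X in L1 X]eq_fun do rewrite exprMn.
exact: integrable_rvZ.
Qed.

Lemma square_integrableB f g : L2 f -> L2 g -> L2 (fun w => f w - g w).
Proof.
move=> f2 g2.
rewrite (_ : (fun w => _) = (fun w => f w + (-1) * g w)); last first.
  by apply/funext => w; rewrite mulN1r.
by apply: square_integrableD => //; exact: square_integrableZ.
Qed.

Lemma square_integrableM_bounded f g M : measurable_fun [set: T] f ->
  (forall w, `|f w| <= M) -> L2 g -> L2 (fun w => f w * g w).
Proof.
move=> mf fM [mg g2]; split; first exact: measurable_funM.
under [X in L1 X]eq_fun do rewrite exprMn.
apply: (@integrable_rvM_bounded _ _ (M ^+ 2)) => //; first exact: measurable_funX.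
by move=> w; rewrite normrX lerXn2r// nnegrE// (le_trans _ (fM w)).
Qed.

Lemma square_integrable_bounded f M : measurable_fun [set: T] f ->
  (forall w, `|f w| <= M) -> L2 f.
Proof.
move=> mf fM; split => //; apply: (@integrable_rv_bounded _ (M ^+ 2)).
  exact: measurable_funX.
by move=> w; rewrite normrX lerXn2r// nnegrE// (le_trans _ (fM w)).
Qed.

Lemma square_integrable_indicM f A : measurable A -> L2 f ->
  L2 (fun w => \1_A w * f w).
Proof.
move=> mA f2; apply: (@square_integrableM_bounded _ _ 1) => // w.
exact: norm_indic_le1.
Qed.

Lemma square_integrable_sum (I : Type) (s : seq I) (h : I -> T -> R) :
  (forall i, L2 (h i)) -> L2 (fun w => \sum_(i <- s) h i w).
Proof.
move=> h1; elim: s => [|i s IH].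
  under [X in L2 X]eq_fun do rewrite big_nil.
  by apply: (@square_integrable_bounded _ 0) => //= w; rewrite normr0.
under [X in L2 X]eq_fun do rewrite big_cons.
exact: square_integrableD.
Qed.

Lemma square_integrable_integrable f : L2 f -> L1 f.
Proof.
move=> f2; rewrite (_ : f = fun w => 1 * f w); last first.
  by apply/funext => w; rewrite mul1r.
apply: (@square_integrableM (fun=> 1)) => //.
by apply: (@square_integrable_bounded _ 1) => //= w; rewrite normr1.
Qed.

Lemma ExD f g : L1 f -> L1 g -> Ex (fun w => f w + g w) = Ex f + Ex g.
Proof. by move=> f1 g1; rewrite RintegralD. Qed.

Lemma ExB f g : L1 f -> L1 g -> Ex (fun w => f w - g w) = Ex f - Ex g.
Proof. by move=> f1 g1; rewrite RintegralB. Qed.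

Lemma ExZ c f : L1 f -> Ex (fun w => c * f w) = c * Ex f.
Proof. by move=> f1; rewrite RintegralZl. Qed.

Lemma Ex_cst c : Ex (fun=> c) = c.
Proof.
rewrite Rintegral_cst//; apply: etrans (mulr1 c); congr (c * _).
by have /= -> := probability_setT P.
Qed.

Lemma Ex_le f g : L1 f -> L1 g -> (forall w, f w <= g w) -> Ex f <= Ex g.
Proof. by move=> f1 g1 fg; apply: le_Rintegral => // w _. Qed.

Lemma Ex_ge0 f : (forall w, 0 <= f w) -> 0 <= Ex f.
Proof. by move=> f0; apply: Rintegral_ge0 => w _. Qed.

Lemma Ex_norm f : L1 f -> `|Ex f| <= Ex (fun w => `|f w|).
Proof. by move=> f1; exact: le_normr_Rintegral. Qed.

Lemma Ex_sum (I : Type) (s : seq I) (h : I -> T -> R) :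
  (forall i, L1 (h i)) ->
  Ex (fun w => \sum_(i <- s) h i w) = \sum_(i <- s) Ex (h i).
Proof.
move=> h1; elim: s => [|i s IH].
  by under eq_Rintegral do rewrite big_nil; rewrite Ex_cst big_nil.
under eq_Rintegral do rewrite big_cons.
by rewrite ExD// ?IH ?big_cons//; exact: integrable_rv_sum.
Qed.

Lemma EFin_Ex f : L1 f -> ((Ex f)%:E = \int[P]_w (f w)%:E)%E.
Proof. by move=> f1; rewrite fineK// integrable_fin_num. Qed.

Lemma Ex_indic A : measurable A -> Ex (\1_A) = fine (P A).
Proof. by move=> mA; rewrite /Rintegral integral_indic// setIT. Qed.

Lemma probability_EFin A : measurable A -> P A = (fine (P A))%:E.
Proof. by move=> mA; rewrite fineK// fin_num_measure. Qed.

Lemma Ex_ae_eq f g : measurable_fun [set: T] f -> measurable_fun [set: T] g ->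
  {ae P, forall w, f w = g w} -> Ex f = Ex g.
Proof.
move=> mf mg fg; congr fine; apply: ae_eq_integral => //.
- exact/measurable_EFinP.
- exact/measurable_EFinP.
- by apply: filterS fg => w fgw _ /=; rewrite fgw.
Qed.

Lemma Ex_dominated_cvg (f_ : nat -> T -> R) f g :
  (forall n, measurable_fun [set: T] (f_ n)) -> measurable_fun [set: T] f ->
  (forall w, f_ n w @[n --> \oo] --> f w) -> L1 g ->
  (forall n w, `|f_ n w| <= g w) ->
  Ex (f_ n) @[n --> \oo] --> Ex f.
Proof.
move=> mf_ mf ff g1 fg.
have [] := @dominated_convergence _ _ _ P [set: T] measurableT
  (fun n => EFin \o f_ n) (EFin \o f) (EFin \o g).
- by move=> n; exact/measurable_EFinP.
- exact/measurable_EFinP.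
- apply/nearW => w _ /=; apply/cvg_EFin; last exact: ff.
  by apply/nearW => n.
- exact: g1.
- by apply/nearW => w n _ /=; rewrite lee_fin.
move=> f1 _ h; apply: fine_cvg.
by rewrite fineK// integrable_fin_num.
Qed.

(** * Random variables of zero conditional mean *)

Section ConditionalMeanZero.
Import HBNNSimple.
Variable S : set_system T.
Hypothesis Smeas : <<s S >> `<=` measurable.

Lemma measurable_wrtP V : measurable_wrt <<s S >> V <->
  measurable_fun [set: g_sigma_algebraType S] (V : g_sigma_algebraType S -> R).
Proof.
split=> [h _ B mB|h B mB]; first by rewrite setTI; exact: (h B mB).
by have := h measurableT _ mB; rewrite setTI.
Qed.

Lemma measurable_wrt_measurable V : measurable_wrt <<s S >> V ->
  measurable_fun [set: T] V.
Proof. by move=> h _ B mB; rewrite setTI; apply: Smeas; exact: (h B mB). Qed.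

(** Simple functions measurable for the sub-sigma-algebra increase to [V]; for each of them the
    claim follows from the hypothesis on indicators, and [|V Y|] dominates the products. *)
Lemma Ex_ge0_mean_zero V Y : L1 Y ->
  (forall A, <<s S >> A -> Ex (fun w => \1_A w * Y w) = 0) ->
  measurable_wrt <<s S >> V -> (forall w, 0 <= V w) ->
  L1 (fun w => V w * Y w) -> Ex (fun w => V w * Y w) = 0.
Proof.
move=> Y1 Y0 mV V0 VY1.
have mV' : measurable_fun [set: g_sigma_algebraType S] (EFin \o V).
  by apply/measurable_EFinP; exact/measurable_wrtP.
pose V_ := nnsfun_approx measurableT mV'.
have mA n r : <<s S >> (V_ n @^-1` [set r]).
  have := measurable_funP (V_ n) measurableT _ (measurable_set1 r).
  by rewrite setTI.
have mVn n : measurable_fun [set: T] (V_ n : T -> R).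
  move=> _ B mB; rewrite setTI; apply: Smeas.
  by have := measurable_funP (V_ n) measurableT _ mB; rewrite setTI.
have V_cvg w : V_ n w @[n --> \oo] --> V w.
  apply: (@fine_cvg _ _ _ _ (fun n => (V_ n w)%:E)).
  by apply: (cvg_nnsfun_approx measurableT mV') => //= x _; rewrite lee_fin.
have V_le n w : `|V_ n w| <= V w.
  rewrite ger0_norm// -lee_fin /V_ nnsfun_approxE.
  by apply: (le_approx n (f := EFin \o V)) => // x _; rewrite lee_fin.
have E0 n : Ex (fun w => V_ n w * Y w) = 0.
  under eq_Rintegral do rewrite fimfunEord mulr_suml.
  rewrite Ex_sum.
    apply: big1 => i _; under eq_Rintegral do rewrite -mulrA.
    rewrite ExZ; last by apply: integrable_rv_indicM => //; apply: Smeas; exact: mA.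
    by rewrite Y0 ?mulr0//; exact: mA.
  move=> i; under [X in L1 X]eq_fun do rewrite -mulrA.
  by apply/integrable_rvZ/integrable_rv_indicM => //; apply: Smeas; exact: mA.
suff h : Ex (fun w => V_ n w * Y w) @[n --> \oo] --> Ex (fun w => V w * Y w).
  move: h; rewrite (funext E0) => h.
  by have /(@cvg_lim _ (@norm_hausdorff _ _)) := h; rewrite lim_cst.
apply: (@Ex_dominated_cvg _ _ (fun w => `|V w * Y w|)) => //.
- by move=> n; apply: measurable_funM => //; exact: integrable_rv_measurable.
- exact: integrable_rv_measurable.
- by move=> w; apply: cvgMr_tmp; exact: V_cvg.
- exact: integrable_rv_norm.
- by move=> n w; rewrite !normrM ler_wpM2r// (le_trans (V_le n w))// ler_norm.
Qed.

(** The hypothesis on indicators says that the conditional expectation of [Y] vanishes; conditional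
    expectations enter the whole development in this form. The proof splits [V] into its positive
    and negative parts. *)
Lemma Ex_mean_zero V Y : L1 Y ->
  (forall A, <<s S >> A -> Ex (fun w => \1_A w * Y w) = 0) ->
  measurable_wrt <<s S >> V ->
  L1 (fun w => V w * Y w) -> Ex (fun w => V w * Y w) = 0.
Proof.
move=> Y1 Y0 mV VY1.
have mVp : measurable_wrt <<s S >> (fun w => Num.max (V w) 0).
  by apply/measurable_wrtP; apply: measurable_maxr => //; exact/measurable_wrtP.
have mVn : measurable_wrt <<s S >> (fun w => Num.max (- V w) 0).
  apply/measurable_wrtP; apply: measurable_maxr => //.
  by apply: measurableT_comp => //; exact/measurable_wrtP.
have mY := integrable_rv_measurable Y1.
have pY : L1 (fun w => Num.max (V w) 0 * Y w).
  apply: (integrable_rv_le _ _ (integrable_rv_norm VY1)).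
    by apply: measurable_funM => //; exact: measurable_wrt_measurable.
  move=> w; rewrite !normrM ler_wpM2r//; have [_|_] := leP (V w) 0 => //.
  by rewrite normr0.
have nY : L1 (fun w => Num.max (- V w) 0 * Y w).
  apply: (integrable_rv_le _ _ (integrable_rv_norm VY1)).
    by apply: measurable_funM => //; exact: measurable_wrt_measurable.
  move=> w; rewrite !normrM ler_wpM2r//; have [_|_] := leP (- V w) 0 => //.
    by rewrite normr0.
  by rewrite normrN.
rewrite (_ : (fun w => V w * Y w) = (fun w =>
    Num.max (V w) 0 * Y w - Num.max (- V w) 0 * Y w)); last first.
  apply/funext => w; rewrite -mulrBl; congr (_ * _).
  by have [h|h] := leP (V w) 0; have [k|k] := leP (- V w) 0; lra.
by rewrite ExB// !Ex_ge0_mean_zero ?subr0// => w; rewrite le_max lexx orbT.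
Qed.

End ConditionalMeanZero.

End Expectation.

(** Serves to discard the null sets that the augmentation adds to the filtration. *)
Lemma measurable_sym_negligible d (T : measurableType d) (R : realType)
    (P : probability T R) (A B E N : set T) :
  measurable A -> measurable B -> measurable E -> P.-negligible N ->
  (forall w, ~ N w -> A w <-> B w) -> P (A `&` E) = P (B `&` E).
Proof.
move=> mA mB mE [M [mM M0 NM]] AB.
have h (C : set T) : measurable C -> P (C `&` E) = P ((C `&` E) `\` M).
  move=> mC; have mCE : measurable (C `&` E) by exact: measurableI.
  rewrite [LHS](measureDI P mCE mM) [X in (_ + X)%E](_ : _ = 0%E) ?adde0//.
  by apply: subset_measure0 M0 => //; exact: measurableI.
rewrite h// (h B)//; congr (P _); apply/seteqP; split => w [[Cw Ew] Mw].
  by split=> //; split=> //; apply/(AB w) => // /NM.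
by split=> //; split=> //; apply/(AB w) => // /NM.
Qed.

(** * The augmented filtration: independent increments and the Markov property *)

Section Filtration.
Context d (T : measurableType d) (R : realType) (P : probability T R).
Variables (W : R -> T -> R) (eps : R -> T -> 'I_2) (Q : 'M[R]_2).
Hypothesis Pcomplete : measure_is_complete P.
Hypothesis WBM : brownian_motion P W.
Hypothesis epsMC : markov_chain P Q eps.
Hypothesis W_eps_indep : independent_systems P
  <<s events measurable W `[0, +oo[ >>
  <<s events [set: set 'I_2] eps `[0, +oo[ >>.

Local Notation FF := (augmented_filtration P W eps).
Local Notation Ex f := (Rintegral P [set: T] f).

Lemma BM_measurable t : 0 <= t -> measurable_fun [set: T] (W t).
Proof. by case: WBM => + _ _ _ _; exact. Qed.

Lemma measurable_chain t (B : set 'I_2) : 0 <= t ->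
  measurable [set w | B (eps t w)].
Proof.
move=> t0; have [meps _ _] := epsMC.
rewrite (_ : [set w | _] = \big[setU/set0]_(i <- enum 'I_2 | i \in B)
    [set w | eps t w = i]).
  by apply: bigsetU_measurable => i _; exact: meps.
apply/seteqP; split => w /=.
  move=> Bw; rewrite -bigcup_seq_cond; exists (eps t w) => //=.
  by rewrite mem_enum; apply/mem_set.
by rewrite -bigcup_seq_cond => -[i /= /andP[_ /set_mem Bi] ->].
Qed.

Lemma events_W_measurable (I : set R) : I `<=` `[0, +oo[ ->
  <<s events measurable W I >> `<=` measurable.
Proof.
move=> I0; apply: smallest_sub; first exact: sigma_algebra_measurable.
move=> _ [s Is [B mB <-]]; apply: BM_measurable => //.
by have := I0 _ Is; rewrite /= in_itv/= andbT.
Qed.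

Lemma events_eps_measurable (I : set R) : I `<=` `[0, +oo[ ->
  <<s events [set: set 'I_2] eps I >> `<=` measurable.
Proof.
move=> I0; apply: smallest_sub; first exact: sigma_algebra_measurable.
move=> _ [s Is [B mB <-]]; rewrite setTI; apply: (@measurable_chain s B).
by have := I0 _ Is; rewrite /= in_itv/= andbT.
Qed.

Lemma itv0_subset t : `[0, t] `<=` (`[0, +oo[ : set R).
Proof. by move=> s /=; rewrite !in_itv/= andbT => /andP[]. Qed.

Lemma FF_measurable t : FF t `<=` measurable.
Proof.
apply: smallest_sub; first exact: sigma_algebra_measurable.
move=> A [[|]|]; last exact: Pcomplete.
- by move=> h; apply: (events_W_measurable (@itv0_subset t)); exact: sub_gen_smallest.
- by move=> h; apply: (events_eps_measurable (@itv0_subset t)); exact: sub_gen_smallest.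
Qed.

Lemma FF_mono s t : s <= t -> FF s `<=` FF t.
Proof.
move=> st; apply: sub_sigma_algebra2 => A [[|]|] AA; last by right.
  left; left; case: AA => r rs AA; exists r => //.
  by move: rs; rewrite /= !in_itv/= => /andP[-> /le_trans]; apply.
left; right; case: AA => r rs AA; exists r => //.
by move: rs; rewrite /= !in_itv/= => /andP[-> /le_trans]; apply.
Qed.

Lemma FF_W s t : 0 <= s <= t -> measurable_wrt (FF t) (W s).
Proof.
move=> st B mB; apply: sub_gen_smallest; left; left; exists s => //.
by exists B => //; rewrite setTI.
Qed.

Lemma FF_eps s t (B : set 'I_2) : 0 <= s <= t -> FF t [set w | B (eps s w)].
Proof.
move=> st; apply: sub_gen_smallest; left; right; exists s => //.
by exists B => //; rewrite setTI.
Qed.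

Lemma FF_negligible t (N : set T) : P.-negligible N -> FF t N.
Proof. by move=> NN; apply: sub_gen_smallest; right. Qed.

(** The sets that agree, off a null set, with an intersection of an event of the past of W and one
    of the past of eps form a pi-system generating the filtration, and both sides are finite
    measures in [A]. This carries the properties of W and of eps, each known for its own past, over
    to the joint past. *)
Lemma FF_extension s (E1 E2 : set T) (c : R) : 0 <= c ->
  measurable E1 -> measurable E2 ->
  (forall A1 A2, <<s events measurable W `[0, s] >> A1 ->
    <<s events [set: set 'I_2] eps `[0, s] >> A2 ->
    P (A1 `&` A2 `&` E1) = (c%:E * P (A1 `&` A2 `&` E2))%E) ->
  forall A, FF s A -> P (A `&` E1) = (c%:E * P (A `&` E2))%E.
Proof.
move=> c0 mE1 mE2 H.
pose S1 := <<s events measurable W `[0, s] >>.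
pose S2 := <<s events [set: set 'I_2] eps `[0, s] >>.
pose G := [set A : set T | measurable A /\ exists A1 A2 N,
  [/\ S1 A1, S2 A2, P.-negligible N &
      forall w, ~ N w -> A w <-> (A1 `&` A2) w]].
have S1T : S1 setT.
  rewrite -setC0 -setTD; case: (smallest_sigma_algebra setT (events measurable W `[0, s])) => h0 hC _.
  exact: hC.
have S2T : S2 setT.
  rewrite -setC0 -setTD; case: (smallest_sigma_algebra setT (events [set: set 'I_2] eps `[0, s])) => h0 hC _.
  exact: hC.
have S1m : S1 `<=` measurable by apply: events_W_measurable; exact: itv0_subset.
have S2m : S2 `<=` measurable by apply: events_eps_measurable; exact: itv0_subset.
have S1I : setI_closed S1.
  by move=> A B; exact: (@measurableI _ (g_sigma_algebraType (events measurable W `[0, s]))).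
have S2I : setI_closed S2.
  by move=> A B; exact: (@measurableI _ (g_sigma_algebraType (events [set: set 'I_2] eps `[0, s]))).
have GI : setI_closed G.
  move=> A B [mA [A1 [A2 [N [a1 a2 n hA]]]]] [mB [B1 [B2 [M [b1 b2 m hB]]]]].
  split; first exact: measurableI.
  exists (A1 `&` B1), (A2 `&` B2), (N `|` M); split.
  - exact: S1I.
  - exact: S2I.
  - exact: negligibleU.
  - move=> w /not_orP[nN nM].
    have := hA w nN; have := hB w nM; rewrite /setI/=; tauto.
have FG : FF s `<=` <<s G >>.
  apply: sub_sigma_algebra2 => A AA; split.
    by apply: (@FF_measurable s); exact: sub_gen_smallest.
  case: AA => [[|]|] AA.
  - exists A, setT, set0; split => //; first exact: sub_gen_smallest.
      exact: negligible_set0.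
    by move=> w _; rewrite setIT.
  - exists setT, A, set0; split => //; first exact: sub_gen_smallest.
      exact: negligible_set0.
    by move=> w _; rewrite setTI.
  - exists set0, setT, A; split => //.
    + by apply: (@measurable0 _ (g_sigma_algebraType (events measurable W `[0, s]))).
    + by move=> w nA; rewrite set0I; split.
move=> A FA.
pose c' : {nonneg R} := NngNum c0.
suff : mrestr P mE1 A = mscale c' (mrestr P mE2) A by [].
apply: (@g_sigma_algebra_measure_unique _ _ T G _ (fun=> setT)) => //; last exact: FG.
- by move=> B [].
- move=> _; split => //; exists setT, setT, set0; split => //.
  exact: negligible_set0.
- by apply/seteqP; split => // w _; exists 0%N.
- move=> B [mB [B1 [B2 [N [b1 b2 n hB]]]]] /=.
  have mB12 : measurable (B1 `&` B2) by apply: measurableI; [exact: S1m|exact: S2m].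
  change (P (B `&` E1) = (c%:E * P (B `&` E2))%E).
  rewrite (measurable_sym_negligible mB mB12 mE1 n hB).
  by rewrite (measurable_sym_negligible mB mB12 mE2 n hB); exact: H.
- by move=> _; rewrite /= /mrestr setTI (le_lt_trans (probability_le1 P mE1))// ltry.
Qed.

Lemma events_W_sub s t : 0 <= s -> s <= t -> forall B : set R, measurable B ->
  <<s events measurable W `[0, +oo[ >> ((fun w => W t w - W s w) @^-1` B).
Proof.
move=> s0 st B mB.
have h r : 0 <= r -> measurable_fun
    [set: g_sigma_algebraType (events measurable W `[0, +oo[)] (W r : g_sigma_algebraType (events measurable W `[0, +oo[) -> R).
  move=> r0 _ C mC; rewrite setTI; apply: sub_gen_smallest; exists r.
    by rewrite /= in_itv/= r0.
  by exists C => //; rewrite setTI.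
have := measurable_funB (h t (le_trans s0 st)) (h s s0).
by move=> /(_ measurableT _ mB); rewrite setTI.
Qed.

(** For an event of the past of W this belongs to the definition of Brownian motion, and the past of
    eps is split off by independence. [FF_extension] joins the two, with the whole space as [E2] and
    the probability of the increment event as [c]. *)
Lemma increment_indep s t (A : set T) (B : set R) : 0 <= s < t ->
  FF s A -> measurable B ->
  P (A `&` (fun w => W t w - W s w) @^-1` B) =
  (P A * normal_prob 0 (Num.sqrt (t - s)) B)%E.
Proof.
move=> /andP[s0 st] FA mB.
have [mW _ _ Wlaw Wind] := WBM.
pose E1 := (fun w => W t w - W s w) @^-1` B.
have mE1 : measurable E1.
  by apply: (@events_W_measurable `[0, +oo[) => //; apply: events_W_sub => //; exact: ltW.
have PE1 : P E1 = normal_prob 0 (Num.sqrt (t - s)) B by apply: Wlaw => //; rewrite s0.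
have finE1 : P E1 = (fine (P E1))%:E by apply: probability_EFin.
have mono (Z : R -> T -> R) : events measurable Z `[0, s] `<=` events measurable Z `[0, +oo[.
  by move=> C [r rs CC]; exists r => //; exact: (@itv0_subset s).
have monoe : events [set: set 'I_2] eps `[0, s] `<=` events [set: set 'I_2] eps `[0, +oo[.
  by move=> C [r rs CC]; exists r => //; exact: (@itv0_subset s).
rewrite -PE1 muleC finE1.
have := @FF_extension s E1 setT (fine (P E1)) _ mE1 measurableT _ A FA.
rewrite setIT; apply.
  by rewrite fine_ge0.
move=> A1 A2 a1 a2; rewrite setIT -finE1.
have a1' : <<s events measurable W `[0, +oo[ >> A1.
  by move: a1; apply: sub_sigma_algebra2; exact: mono.
have a2' : <<s events [set: set 'I_2] eps `[0, +oo[ >> A2.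
  by move: a2; apply: sub_sigma_algebra2; exact: monoe.
have aE : <<s events measurable W `[0, +oo[ >> (A1 `&` E1).
  apply: (@measurableI _ (g_sigma_algebraType (events measurable W `[0, +oo[))) => //.
  by apply: events_W_sub => //; exact: ltW.
rewrite setIAC (W_eps_indep aE a2') (W_eps_indep a1' a2').
rewrite (Wind s t _ A1 E1) ?s0//; last by exists B => //; rewrite setTI.
by rewrite (muleC (P A1)) muleA.
Qed.

Lemma chain_markov s t i j (A : set T) : 0 <= s <= t -> FF s A ->
  0 <= transition_matrix Q (t - s) i j ->
  P (A `&` [set w | eps s w = i /\ eps t w = j]) =
  ((transition_matrix Q (t - s) i j)%:E * P (A `&` [set w | eps s w = i]))%E.
Proof.
move=> st FA p0; have [meps _ Mk] := epsMC.
have [s0 st'] := andP st.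
have t0 := le_trans s0 st'.
have mE1 : measurable [set w | eps s w = i /\ eps t w = j].
  by apply: measurableI; exact: meps.
apply: (@FF_extension s) => //; first exact: meps.
move=> A1 A2 a1 a2.
have a1' : <<s events measurable W `[0, +oo[ >> A1.
  move: a1; apply: sub_sigma_algebra2 => C [r rs CC]; exists r => //.
  exact: (@itv0_subset s).
have a2' : <<s events [set: set 'I_2] eps `[0, +oo[ >> A2.
  move: a2; apply: sub_sigma_algebra2 => C [r rs CC]; exists r => //.
  exact: (@itv0_subset s).
have e r k : 0 <= r -> <<s events [set: set 'I_2] eps `[0, +oo[ >> [set w | eps r w = k].
  move=> r0; apply: sub_gen_smallest; exists r; first by rewrite /= in_itv/= r0.
  by exists [set k] => //; rewrite setTI.
have eI := @measurableI _ (g_sigma_algebraType (events [set: set 'I_2] eps `[0, +oo[)).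
rewrite -!setIA (W_eps_indep a1'); last by apply: (eI) => //; apply: (eI); exact: e.
rewrite (W_eps_indep a1'); last by apply: (eI) => //; exact: e.
rewrite Mk//.
by rewrite muleCA.
Qed.

End Filtration.

(** * Moments of the centred normal law *)

Section NormalMoments.
Context {R : realType}.
Local Notation mu := (@lebesgue_measure R).
Import HBNNSimple.

Lemma normal_peakM (r s : R) : 0 < r ->
  normal_peak (r * s) = r^-1 * normal_peak s.
Proof.
move=> r0; rewrite /normal_peak exprMn -mulrA -mulrnAr sqrtrM ?sqr_ge0//.
by rewrite sqrtr_sqr gtr0_norm// invfM.
Qed.

Let integral_normal_prob_nnsfun (m s : R) (f : {nnsfun R >-> R}) :
  (\int[normal_prob m s]_x (f x)%:E =
   \int[mu]_x ((f x)%:E * (normal_pdf m s x)%:E))%E.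
Proof.
have mpdf : measurable_fun [set: R] (EFin \o normal_pdf m s).
  by apply/measurable_EFinP; exact: measurable_normal_pdf.
have p0 x : (0 <= (normal_pdf m s x)%:E)%E by rewrite lee_fin normal_pdf_ge0.
have mA r : measurable (f @^-1` [set r]).
  by have := measurable_funP f measurableT _ (measurable_set1 r); rewrite setTI.
have mfr r : measurable_fun [set: R] (fun x => (r * \1_(f @^-1` [set r]) x)%:E).
  by apply/measurable_EFinP; apply: measurable_funM => //; exact: measurable_indic.
under [LHS]eq_integral do rewrite fimfunE -fsumEFin//.
rewrite [LHS]ge0_integral_fsum//; last first.
  - by move=> n x _; rewrite EFinM nnfun_muleindic_ge0.
under [RHS]eq_integral.
  move=> x xD; rewrite fimfunE -fsumEFin// muleC ge0_mule_fsumr; last first.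
    by move=> r; rewrite EFinM nnfun_muleindic_ge0.
  over.
rewrite [RHS]ge0_integral_fsum//; last 2 first.
  - by move=> r; apply: emeasurable_funM => //; exact: mfr.
  - move=> n x _; rewrite EFinM mule_ge0//.
    by rewrite nnfun_muleindic_ge0.
apply: eq_fsbigr => r _.
under [RHS]eq_integral do rewrite EFinM muleCA.
have [r0|r0] := leP 0 r; last first.
  have A0 x : (r * \1_(f @^-1` [set r]) x)%:E = 0%E.
    rewrite indicE; case: (boolP (x \in _)) => [/set_mem/= fx|_]; last by rewrite mulr0.
    by move: r0; rewrite -fx ltNge fun_ge0.
  rewrite (eq_integral (cst 0%E)) ?integral0; last by move=> x _; exact: A0.
  rewrite (eq_integral (cst 0%E)) ?integral0// => x _.
  by rewrite muleCA -(EFinM r) A0 mule0.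
under [LHS]eq_integral do rewrite EFinM.
have mI : measurable_fun [set: R] (fun x => (\1_(f @^-1` [set r]) x : R)%:E).
  by apply/measurable_EFinP; exact: measurable_indic.
transitivity (r%:E * \int[normal_prob m s]_x (\1_(f @^-1` [set r]) x)%:E)%E.
  by apply: ge0_integralZl => // x _; rewrite lee_fin.
transitivity (r%:E * \int[mu]_x ((normal_pdf m s x)%:E * (\1_(f @^-1` [set r]) x)%:E))%E; last first.
  apply/esym/ge0_integralZl => //; first exact: emeasurable_funM.
  by move=> x _; rewrite mule_ge0// lee_fin.
congr (_ * _)%E; rewrite integral_indic//; last exact: mA.
rewrite setIT /normal_prob/= [LHS]integral_mkcond.
apply: eq_integral => x _; rewrite patchE indicE.
by case: (x \in _); rewrite ?mule1 ?mule0.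
Qed.

Lemma ge0_integral_normal_prob (m s : R) (f : R -> \bar R) :
  measurable_fun [set: R] f -> (forall x, 0 <= f x)%E ->
  (\int[normal_prob m s]_x f x = \int[mu]_x (f x * (normal_pdf m s x)%:E))%E.
Proof.
move=> mf f0; pose f_ := nnsfun_approx measurableT mf.
have mpdf : measurable_fun [set: R] (EFin \o normal_pdf m s).
  by apply/measurable_EFinP; exact: measurable_normal_pdf.
have p0 x : (0 <= (normal_pdf m s x)%:E)%E by rewrite lee_fin normal_pdf_ge0.
transitivity (limn (fun n => \int[normal_prob m s]_x (f_ n x)%:E)%E).
  rewrite -monotone_convergence//=.
  - by apply: eq_integral => x _; apply/esym/cvg_lim => //; exact: (cvg_nnsfun_approx measurableT mf).
  - by move=> n; apply/measurable_EFinP; exact: (measurable_funP (f_ n)).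
  - by move=> n x _; rewrite lee_fin.
  - by move=> x _ a b ab; rewrite lee_fin; have /lefP := nd_nnsfun_approx measurableT mf ab; exact.
under eq_fun do rewrite integral_normal_prob_nnsfun.
rewrite -monotone_convergence//=.
- apply: eq_integral => x _; apply/cvg_lim => //; apply: cvgeMr => //.
  by apply: (cvg_nnsfun_approx measurableT mf).
- move=> n; apply: emeasurable_funM => //.
  by apply/measurable_EFinP; exact: (measurable_funP (f_ n)).
- by move=> n x _; rewrite mule_ge0// lee_fin.
- move=> x _ a b ab; rewrite lee_wpmul2r// lee_fin.
  have /lefP := nd_nnsfun_approx measurableT mf ab; exact.
Qed.

(** The density is even and Lebesgue measure is invariant under reflection; the zero mean follows
    from this symmetry. *)
Lemma normal_prob_oppr (s : R) (B : set R) : s != 0 -> measurable B ->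
  normal_prob 0 s ((-%R : R -> R) @^-1` B) = normal_prob 0 s B.
Proof.
move=> s0 mB; rewrite /normal_prob.
have mpdf : measurable_fun [set: R] (EFin \o normal_pdf 0 s).
  by apply/measurable_EFinP; exact: measurable_normal_pdf.
have pN x : normal_pdf 0 s (- x) = normal_pdf 0 s x.
  by rewrite normal_pdfE// /normal_fun !subr0 mulNr sqrrN mulNr.
have := @ge0_integral_pushforward _ _ _ _ R (-%R : measurableTypeR R -> measurableTypeR R)
  (@oppr_measurable R setT) mu B (EFin \o normal_pdf 0 s) mB.
move=> /(_ (measurable_funTS mpdf)) h.
transitivity (\int[mu]_(x in (-%R : R -> R) @^-1` B) ((EFin \o normal_pdf 0 s) \o -%R) x)%E.
  by apply: eq_integral => x _ /=; rewrite pN.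
rewrite -h; last by move=> y _ /=; rewrite lee_fin normal_pdf_ge0.
by apply: eq_measure_integral => A mA AB; exact: lebesgue_measureN.
Qed.

(** The density of standard deviation sqrt 2 s decays slowly enough to absorb x^4. With y = x^2/(4
    s^2) one has x^4 = 16 s^4 y^2, y^2 e^-y <= 2 and 1/sqrt 2 >= 1/2, whence the factor 64. *)
Lemma normal_fourth_moment (s : R) : 0 < s ->
  (\int[normal_prob 0 s]_x (x ^+ 4)%:E <= (64 * s ^+ 4)%:E)%E.
Proof.
move=> s0; have s0' : s != 0 by rewrite gt_eqF.
have m4 : measurable_fun [set: R] (fun x : R => (x ^+ 4)%:E).
  by apply/measurable_EFinP; exact: measurable_funX.
have p4 (x : R) : 0 <= x ^+ 4 by rewrite exprn_even_ge0.
rewrite ge0_integral_normal_prob//.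
have q2 : 0 < Num.sqrt 2 :> R by rewrite sqrtr_gt0.
have q2s : Num.sqrt 2 * s != 0 by rewrite mulf_neq0 ?gt_eqF.
have q22 : Num.sqrt 2 ^+ 2 = 2 :> R by rewrite sqr_sqrtr.
apply: (@le_trans _ _ (\int[mu]_x ((64 * s ^+ 4)%:E * (normal_pdf 0 (Num.sqrt 2 * s) x)%:E))%E).
  apply: ge0_le_integral => //.
  - by move=> x _; rewrite -EFinM lee_fin mulr_ge0// normal_pdf_ge0.
  - apply: emeasurable_funM => //.
    by apply/measurable_EFinP; exact: measurable_normal_pdf.
  - apply: emeasurable_funM => //.
    by apply/measurable_EFinP; exact: measurable_normal_pdf.
  - move=> x _; rewrite -!EFinM lee_fin !normal_pdfE// normal_peakM//.
    set k := normal_peak s.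
    have k0 : 0 <= k by exact: normal_peak_ge0.
    rewrite /normal_fun !subr0 exprMn q22.
    set y := x ^+ 2 / (4 * s ^+ 2).
    have -> : - x ^+ 2 / (s ^+ 2 *+ 2) = - y - y by rewrite /y; field.
    have -> : - x ^+ 2 / (2 * s ^+ 2 *+ 2) = - y by rewrite /y; field.
    have -> : x ^+ 4 = 16 * s ^+ 4 * y ^+ 2 by rewrite /y; field.
    have y0 : 0 <= y by rewrite divr_ge0 ?sqr_ge0// mulr_ge0// sqr_ge0.
    rewrite expRD; have e0 := expR_gt0 (- y).
    have h : y ^+ 2 * expR (- y) <= 2.
      rewrite expRN ler_pdivrMr ?expR_gt0//.
      have : 1 + y ^+ 2 / 2 <= expR y := expR_ge1Dxn 1 y0; lra.
    have s40 : 0 <= s ^+ 4 by rewrite exprn_even_ge0.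
    have i2 : 1 / 2 <= (Num.sqrt 2)^-1 :> R.
      rewrite div1r lef_pV2 ?posrE//.
      by rewrite -(ler_pXn2r (n := 2)) ?nnegrE// ?ltW// q22; lra.
    rewrite [leLHS](_ : _ = (16 * (y ^+ 2 * expR (- y))) * (s ^+ 4 * (k * expR (- y)))); last by ring.
    rewrite [leRHS](_ : _ = (64 * (Num.sqrt 2)^-1) * (s ^+ 4 * (k * expR (- y)))); last by ring.
    rewrite ler_wpM2r//; last by lra.
    by rewrite !mulr_ge0// ltW.
rewrite ge0_integralZl//.
- by rewrite integral_normal_pdf mule1.
- by apply/measurable_EFinP; exact: measurable_normal_pdf.
- by move=> x _; rewrite lee_fin normal_pdf_ge0.
- by rewrite lee_fin mulr_ge0// exprn_even_ge0.
Qed.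

Local Notation "'Nx' s f" := (Rintegral (normal_prob 0 s) [set: R] f) (at level 10, s at level 9, f at level 9).

Lemma normal_fourth_integrable (s : R) : 0 < s ->
  integrable_rv (normal_prob 0 s) (fun x : R => x ^+ 4).
Proof.
move=> s0; apply/integrableP; split.
  by apply/measurable_EFinP; exact: measurable_funX.
under eq_integral.
  move=> x _; rewrite /= ger0_norm; last by rewrite exprn_even_ge0.
  over.
by rewrite (le_lt_trans (normal_fourth_moment s0))// ltry.
Qed.

Lemma normal_square_integrable (s : R) : 0 < s ->
  square_integrable_rv (normal_prob 0 s) (fun x : R => x ^+ 2).
Proof.
move=> s0; split; first exact: measurable_funX.
under [X in integrable_rv _ X]eq_fun do rewrite -exprM.
exact: normal_fourth_integrable.
Qed.

Lemma normal_id_integrable (s : R) : 0 < s ->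
  square_integrable_rv (normal_prob 0 s) (fun x : R => x).
Proof.
move=> s0; split => //.
exact: (square_integrable_integrable (normal_square_integrable s0)).
Qed.

Lemma normal_mean (s : R) : 0 < s ->
  \int[normal_prob 0 s]_x x = 0.
Proof.
move=> s0; have s0' : s != 0 by rewrite gt_eqF.
pose N : {measure set (measurableTypeR R) -> \bar R} := normal_prob 0 s.
have mid : measurable_fun [set: R] (fun x : R => x%:E) by exact/measurable_EFinP.
have i1 : N.-integrable setT (fun x : R => x%:E).
  exact: (square_integrable_integrable (normal_id_integrable s0)).
have := @integral_pushforward _ _ _ _ R (-%R : measurableTypeR R -> measurableTypeR R)
  (@oppr_measurable R setT) N setT (fun x : R => x%:E) mid.
rewrite preimage_setT => h.
suff : \int[N]_x x = - \int[N]_x x by move=> ?; rewrite -/N; lra.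
rewrite -mulN1r -RintegralZl//; congr fine.
under [RHS]eq_integral do rewrite mulN1r.
rewrite -[RHS]h//.
  by apply: eq_measure_integral => A mA _; rewrite /N /= /pushforward normal_prob_oppr.
under [X in _.-integrable _ X]eq_fun do rewrite -mulN1r /=.
exact: (integrableZl measurableT (-1) i1).
Qed.

(* The exponential of [- (b^2 - 1) x^2 / (2 s^2)] turns the density of standard
   deviation [s] into that of standard deviation [s / b]; its convexity bounds
   brackets the second moment between values that meet as [b] tends to [1]. *)
Lemma normal_exp_square (s b : R) : 0 < s -> 0 < b ->
  (\int[normal_prob 0 s]_x (expR (- (b ^+ 2 - 1) * x ^+ 2 / (2 * s ^+ 2)))%:E
   = (b^-1)%:E)%E.
Proof.
move=> s0 b0; have s0' : s != 0 by rewrite gt_eqF.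
have b0' : b != 0 by rewrite gt_eqF.
have bs0 : b^-1 * s != 0 by rewrite mulf_neq0// invr_eq0.
have mexp : measurable_fun [set: R]
    (fun x : R => (expR (- (b ^+ 2 - 1) * x ^+ 2 / (2 * s ^+ 2)))%:E).
  apply/measurable_EFinP; apply: measurableT_comp => //.
  apply: measurable_funM; last exact: measurable_cst.
  apply: measurable_funM; first exact: measurable_cst.
  exact: measurable_funX.
have exp0 (x : R) : (0 <= (expR (- (b ^+ 2 - 1) * x ^+ 2 / (2 * s ^+ 2)))%:E)%E.
  by rewrite lee_fin expR_ge0.
rewrite ge0_integral_normal_prob//.
transitivity (\int[mu]_x ((b^-1)%:E * (normal_pdf 0 (b^-1 * s) x)%:E))%E.
  apply: eq_integral => x _; rewrite -!EFinM; congr EFin.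
  rewrite !normal_pdfE// normal_peakM ?invr_gt0// invrK.
  rewrite -[in RHS]mulrA mulKf// mulrCA /normal_fun -expRD !subr0; congr (_ * expR _).
  by field; rewrite s0' b0'.
rewrite ge0_integralZl//.
- by rewrite integral_normal_pdf mule1.
- by apply/measurable_EFinP; exact: measurable_normal_pdf.
- by move=> x _; rewrite lee_fin normal_pdf_ge0.
- by rewrite lee_fin invr_ge0 ltW.
Qed.

Lemma normal_variance (s : R) : 0 < s ->
  \int[normal_prob 0 s]_x (x ^+ 2) = s ^+ 2.
Proof.
move=> s0; have s0' : s != 0 by rewrite gt_eqF.
set m := \int[_]_x _.
pose N : probability (measurableTypeR R) R := normal_prob 0 s.
have i2 : integrable_rv N (fun x : R => x ^+ 2).
  exact: (square_integrable_integrable (normal_square_integrable s0)).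
(* The inequality 1 + t <= e^t, integrated at the exponent of [normal_exp_square]. *)
have key (b : R) : 0 < b -> 1 - (b ^+ 2 - 1) * (m / (2 * s ^+ 2)) <= b^-1.
  move=> b0; pose g (x : R) := expR (- (b ^+ 2 - 1) * x ^+ 2 / (2 * s ^+ 2)).
  have ig : integrable_rv N g.
    apply/integrableP; split.
      apply/measurable_EFinP; apply: measurableT_comp => //.
      apply: measurable_funM; last exact: measurable_cst.
      apply: measurable_funM; first exact: measurable_cst.
      exact: measurable_funX.
    under eq_integral do rewrite /= ger0_norm ?expR_ge0//.
    by rewrite normal_exp_square// ltry.
  have -> : b^-1 = \int[N]_x g x by rewrite /Rintegral /N /g normal_exp_square.
  pose c := - (b ^+ 2 - 1) / (2 * s ^+ 2).
  have -> : 1 - (b ^+ 2 - 1) * (m / (2 * s ^+ 2)) =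
      \int[N]_x (1 + c * x ^+ 2).
    rewrite (@ExD _ _ _ N (fun=> 1) (fun x : R => c * x ^+ 2)).
    - by rewrite Ex_cst (@ExZ _ _ _ N c)// -/m /c; field.
    - by apply: (@integrable_rv_bounded _ _ _ N _ 1) => // x; rewrite normr1.
    - exact: integrable_rvZ.
  apply: (@Ex_le _ _ _ N (fun x : R => 1 + c * x ^+ 2) g) => //.
    suff i1 : integrable_rv N (fun=> 1) by exact: (integrable_rvD i1 (integrable_rvZ c i2)).
    by apply: (@integrable_rv_bounded _ _ _ N _ 1) => // x; rewrite normr1.
  move=> x; apply: le_trans (expR_ge1Dx _); rewrite /g /c.
  by rewrite le_eqVlt; apply/orP; left; apply/eqP; field.
set r := m / (2 * s ^+ 2) in key.
suff rE : r = 1 / 2.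
  have : m = r * (2 * s ^+ 2) by rewrite /r divfK// mulf_neq0// expf_neq0.
  by rewrite rE => ->; field.
(* After multiplication by b, the inequality [key] has the factor 1 - b on both sides; its sign
   changes at b = 1. This yields opposite bounds on the two sides, which at b = 1 would both read 2
   r = 1. *)
have up (b : R) : 0 < b < 1 -> r * (b * (b + 1)) <= 1.
  move=> /andP[b0 b1]; have := key b b0.
  rewrite -(ler_pM2r b0) mulVf ?gt_eqF// => h.
  have : (1 - b) * (r * (b * (b + 1))) <= (1 - b) * 1 by lra.
  by rewrite ler_pM2l// subr_gt0.
have dn (b : R) : 1 < b -> 1 <= r * (b * (b + 1)).
  move=> b1; have b0 : 0 < b by rewrite (lt_trans _ b1).
  have := key b b0.
  rewrite -(ler_pM2r b0) mulVf ?gt_eqF// => h.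
  have : (b - 1) * 1 <= (b - 1) * (r * (b * (b + 1))) by lra.
  by rewrite ler_pM2l// subr_gt0.
have r0 : 0 <= r.
  rewrite divr_ge0//; last by rewrite mulr_ge0// sqr_ge0.
  by apply: Ex_ge0 => x; exact: sqr_ge0.
(* If 2 r differed from 1, a [b] at a distance [e] from 1, with [e] small compared with the
   difference, would contradict [up] or [dn]. *)
apply/eqP; rewrite eq_le; apply/andP; split; rewrite leNgt; apply/negP => h.
  have r1 : 0 < 2 * r - 1 by lra.
  pose e := Num.min (1 / 2) ((2 * r - 1) / (6 * r)).
  have r6 : 0 < 6 * r by lra.
  have e0 : 0 < e by rewrite /e lt_min divr_gt0//= divr_gt0.
  have e1 : e <= 1 / 2 by rewrite /e ge_min lexx.
  have e2 : e * (6 * r) <= 2 * r - 1.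
    by rewrite -ler_pdivlMr// /e ge_min lexx orbT.
  have := up (1 - e); rewrite subr_gt0 (le_lt_trans e1) ?ltrBlDr ?ltrDl//; last by lra.
  rewrite e0 /= => /(_ isT); have := mulr_ge0 r0 (sqr_ge0 e); nra.
have r1 : 0 < 1 - 2 * r by lra.
pose e := Num.min 1 ((1 - 2 * r) / 4).
have e0 : 0 < e by rewrite /e lt_min ltr01/= divr_gt0.
have e1 : e <= 1 by rewrite /e ge_min lexx.
have e2 : e * 4 <= 1 - 2 * r.
  by rewrite -ler_pdivlMr// /e ge_min lexx orbT.
have := dn (1 + e); rewrite ltrDl e0 => /(_ isT); have := mulr_ge0 r0 (sqr_ge0 e); nra.
Qed.

End NormalMoments.

(** * Transition probabilities of the two-state chain *)

Section Chain.
Context {R : realType}.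
Variable lambda : 'I_2 -> R.
Hypothesis lambda_gt0 : forall i, 0 < lambda i.

Lemma ord2_neq (i j : 'I_2) : (j != i) = (j == rev_ord i).
Proof. by move: i j => [[|[|[]]]//= ?] [[|[|[]]]//= ?]. Qed.

Definition total_rate := \sum_i lambda i.

Lemma total_rateE i : total_rate = lambda i + lambda (rev_ord i).
Proof.
rewrite /total_rate (bigD1 i)//= (bigD1 (rev_ord i)) ?ord2_neq//=.
by rewrite big_pred0 ?addr0// => j; rewrite ord2_neq andbN.
Qed.

Lemma total_rate_gt0 : 0 < total_rate.
Proof. by rewrite (total_rateE ord0) addr_gt0. Qed.

(** The off-diagonal entry of e^(hQ) in closed form, see [transition_jump]. *)
Definition jump_prob (i : 'I_2) (h : R) :=
  lambda i / total_rate * (1 - expR (- (total_rate * h))).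

Lemma jump_prob_ge0 i h : 0 <= h -> 0 <= jump_prob i h.
Proof.
move=> h0; have L0 := total_rate_gt0.
apply: mulr_ge0; first by rewrite divr_ge0// ltW.
by rewrite subr_ge0 -expR0 ler_expR oppr_le0 mulr_ge0// ltW.
Qed.

Lemma jump_prob_le i h : 0 <= h -> jump_prob i h <= lambda i * h.
Proof.
move=> h0; have L0 := total_rate_gt0.
rewrite /jump_prob -mulrA ler_pM2l// mulrC ler_pdivrMr//.
by have := expR_ge1Dx (- (total_rate * h)); lra.
Qed.

Lemma jump_prob_approx i h : 0 <= h ->
  `|jump_prob i h - h * lambda i| <= lambda i * total_rate * h ^+ 2.
Proof.
move=> h0; have L0 := total_rate_gt0; have l0 := lambda_gt0 i.
rewrite ler0_norm; last by rewrite subr_le0 mulrC jump_prob_le.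
set y := total_rate * h.
have y0 : 0 <= y by rewrite mulr_ge0// ltW.
(* Because (1 - y + y^2)(1 + y) = 1 + y^3 >= 1 and 1 + y <= e^y. *)
have e1 : expR (- y) <= 1 - y + y ^+ 2.
  rewrite expRN invf_ple ?posrE ?expR_gt0//; last by nra.
  apply: le_trans (expR_ge1Dx y).
  by rewrite -[leLHS]mul1r ler_pdivrMr; nra.
rewrite /jump_prob -/y opprB.
rewrite [leLHS](_ : _ = lambda i / total_rate * (y - 1 + expR (- y))); last first.
  by rewrite /y; field; rewrite gt_eqF.
rewrite [leRHS](_ : _ = lambda i / total_rate * y ^+ 2); last first.
  by rewrite /y; field; rewrite gt_eqF.
by rewrite ler_pM2l ?divr_gt0//; lra.
Qed.

(** The matrix has rank one and trace minus the total rate, so its square is minus the total rate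
    times itself. *)
Lemma regime_rates_exp k :
  regime_rates lambda ^+ k.+1 = (- total_rate) ^+ k *: regime_rates lambda.
Proof.
have Q2 : regime_rates lambda * regime_rates lambda =
    (- total_rate) *: regime_rates lambda.
  apply/matrixP => i j; rewrite !mxE (bigD1 i)//= (bigD1 (rev_ord i)) ?ord2_neq//=.
  rewrite big_pred0 ?addr0; last by move=> l; rewrite ord2_neq andbN.
  rewrite !mxE eqxx (total_rateE i).
  have -> : (i == rev_ord i) = false by apply/negbTE; rewrite ord2_neq rev_ordK.
  have [<-|] := eqVneq i j.
    have -> : (rev_ord i == i) = false by apply/negbTE; rewrite ord2_neq.
    by ring.
  rewrite eq_sym ord2_neq => /eqP ->; rewrite eqxx; ring.
elim: k => [|k IH]; first by rewrite expr1 expr0 scale1r.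
by rewrite exprS IH -scalerAr Q2 scalerA -exprSr.
Qed.

Lemma transition_jump i h :
  transition_matrix (regime_rates lambda) h i (rev_ord i) = jump_prob i h.
Proof.
have L0 := total_rate_gt0; have L0' : total_rate != 0 by rewrite gt_eqF.
rewrite mxE; set x := - (total_rate * h).
(* The term k = 0 vanishes off the diagonal; the boolean cancels the first exponential coefficient
   there and sums up to the 1 of 1 - e^(-total h). *)
have tE k : h ^+ k / k`!%:R * (regime_rates lambda ^+ k) i (rev_ord i) =
    lambda i / total_rate * ((k == 0%N)%:R - exp_coeff x k).
  case: k => [|k].
    rewrite expr0 mxE /exp_coeff/= !expr0.
    have -> : (i == rev_ord i) = false by apply/negbTE; rewrite ord2_neq rev_ordK.
    by rewrite fact0 divr1 subrr !mulr0.
  rewrite regime_rates_exp !mxE /=.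
  have -> : (i == rev_ord i) = false by apply/negbTE; rewrite ord2_neq rev_ordK.
  have -> : x = (- total_rate) * h by rewrite /x mulNr.
  rewrite /exp_coeff/= exprMn [(- total_rate) ^+ k.+1]exprS.
  by field; rewrite L0' pnatr_eq0 -lt0n fact_gt0.
apply/cvg_lim => //.
have : lambda i / total_rate * (1 - series (exp_coeff x) n) @[n --> \oo] -->
    jump_prob i h.
  apply: cvgMl_tmp; apply: cvgB; first exact: cvg_cst.
  exact: is_cvg_series_exp_coeff.
rewrite -cvg_shiftS => H; rewrite -cvg_shiftS; apply: cvg_trans H.
apply: near_eq_cvg; near=> n; rewrite /= /series/=.
under [RHS]eq_bigr do rewrite tE.
rewrite -mulr_sumr sumrB; congr (_ * (_ - _)).
by rewrite big_nat_recl//= big1 ?addr0.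
Unshelve. all: by end_near.
Qed.

End Chain.

(** * Integral inequalities involving functions not known to be measurable *)

Section NonMeasurableBounds.
Local Open Scope ereal_scope.
Context d (T : measurableType d) (R : realType) (mu : {measure set T -> \bar R}).

(* The integral of a nonnegative function is a supremum over the simple
   functions below it, hence monotone without any measurability. *)
Lemma ge0_le_integral_nonmeasurable (D E : set T) (f g : T -> \bar R) :
  D `<=` E -> (forall x, 0 <= f x) -> (forall x, D x -> f x <= g x) ->
  (forall x, 0 <= g x) ->
  \int[mu]_(x in D) f x <= \int[mu]_(x in E) g x.
Proof.
move=> DE f0 fg g0; rewrite integral_mkcond [leRHS]integral_mkcond.
have h0 x : 0 <= (f \_ D) x by apply: erestrict_ge0.
have h1 x : 0 <= (g \_ E) x by apply: erestrict_ge0.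
rewrite !ge0_integralTE//; apply: le_ereal_sup => _ [h /= hf <-].
exists h => //= x; apply: le_trans (hf x) _; rewrite !patchE.
case: ifPn => xD; last by case: ifPn.
by rewrite mem_set ?fg//; [exact/set_mem|exact/DE/set_mem].
Qed.

(** Here [a] stands for a time integral along a path, whose measurability in [w] is unknown. The
    positive part of f - g, cut off on the null set, is measurable and lies below [a] everywhere; it
    takes the place of [a] in the additivity of the integral, and monotonicity restores [a]. *)
Lemma ge0_integral_le_add (D : set T) (f a g : T -> \bar R) : measurable D ->
  measurable_fun [set: T] f -> measurable_fun [set: T] g ->
  (forall x, 0 <= f x) -> (forall x, 0 <= a x) -> (forall x, 0 <= g x) ->
  {ae mu, forall x, f x <= a x + g x} ->
  \int[mu]_(x in D) f x <= \int[mu]_(x in D) a x + \int[mu]_(x in D) g x.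
Proof.
move=> mD mf mg f0 a0 g0 [N [mN N0 fag]].
pose k := ((f \- g)^\+ \_ (~` N))%E.
have mk : measurable_fun [set: T] k.
  apply/(measurable_restrictT _ (measurableC mN)).
  by apply: measurable_funTS; apply: measurable_funepos; exact: emeasurable_funB.
have k0 x : 0 <= k x by apply: erestrict_ge0.
have fk x : ~ N x -> f x <= k x + g x.
  move=> Nx; rewrite /k patchE mem_set// funeposE/=.
  have [gfin|] := boolP (g x \is a fin_num).
    by rewrite -leeBlDr// le_max lexx.
  rewrite ge0_fin_numE// -leNgt leye_eq => /eqP ->.
  by rewrite addey ?leey// gt_eqF// (lt_le_trans (ltNyr 0))// le_max lexx orbT.
have ka x : k x <= a x.
  rewrite /k patchE; case: ifPn => [/set_mem/= Nx|_]; last exact: a0.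
  have fx : f x <= a x + g x by apply: contrapT => H; apply/Nx/fag.
  rewrite funeposE ge_max a0 andbT.
  have [gfin|] := boolP (g x \is a fin_num); first by rewrite leeBlDr.
  by rewrite ge0_fin_numE// -leNgt leye_eq => /eqP ->; rewrite addeNy leNye.
apply: (@le_trans _ _ (\int[mu]_(x in D) (k x + g x))).
  apply: ae_ge0_le_integral => //.
  - exact: measurable_funTS.
  - by move=> x _; exact: adde_ge0.
  - by apply: measurable_funTS; exact: emeasurable_funD.
  - by exists N; split=> // x /=; apply: contra_notP => Nx _; exact: fk.
rewrite ge0_integralD//; [|exact: measurable_funTS|exact: measurable_funTS].
by rewrite leeD2r// ge0_le_integral_nonmeasurable.
Qed.

End NonMeasurableBounds.

(** * Step functions, refined grids and Riemann sums *)

Section StepFunctions.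
Context {R : realType}.
Local Notation mu := (@lebesgue_measure R).
Implicit Types (tau e : nat -> R) (n : nat) (Z : R -> R).

Lemma monotone_grid tau n j k : (forall l, (l < n)%N -> tau l <= tau l.+1) ->
  (j <= k <= n)%N -> tau j <= tau k.
Proof.
move=> mono /andP[jk kn]; elim: k jk kn => [|k IH].
  by rewrite leqn0 => /eqP -> _.
rewrite leq_eqVlt ltnS => /orP[/eqP -> //|jk] kn.
by apply: le_trans (IH jk (ltnW kn)) (mono _ kn).
Qed.

Lemma itv_indicE (a b r : R) : a <= b ->
  \1_(`]a, b]%classic) r = (r <= b)%R%:R - (r <= a)%R%:R :> R.
Proof.
move=> ab; rewrite indicE mem_setE in_itv/=.
case: (leP r a) => ra; last by rewrite subr0.
by rewrite (le_trans ra ab) subrr.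
Qed.

(** The cells of a monotone grid are disjoint, so that at most one summand is non-zero. *)
Lemma sqr_step e tau n r : (forall k, (k < n)%N -> tau k <= tau k.+1) ->
  (\sum_(k < n) e k * \1_(`]tau k, tau k.+1]%classic) r) ^+ 2 =
  \sum_(k < n) e k ^+ 2 * \1_(`]tau k, tau k.+1]%classic) r.
Proof.
move=> mono.
have [[k0 hk0]|none] := pselect (exists k : 'I_n, (`]tau k, tau k.+1]%classic : set R) r).
  have other (k : 'I_n) : k != k0 -> \1_(`]tau k, tau k.+1]%classic) r = 0 :> R.
    move=> kk0; rewrite indicE memNset//= in_itv/= => /andP[h1 h2].
    move: hk0; rewrite /= in_itv/= => /andP[h3 h4].
    case: (ltngtP k k0) => kk.
    - have : tau k.+1 <= tau k0 by apply: (monotone_grid mono); rewrite kk ltnW.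
      lra.
    - have : tau k0.+1 <= tau k by apply: (monotone_grid mono); rewrite kk ltnW.
      lra.
    - by move: kk0; rewrite (val_inj kk) eqxx.
  have one : \1_(`]tau k0, tau k0.+1]%classic) r = 1 :> R by rewrite indicE mem_set.
  rewrite (bigD1 k0)//= [in RHS](bigD1 k0)//= one !mulr1.
  rewrite big1; last by move=> k kk0; rewrite other// mulr0.
  by rewrite big1 ?addr0// => k kk0; rewrite other// mulr0.
rewrite !big1 ?expr0n// => k _; rewrite indicE memNset ?mulr0// => h; apply: none; by exists k.
Qed.

Lemma measurable_step e tau n (D : set R) :
  measurable_fun D (fun r => \sum_(k < n) e k * \1_(`]tau k, tau k.+1]%classic) r : R).
Proof.
apply: measurable_funTS.
apply: (@measurable_fun_approximation.measurable_sum _ _ _ _ _ _ ( fun (k : 'I_n) r => e k * \1_(`]tau k, tau k.+1]%classic) r)) => k.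
by apply: measurable_funM => //; apply: measurable_indic; exact: measurable_itv.
Qed.

Lemma integral_step e tau n s u : (forall k, (k < n)%N -> tau k <= tau k.+1) ->
  (forall k, (k < n)%N -> 0 <= e k) -> s <= tau 0%N -> tau n <= u ->
  (\int[mu]_(r in `]s, u])
     (\sum_(k < n) e k * \1_(`]tau k, tau k.+1]%classic) r)%:E =
  (\sum_(k < n) e k * (tau k.+1 - tau k))%:E)%E.
Proof.
move=> mono e0 s0 un; under eq_integral do rewrite -sumEFin.
rewrite -sumEFin (@ge0_integral_sum _ _ _ mu _ _ _ (fun (k : 'I_n) r => (e k * \1_(`]tau k, tau k.+1]%classic) r)%:E))//; first last.
- by move=> k r _; rewrite lee_fin mulr_ge0 ?e0// indicE.
- move=> k; apply/measurable_EFinP; apply: measurable_funTS.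
  by apply: measurable_funM => //; apply: measurable_indic; exact: measurable_itv.
apply: eq_bigr => k _; under eq_integral do rewrite EFinM.
transitivity ((e k)%:E *
    \int[mu]_(r in `]s, u]) (\1_(`]tau k, tau k.+1]%classic) r : R)%:E)%E.
  apply: ge0_integralZl.
  - exact: measurable_itv.
  - apply/measurable_EFinP; apply: measurable_funTS; apply: measurable_indic.
    exact: measurable_itv.
  - by move=> r _; rewrite lee_fin indicE.
  - by rewrite lee_fin e0.
rewrite integral_indic; [|exact: measurable_itv|exact: measurable_itv].
rewrite (_ : `]tau k, tau k.+1]%classic `&` `]s, u]%classic = `]tau k, tau k.+1]%classic).
  rewrite /= lebesgue_measure_itv/= lte_fin.
  have := mono k (ltn_ord k); rewrite le_eqVlt => /orP[/eqP <-|lt].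
    by rewrite ltxx subrr mulr0 mule0.
  by rewrite lt -EFinD EFinM.
apply/seteqP; split => [r []//|r /= hr]; split => //.
move: hr; rewrite /= !in_itv/= => /andP[h1 h2].
have h3 : tau 0%N <= tau k.
  by apply: (monotone_grid mono); rewrite /= ltnW.
have h4 : tau k.+1 <= tau n.
  by apply: (monotone_grid mono); rewrite ltn_ord /=.
by rewrite (le_lt_trans (le_trans s0 h3) h1) (le_trans h2 (le_trans h4 un)).
Qed.

(* The increments of a step sum over [[s, u]] minus those of the constant [v],
   written as one step sum: the grid is clamped to [[s, u]] and completed by the
   two end points. *)
Definition refined_time (t : nat -> R) n s u k : R :=
  if k is k'.+1 then (if (k' <= n)%N then Num.max s (Num.min (t k') u) else u)
  else s.

Definition refined_coef (c : nat -> R) n v k : R :=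
  if k is k'.+1 then (if (k' < n)%N then c k' - v else - v) else - v.

Lemma refined_time_mono t n s u : s <= u ->
  (forall k, (k < n)%N -> t k <= t k.+1) ->
  forall k, (k < n.+2)%N -> refined_time t n s u k <= refined_time t n s u k.+1.
Proof.
move=> su mono [|k] /=; first by rewrite le_max lexx.
rewrite ltnS => kn.
have -> : (k <= n)%N by [].
case: ifPn => kn1; last by rewrite ge_max su ge_min lexx orbT.
rewrite ge_max le_max lexx/= le_max; apply/orP; right.
by rewrite le_min ge_min mono//= ge_min lexx orbT.
Qed.

(** An increment of [Z] along the grid clamped to [s, u] is the difference of the increments along
    the grids stopped at [u] and at [s] ([clE]); the part in [v] telescopes. *)
Lemma refined_sum t c n s u v Z : s <= u ->
  \sum_(k < n.+2) refined_coef c n v k *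
    (Z (refined_time t n s u k.+1) - Z (refined_time t n s u k)) =
  \sum_(k < n) c k * (Z (Num.min (t k.+1) u) - Z (Num.min (t k) u)) -
  \sum_(k < n) c k * (Z (Num.min (t k.+1) s) - Z (Num.min (t k) s)) -
  v * (Z u - Z s).
Proof.
move=> su; set tau := refined_time t n s u.
pose a k : R := if k is k'.+1 then (if (k' < n)%N then c k' else 0) else 0.
have eE k : refined_coef c n v k = a k - v.
  by case: k => [|k] /=; [rewrite sub0r|case: ifP; rewrite ?sub0r].
under eq_bigr do rewrite eE mulrBl.
rewrite sumrB; congr (_ - _); last first.
  rewrite -mulr_sumr; congr (_ * _).
  rewrite -(big_mkord xpredT (fun k => Z (tau k.+1) - Z (tau k))) telescope_sumr//.
  by rewrite /tau /= ltnn.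
rewrite big_ord_recl/= mul0r add0r big_ord_recr/= /bump/= !add1n ltnn mul0r addr0.
rewrite -sumrB; apply: eq_bigr => k _; rewrite !add1n /= ltn_ord -mulrBr.
have clE x : Z (Num.max s (Num.min x u)) = Z (Num.min x u) - Z (Num.min x s) + Z s.
  have [xs|sx] := leP x s.
    have xu := le_trans xs su.
    by rewrite (min_idPl xu) (max_idPl xs) subrr add0r.
  have sm : s <= Num.min x u by rewrite le_min (ltW sx).
  by rewrite (max_idPr sm) subrK.
by rewrite (ltnW (ltn_ord k)) !clE; congr (_ * _); ring.
Qed.

(** The indicator of a cell at [r] is the increment over that cell of the function x |-> 1 if r <=
    x, else 0; so this is [refined_sum] for that function. *)
Lemma refined_value t c n s u v r : s <= u -> s < r <= u ->
  (forall k, (k < n)%N -> t k <= t k.+1) ->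
  \sum_(k < n.+2) refined_coef c n v k * \1_(`]refined_time t n s u k,
     refined_time t n s u k.+1]%classic) r =
  \sum_(k < n) c k * \1_(`]t k, t k.+1]%classic) r - v.
Proof.
move=> su /andP[sr ru] mono.
pose Z x : R := (r <= x)%R%:R.
under eq_bigr => k _.
  rewrite itv_indicE; last by apply: refined_time_mono => //; exact: ltn_ord.
  over.
rewrite (@refined_sum t c n s u v Z su).
have Zs x : Z (Num.min x s) = 0.
  by rewrite /Z le_min [r <= s]leNgt sr andbF.
have Zu x : Z (Num.min x u) = Z x by rewrite /Z le_min ru andbT.
under [X in _ - X - _]eq_bigr do rewrite !Zs subrr mulr0.
rewrite [X in _ - X - _]big1 ?subr0//; congr (_ - _).
  by apply: eq_bigr => k _; rewrite !Zu /Z itv_indicE// mono.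
have -> : Z s = 0 by rewrite /Z leNgt sr.
by rewrite /Z ru subr0 mulr1.
Qed.

Definition uniform_grid (s u : R) m k : R := s + (u - s) * k%:R / m.+1%:R.

Lemma uniform_grid_mono s u m k : s <= u ->
  uniform_grid s u m k <= uniform_grid s u m k.+1.
Proof.
move=> su; rewrite lerD2l ler_pM2r ?invr_gt0// ler_wpM2l ?subr_ge0//.
by rewrite ler_nat.
Qed.

Lemma uniform_grid_step s u m k :
  uniform_grid s u m k.+1 - uniform_grid s u m k = (u - s) / m.+1%:R.
Proof.
have N0 : m.+1%:R != 0 :> R by rewrite pnatr_eq0.
by rewrite /uniform_grid -[k.+1%:R]natr1; move: (m.+1%:R) N0 => N N0; field.
Qed.

Lemma uniform_grid0 s u m : uniform_grid s u m 0 = s.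
Proof. by rewrite /uniform_grid mulr0 mul0r addr0. Qed.

Lemma uniform_gridn s u m : uniform_grid s u m m.+1 = u.
Proof.
have N0 : m.+1%:R != 0 :> R by rewrite pnatr_eq0.
by rewrite /uniform_grid; move: (m.+1%:R) N0 => N N0; field.
Qed.

(** The right end point of the cell containing [r] lies at most one mesh to the right of [r], where
    the path still has its value at [r] once the mesh is small. Left end points would not have this
    property. *)
Lemma right_continuous_grid (I : Type) (g : R -> I) (phi : I -> R) s u r :
  (forall t, 0 <= t -> \forall s \near t^'+, g s = g t) -> 0 <= s -> s < r <= u ->
  \sum_(k < m.+1) phi (g (uniform_grid s u m k.+1)) *
     \1_(`]uniform_grid s u m k, uniform_grid s u m k.+1]%classic) r
    @[m --> \oo] --> phi (g r).
Proof.
move=> rc s0 /andP[sr ru]; have r0 : 0 <= r by rewrite ltW// (le_lt_trans s0).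
have [e /= e0 he] := rc r r0.
have us : 0 < u - s by rewrite subr_gt0 (lt_le_trans sr).
apply: (@cvg_trans _ (phi (g r) @[_ --> \oo])); last exact: cvg_cst.
apply: near_eq_cvg; near=> m.
have small : (u - s) / m.+1%:R < e.
  rewrite ltr_pdivrMr// mulrC -ltr_pdivrMr//.
  rewrite (@lt_le_trans _ _ (Num.truncn ((u - s) / e)).+1%:R)//; last first.
    by rewrite ler_nat ltnS; near: m; exact: nbhs_infty_ge.
  exact: truncnS_gt.
set tau := uniform_grid s u m.
have mono k : tau k <= tau k.+1 by apply: uniform_grid_mono; rewrite ltW// (lt_le_trans sr).
transitivity (\sum_(k < m.+1) phi (g r) * \1_(`]tau k, tau k.+1]%classic) r).
  rewrite -mulr_sumr; under eq_bigr do rewrite itv_indicE//.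
  rewrite -(big_mkord xpredT (fun k => (r <= tau k.+1)%R%:R - (r <= tau k)%R%:R)) telescope_sumr//.
  by rewrite /tau uniform_gridn uniform_grid0 ru [r <= s]leNgt sr subr0 mulr1.
apply: eq_bigr => k _; rewrite indicE mem_setE in_itv/=.
case: (boolP (_ && _)) => [/andP[h1 h2]|_]; last by rewrite !mulr0.
congr (phi _ * _); move: h2; rewrite le_eqVlt => /orP[/eqP <-//|h2].
apply/esym/he => //=; rewrite distrC ger0_norm ?subr_ge0 ?ltW//.
apply: le_lt_trans small; rewrite -(uniform_grid_step s u m k) -/tau.
by rewrite lerD2l lerN2 ltW.
Unshelve. all: by end_near.
Qed.

End StepFunctions.

(** * Fatou's lemma for payoffs at a stopping time *)

Section FatouNonmeasurable.
Context d (T : measurableType d) (R : realType) (P : probability T R).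
Local Notation L1 := (integrable_rv P).
Local Notation "'Ex' f" := (Rintegral P [set: T] f) (at level 10, f at level 9).

(* The payoff at a stopping time need not be measurable: neither [D] nor [f] is assumed to be. *)
Lemma fatou_nonmeasurable (D : set T) (f : T -> R) (Y : nat -> T -> R) (b C : R) :
  (forall n, L1 (Y n)) -> (forall n w, 0 <= Y n w) ->
  (forall n, Ex (Y n) <= b + C * n.+1%:R^-1) ->
  {ae P, forall w, D w -> forall e, 0 < e ->
     exists n0, forall n, (n0 <= n)%N -> f w - e <= Y n w} ->
  (\int[P]_(w in D) (f w)%:E <= b%:E)%E.
Proof.
move=> Y1 Y0 YC [N0 [mN0 PN0 sN0]].
pose gl w := limn_einf (fun n => (Y n w)%:E).
have mY n : measurable_fun [set: T] (fun w => (Y n w)%:E).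
  by apply/measurable_EFinP; exact: integrable_rv_measurable (Y1 n).
have mgl : measurable_fun [set: T] gl.
  rewrite (_ : gl = fun w => - limn_esup (-%E \o (fun m => (Y m w)%:E)))%E.
    apply: measurableT_comp => //; apply: measurable_fun_limn_esup => m.
    exact: measurableT_comp.
  by apply/funext => w; rewrite limn_esupN oppeK.
have gl0 w : (0 <= gl w)%E.
  rewrite /gl limn_einf_lim; apply: lime_ge; first exact: is_cvg_einfs.
  by apply: nearW => k; apply: le_ereal_inf_tmp => _ [l /= _ <-]; rewrite lee_fin.
(* The value [+oo] on the null set makes [g] dominate [f] at every point of [D] and leaves the
   integral unchanged. *)
pose g w := (gl w + +oo * (\1_N0 w)%:E)%E.
have g0 w : (0 <= g w)%E.
  by apply: adde_ge0 => //; apply: mule_ge0 => //; rewrite lee_fin indicE.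
have mg : measurable_fun [set: T] g.
  apply: emeasurable_funD => //; apply: measurable_funeM.
  by apply/measurable_EFinP.
have glb : (\int[P]_w gl w <= b%:E)%E.
  apply/lee_addgt0Pr => e e0.
  have := @fatou _ _ _ P setT measurableT (fun m w => (Y m w)%:E)
    (fun m => mY m) (fun m w _ => Y0 m w).
  move=> /le_trans; apply; rewrite limn_einf_lim; apply: lime_le; first exact: is_cvg_einfs.
  (* An index beyond [k] for which C/(m + 1) <= e. *)
  apply: nearW => k; pose m := maxn k (Num.truncn (`|C| / e)).
  apply: (@le_trans _ _ (\int[P]_w (Y m w)%:E)%E).
    by apply: ereal_inf_lbound; exists m => //=; rewrite leq_maxl.
  rewrite -EFin_Ex// -EFinD lee_fin; apply: le_trans (YC m) _; rewrite lerD2l.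
  rewrite ler_pdivrMr//; apply: (le_trans (ler_norm _)).
  rewrite mulrC -ler_pdivrMr//; apply: le_trans (_ : (Num.truncn (`|C| / e)).+1%:R <= _).
    exact/ltW/truncnS_gt.
  by rewrite ler_nat ltnS leq_maxr.
have -> : (\int[P]_(w in D) (f w)%:E =
  \int[P]_(w in D) ((fun w => (f w)%:E)^\+ w) - \int[P]_(w in D) ((fun w => (f w)%:E)^\- w))%E.
  exact: integralE.
have neg0 : (0 <= \int[P]_(w in D) ((fun w => (f w)%:E)^\- w))%E by exact: integral_ge0.
apply: (@le_trans _ _ (\int[P]_(w in D) ((fun w => (f w)%:E)^\+ w))%E).
  by rewrite -[leRHS]sube0; apply: leeB.
apply: le_trans glb; apply: (@le_trans _ _ (\int[P]_w g w)%E).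
  apply: ge0_le_integral_nonmeasurable => // w Dw.
  rewrite /g; have [wN|wN] := pselect (N0 w).
    rewrite indicE mem_set// mule1 addey ?leey//.
    by rewrite gt_eqF// (lt_le_trans _ (gl0 w))// ltNy0.
  rewrite indicE memNset// mule0 adde0 funeposE ge_max gl0 andbT.
  have /(_ Dw) cv : D w -> forall e, 0 < e -> exists n0, forall n, (n0 <= n)%N -> f w - e <= Y n w.
    by apply: contrapT => h; apply: wN; apply: sN0.
  apply/lee_subgt0Pr => e e0; have [n0 hn0] := cv e e0.
  rewrite /gl limn_einf_lim; apply: lime_ge; first exact: is_cvg_einfs.
  exists n0 => // m /= n0m; apply: le_ereal_inf_tmp => _ [l /= ml <-].
  by rewrite -EFinB lee_fin hn0// (leq_trans n0m).
rewrite le_eqVlt; apply/orP; left; apply/eqP.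
apply: ae_eq_integral => //.
exists N0; split => // w /=; apply: contra_notP => wN _.
by rewrite /g indicE memNset// mule0 adde0.
Qed.

End FatouNonmeasurable.

(** * Stopped sums, discount factors and continuity along paths *)

Lemma stopped_telescope (R : realType) (M : nat -> R) (b : nat -> bool) m N :
  (m <= N)%N -> (forall j, (j < m)%N -> b j) -> (forall j, (m <= j < N)%N -> ~~ b j) ->
  M 0%N + \sum_(j < N) (b j)%:R * (M j.+1 - M j) = M m.
Proof.
move=> mN bt bf.
rewrite -(big_mkord xpredT (fun j => (b j)%:R * (M j.+1 - M j))).
rewrite (big_cat_nat (n := m))//= [X in _ + (_ + X)]big1_seq; last first.
  by move=> j; rewrite mem_index_iota => /bf/negbTE ->; rewrite mul0r.
rewrite (eq_big_nat _ _ (F2 := fun j => M j.+1 - M j)); last first.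
  by move=> j /bt ->; rewrite mul1r.
by rewrite telescope_sumr// addr0 subrKC.
Qed.

(** Each a e^(-a(j+1)) is at most e^(-aj) - e^(-a(j+1)), because 1 + a <= e^a, and these differences
    telescope. *)
Lemma discount_sum (R : realType) (a : R) N : 0 < a ->
  \sum_(j < N) expR (- (a * j.+1%:R)) <= a^-1.
Proof.
move=> a0; rewrite -[leRHS]mulr1 ler_pdivlMl// mulr_sumr.
suff : \sum_(j < N) a * expR (- (a * j.+1%:R)) <= 1 - expR (- (a * N%:R)).
  by move/le_trans; apply; rewrite gerBl expR_ge0.
elim: N => [|N IH]; first by rewrite big_ord0 mulr0 oppr0 expR0 subrr.
rewrite big_ord_recr /=; apply: le_trans (lerD IH (lexx _)) _.
have -> : expR (- (a * N%:R)) = expR a * expR (- (a * N.+1%:R)).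
  by rewrite -expRD -natr1; congr expR; ring.
have := expR_ge1Dx a; have := expR_gt0 (- (a * N.+1%:R)); nra.
Qed.

Definition continuous_at_nonneg (R : realType) (g : R -> R) := forall r, 0 <= r ->
  forall e, 0 < e -> exists2 eta, 0 < eta &
    forall t, 0 <= t -> `|t - r| < eta -> `|g t - g r| < e.

Lemma continuous_nonnegP (R : realType) (g : R -> R) :
  {within `[0, +oo[, continuous g} -> continuous_at_nonneg g.
Proof.
move=> /subspace_continuousP gc r r0 e e0.
have := gc r; rewrite /= in_itv/= r0 => /(_ isT) /cvgrPdist_lt /(_ _ e0) [eta /= eta0 h]; exists eta => // t t0 tr.
by rewrite distrC; apply: h; rewrite /= ?in_itv/= ?t0// distrC.
Qed.

Lemma continuous_nonneg_discount (R : realType) (rho : R) (g : R -> R) :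
  continuous_at_nonneg g -> continuous_at_nonneg (fun t => expR (- rho * t) * g t).
Proof.
move=> gc r r0 e e0.
pose b := expR (- rho * r); pose M := `|g r| + 1.
have M0 : 0 < M by rewrite ltr_wpDl.
have b0 : 0 < b by exact: expR_gt0.
have m0 : 0 < Num.min 1 (e / (2 * b)) by rewrite lt_min ltr01 divr_gt0// mulr_gt0.
have [eta1 eta10 h1] := gc r r0 _ m0.
have ec : continuous (fun t => expR (- rho * t)).
  by move=> t; apply: continuous_comp; [exact: mulrl_continuous|exact: continuous_expR].
have eM : 0 < e / (2 * M) by rewrite divr_gt0// mulr_gt0.
have := ec r => /cvgrPdist_lt /(_ _ eM) [eta2 /= eta20 h2].
exists (Num.min eta1 eta2); first by rewrite lt_min eta10.
move=> t t0; rewrite lt_min => /andP[t1 t2].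
have := h1 t t0 t1; rewrite lt_min => /andP[g1 g2].
have g3 : `|expR (- rho * t) - expR (- rho * r)| < e / (2 * M).
  by rewrite distrC; apply: h2; rewrite /= distrC.
have gM : `|g t| < M.
  by rewrite -(subrK (g r) (g t)) addrC (le_lt_trans (ler_normD _ _))// /M ltrD2l.
have -> : expR (- rho * t) * g t - expR (- rho * r) * g r =
  (expR (- rho * t) - b) * g t + b * (g t - g r) by rewrite /b; ring.
apply: le_lt_trans (ler_normD _ _) _; rewrite !normrM (gtr0_norm b0).
have a1 : `|expR (- rho * t) - b| * `|g t| <= e / 2.
  apply: (@le_trans _ _ (e / (2 * M) * M)); first by apply: ler_pM => //; exact: ltW.
  by rewrite le_eqVlt; apply/orP; left; apply/eqP; field; rewrite gt_eqF.
have a2 : b * `|g t - g r| < e / 2.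
  rewrite mulrC -ltr_pdivlMr//; apply: lt_le_trans g2 _.
  by rewrite invfM mulrA.
by rewrite (splitr e); exact: ler_ltD.
Qed.

(** The cubic term of the exponential series, e^z >= z^3/6, outweighs the quadratic growth. With it,
    what is lost by stopping at a horizon t is of order 1/t. *)
Lemma discount_sqr_le (R : realType) (rho t c m : R) :
  0 < rho -> 1 <= t -> 0 <= c -> 0 <= m ->
  expR (- (rho * t)) * (c + m * t ^+ 2) <= 6 / rho ^+ 3 * (c + m) * t^-1.
Proof.
move=> r0 t1 c0 m0; have t0 : 0 < t by exact: lt_le_trans t1.
have rt : 0 < rho * t by rewrite mulr_gt0.
have ez : expR (- (rho * t)) <= ((rho * t) ^+ 3 / 6)^-1.
  rewrite expRN lef_pV2 ?posrE ?expR_gt0// ?divr_gt0 ?exprn_gt0//.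
  by apply: le_trans (expR_ge1Dxn 2 (ltW rt)); rewrite lerDr.
have ct : c + m * t ^+ 2 <= (c + m) * t ^+ 2.
  by rewrite mulrDl lerD2r ler_peMr// exprn_ege1.
apply: (@le_trans _ _ (((rho * t) ^+ 3 / 6)^-1 * ((c + m) * t ^+ 2))).
  apply: ler_pM => //.
  by apply: addr_ge0 => //; apply: mulr_ge0 => //; exact: sqr_ge0.
rewrite le_eqVlt; apply/orP; left; apply/eqP; field.
by rewrite !gt_eqF.
Qed.

(** * Random variables adapted to the filtration *)

Section RegimeSwitchingDiffusion.
Context d (T : measurableType d) (R : realType) (P : probability T R).
Implicit Types (U V Y : T -> R) (A : set T) (s t : R) (i : 'I_2).
Variables (W : R -> T -> R) (eps : R -> T -> 'I_2) (lambda : 'I_2 -> R).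
Hypothesis lambda_gt0 : forall i, 0 < lambda i.
Hypothesis Pcomplete : measure_is_complete P.
Hypothesis WBM : brownian_motion P W.
Hypothesis epsMC : markov_chain P (regime_rates lambda) eps.
Hypothesis W_eps_indep : independent_systems P
  <<s events measurable W `[0, +oo[ >>
  <<s events [set: set 'I_2] eps `[0, +oo[ >>.

Local Notation FF := (augmented_filtration P W eps).
Local Notation L1 := (integrable_rv P).
Local Notation L2 := (square_integrable_rv P).
Local Notation "'Ex' f" := (Rintegral P [set: T] f) (at level 10, f at level 9).
Local Notation mu := (@lebesgue_measure R).

Lemma FF_setT t : FF t setT.
Proof. exact: (@measurableT _ (g_sigma_algebraType _)). Qed.

Lemma filtration_measurable t : FF t `<=` measurable.
Proof. exact: (FF_measurable Pcomplete WBM epsMC). Qed.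

Lemma FF_measurable_fun t V : measurable_wrt (FF t) V ->
  measurable_fun [set: T] V.
Proof. exact: (measurable_wrt_measurable (@filtration_measurable t)). Qed.

Lemma FF_adaptedP t V : measurable_wrt (FF t) V <->
  measurable_fun [set: g_sigma_algebraType
    (events measurable W `[0, t] `|` events [set: set _] eps `[0, t]
      `|` P.-negligible)] (V : g_sigma_algebraType _ -> R).
Proof. exact: measurable_wrtP. Qed.

Lemma FF_adapted_mono s t V : s <= t -> measurable_wrt (FF s) V ->
  measurable_wrt (FF t) V.
Proof. by move=> st mV B mB; apply: (FF_mono st); exact: mV. Qed.

Lemma FF_adapted_indic t A : FF t A -> measurable_wrt (FF t) (\1_A : T -> R).
Proof.
move=> FA; apply/FF_adaptedP.
exact: (@measurable_indic _ (g_sigma_algebraType _) _ _ _ FA).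
Qed.

Lemma FF_adaptedD t U V : measurable_wrt (FF t) U -> measurable_wrt (FF t) V ->
  measurable_wrt (FF t) (fun w => U w + V w).
Proof.
by move=> /FF_adaptedP mU /FF_adaptedP mV; apply/FF_adaptedP; exact: measurable_funD.
Qed.

Lemma FF_adaptedB t U V : measurable_wrt (FF t) U -> measurable_wrt (FF t) V ->
  measurable_wrt (FF t) (fun w => U w - V w).
Proof.
by move=> /FF_adaptedP mU /FF_adaptedP mV; apply/FF_adaptedP; exact: measurable_funB.
Qed.

Lemma FF_adaptedM t U V : measurable_wrt (FF t) U -> measurable_wrt (FF t) V ->
  measurable_wrt (FF t) (fun w => U w * V w).
Proof.
by move=> /FF_adaptedP mU /FF_adaptedP mV; apply/FF_adaptedP; exact: measurable_funM.
Qed.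

Lemma FF_adapted_cst t (c : R) : measurable_wrt (FF t) (fun=> c).
Proof. by apply/FF_adaptedP; exact: measurable_cst. Qed.

Lemma FF_adapted_comp t (g : R -> R) V : measurable_fun [set: R] g ->
  measurable_wrt (FF t) V -> measurable_wrt (FF t) (fun w => g (V w)).
Proof.
by move=> mg /FF_adaptedP mV; apply/FF_adaptedP; exact: (measurableT_comp mg mV).
Qed.

Lemma FF_adapted_chain s t (g : 'I_2 -> R) : 0 <= s <= t ->
  measurable_wrt (FF t) (fun w => g (eps s w)).
Proof.
move=> st B mB.
exact: (@FF_eps _ _ _ P W eps s t [set i | B (g i)]).
Qed.

(* A function of [(X, eps_s)] is a finite sum over the regimes. *)
Lemma FF_adapted_regime s t (g : R -> 'I_2 -> R) V : 0 <= s <= t ->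
  (forall i, measurable_fun [set: R] (g ^~ i)) -> measurable_wrt (FF t) V ->
  measurable_wrt (FF t) (fun w => g (V w) (eps s w)).
Proof.
move=> st mg mV.
rewrite (_ : (fun w => _) = (fun w =>
    (eps s w == ord0)%:R * g (V w) ord0 +
    (eps s w == rev_ord ord0)%:R * g (V w) (rev_ord ord0))).
  apply: FF_adaptedD; apply: FF_adaptedM.
  - exact: (FF_adapted_chain (fun i => (i == ord0)%:R)).
  - exact: (FF_adapted_comp (mg ord0)).
  - exact: (FF_adapted_chain (fun i => (i == rev_ord ord0)%:R)).
  - exact: (FF_adapted_comp (mg (rev_ord ord0))).
apply/funext => w; have [->|] := eqVneq (eps s w) ord0.
  have -> : (@ord0 1 == rev_ord ord0) = false by apply/negbTE; rewrite ord2_neq rev_ordK.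
  by rewrite mul1r mul0r addr0.
by rewrite ord2_neq => /eqP ->; rewrite eqxx mul0r mul1r add0r.
Qed.

Lemma FF_mean_zero t V Y : L1 Y ->
  (forall A, FF t A -> Ex (fun w => \1_A w * Y w) = 0) ->
  measurable_wrt (FF t) V -> L1 (fun w => V w * Y w) ->
  Ex (fun w => V w * Y w) = 0.
Proof. by move=> Y1 Y0 mV; apply: (Ex_mean_zero (@filtration_measurable t)). Qed.

(** * Jumps of the chain given the past *)

Lemma indic_chain s i w : (eps s w == i)%:R = \1_[set w | eps s w = i] w :> R.
Proof. by rewrite indicE; congr (nat_of_bool _)%:R; apply/eqP/idP => [/mem_set|/set_mem]. Qed.

Lemma measurable_regime s i : 0 <= s -> measurable [set w | eps s w = i].
Proof. by case: epsMC => + _ _; exact. Qed.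

Lemma measurable_regime_indic s i : 0 <= s ->
  measurable_fun [set: T] (fun w => (eps s w == i)%:R : R).
Proof.
move=> s0; under eq_fun do rewrite indic_chain.
by apply: measurable_indic; exact: measurable_regime.
Qed.

(** The Markov property with the transition probability in closed form: the compensated jump out of
    regime [i] has zero conditional mean. *)
Lemma chain_jump s t i A : 0 <= s <= t -> FF s A ->
  Ex (fun w => \1_A w * ((eps s w == i)%:R *
    ((eps t w == rev_ord i)%:R - jump_prob lambda i (t - s)))) = 0.
Proof.
move=> st FA; have [s0 st'] := andP st; have t0 := le_trans s0 st'.
have mA := filtration_measurable FA.
have ms := measurable_regime i s0; have mt := measurable_regime (rev_ord i) t0.
have h0 : 0 <= t - s by rewrite subr_ge0.
rewrite (_ : (fun w => _) = (fun w => \1_(A `&` [set w | eps s w = i /\ eps t w = rev_ord i]) w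
   - jump_prob lambda i (t - s) * \1_(A `&` [set w | eps s w = i]) w)); last first.
  apply/funext => w; rewrite !indic_chain.
  by rewrite -![\1_(A `&` _)]/(_) !indicI /=; ring.
have m1 : measurable (A `&` [set w | eps s w = i /\ eps t w = rev_ord i]).
  by apply: measurableI => //; exact: measurableI.
have m2 : measurable (A `&` [set w | eps s w = i]) by exact: measurableI.
have i1 B : measurable B -> L1 (\1_B).
  by move=> mB; apply: (@integrable_rv_bounded _ _ _ _ _ 1) => // w; exact: norm_indic_le1.
rewrite ExB; [|exact: i1|by apply: integrable_rvZ; exact: i1].
rewrite ExZ; last exact: i1.
rewrite !Ex_indic//.
have := @chain_markov _ _ _ P W eps _ Pcomplete WBM epsMC W_eps_indep s t i (rev_ord i) A st FA.
rewrite transition_jump// => /(_ (jump_prob_ge0 lambda_gt0 i h0)) ->.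
rewrite fineM//; last exact: fin_num_measure.
by rewrite /= subrr.
Qed.

Lemma regime_change s t w : (eps t w != eps s w)%:R =
  \sum_i (eps s w == i)%:R * (eps t w == rev_ord i)%:R :> R.
Proof.
rewrite (bigD1 (eps s w))//= eqxx mul1r ord2_neq big1 ?addr0// => j /negbTE jn.
by rewrite eq_sym jn mul0r.
Qed.

(** A change is a jump out of one of the two regimes, and a jump out of regime i has conditional
    probability at most lambda_i (t - s). *)
Lemma chain_change s t A : 0 <= s <= t -> FF s A ->
  Ex (fun w => \1_A w * (eps t w != eps s w)%:R) <=
  total_rate lambda * (t - s) * fine (P A).
Proof.
move=> st FA; have [s0 st'] := andP st; have t0 := le_trans s0 st'.
have mA := filtration_measurable FA.
have h0 : 0 <= t - s by rewrite subr_ge0.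
have mi r i : 0 <= r -> measurable_fun [set: T] (fun w => (eps r w == i)%:R : R).
  exact: measurable_regime_indic.
have b1 (b : bool) : `|b%:R| <= 1 :> R by case: b; rewrite ?normr1 ?normr0.
have Y1 i : L1 (fun w => \1_A w * ((eps s w == i)%:R *
    ((eps t w == rev_ord i)%:R - jump_prob lambda i (t - s)))).
  apply: integrable_rv_indicM => //; apply: (integrable_rvM_bounded (M := 1)) => //.
    exact: mi.
  apply: integrable_rvB.
    by apply: (@integrable_rv_bounded _ _ _ _ _ 1) => //; exact: mi.
  by apply: (@integrable_rv_bounded _ _ _ _ _ `|jump_prob lambda i (t - s)|).
have Z1 i : L1 (fun w => jump_prob lambda i (t - s) * (\1_A w * (eps s w == i)%:R)).
  apply: integrable_rvZ; apply: integrable_rv_indicM => //.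
  by apply: (@integrable_rv_bounded _ _ _ _ _ 1) => //; exact: mi.
rewrite (_ : (fun w => _) = (fun w => \sum_i (\1_A w * ((eps s w == i)%:R *
    ((eps t w == rev_ord i)%:R - jump_prob lambda i (t - s))) +
    jump_prob lambda i (t - s) * (\1_A w * (eps s w == i)%:R)))); last first.
  by apply/funext => w; rewrite regime_change mulr_sumr; apply: eq_bigr => i _; ring.
rewrite Ex_sum; last by move=> i; exact: integrable_rvD.
under eq_bigr do rewrite ExD// chain_jump// add0r.
apply: (@le_trans _ _ (\sum_i lambda i * (t - s) * fine (P A))).
  apply: ler_sum => i _; rewrite ExZ; last first.
    apply: integrable_rv_indicM => //.
    by apply: (@integrable_rv_bounded _ _ _ _ _ 1) => //; exact: mi.
  apply: ler_pM; first exact: jump_prob_ge0.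
  - by apply: Ex_ge0 => w; rewrite mulr_ge0// indicE.
  - exact: jump_prob_le.
  - rewrite -(Ex_indic P mA); apply: Ex_le.
    + apply: integrable_rv_indicM => //.
      by apply: (@integrable_rv_bounded _ _ _ _ _ 1) => //; exact: mi.
    + apply: (@integrable_rv_bounded _ _ _ _ _ 1) => // w; exact: norm_indic_le1.
    + by move=> w; rewrite ler_piMr ?indicE//; case: (_ == _).
by rewrite -!mulr_suml.
Qed.

(** * Brownian increments given the past *)

Local Notation DW s t := (fun w => W t w - W s w).

Lemma DW_measurable s t : 0 <= s <= t -> measurable_fun [set: T] (DW s t).
Proof.
move=> /andP[s0 st]; apply: measurable_funB; apply: (BM_measurable WBM) => //.
exact: le_trans st.
Qed.

Lemma DW_law s t (g : R -> R) (A : set T) : 0 <= s < t -> FF s A ->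
  measurable_fun [set: R] g ->
  integrable_rv (normal_prob 0 (Num.sqrt (t - s))) g ->
  L1 (fun w => g (W t w - W s w)) /\
  Ex (fun w => \1_A w * g (W t w - W s w)) =
  fine (P A) * Rintegral (normal_prob 0 (Num.sqrt (t - s))) [set: R] g.
Proof.
move=> st FA mg ig; have [s0 st'] := andP st.
have mD := @DW_measurable s t (introT andP (conj s0 (ltW st'))).
have [_ _ _ law _] := WBM.
pose N : probability (measurableTypeR R) R := normal_prob 0 (Num.sqrt (t - s)).
have mD' : measurable_fun [set: T] (DW s t : T -> measurableTypeR R) := mD.
pose Dm : {mfun T >-> measurableTypeR R} :=
  HB.pack (DW s t : T -> measurableTypeR R) (isMeasurableFun.Build _ _ _ _ _ mD').
have eqN B : measurable B -> pushforward P Dm B = N B.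
  by move=> mB; rewrite /pushforward law.
have mgE : measurable_fun [set: R] (EFin \o g) by exact/measurable_EFinP.
have gD1 : L1 (fun w => g (W t w - W s w)).
  apply/integrableP; split.
    by apply/measurable_EFinP; exact: (measurableT_comp mg mD).
  have mg' : measurable_fun [set: R] (fun x => `|(g x)%:E|%E) by exact: measurableT_comp.
  have h : (\int[pushforward P Dm]_x `|(g x)%:E| =
      \int[P]_w `|(g (W t w - W s w))%:E|)%E.
    have := @ge0_integral_pushforward _ _ _ _ R Dm mD' P setT
      (fun x => `|(g x)%:E|)%E measurableT mg'.
    by rewrite preimage_setT; apply => x _ /=.
  have h2 : (\int[pushforward P Dm]_x `|(g x)%:E| = \int[N]_x `|(g x)%:E|)%E.
    by apply: eq_measure_integral => B mB _; exact: eqN.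
  by move: h; rewrite h2 => <-; have /integrableP[] := ig.
split => //.
have Eg : Ex (fun w => g (W t w - W s w)) = Rintegral N [set: R] g.
  congr fine.
  have := @integral_pushforward _ _ _ _ R Dm mD' P setT (EFin \o g) mgE.
  rewrite preimage_setT => /(_ gD1 measurableT) <-.
  by apply: eq_measure_integral => B mB _; exact: eqN.
have mA := filtration_measurable FA.
pose S := preimage_set_system [set: T] (DW s t) measurable.
have SS : <<s S >> = S.
  by apply: sigma_algebra_id; apply: sigma_algebra_preimage; exact: sigma_algebra_measurable.
have Sm : <<s S >> `<=` measurable.
  by rewrite SS => _ [B mB <-]; exact: mD.
have iA : L1 (\1_A) by apply: (@integrable_rv_bounded _ _ _ _ _ 1) => // w; exact: norm_indic_le1.
have ic c : L1 (fun=> c) by apply: (@integrable_rv_bounded _ _ _ _ _ `|c|).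
have iY : L1 (fun w => \1_A w - fine (P A)) by exact: integrable_rvB.
(* [Ex_mean_zero] is used with the sigma-algebra of the increment, not that of the past: by
   independence the centred indicator of [A] has zero mean on each of its events, and g of the
   increment is the measurable factor. *)
have : Ex (fun w => g (W t w - W s w) * (\1_A w - fine (P A))) = 0.
  apply: (Ex_mean_zero Sm) => //.
  - move=> C; rewrite SS => -[B mB <-]; rewrite setTI.
    set C' := DW s t @^-1` B.
    have mC : measurable C' by have := mD measurableT B mB; rewrite setTI.
    rewrite (_ : (fun w => _) = (fun w => \1_(A `&` C') w - fine (P A) * \1_C' w)); last first.
      by apply/funext => w; rewrite indicI/=; ring.
    have iC B' : measurable B' -> L1 (\1_B').
      by move=> mB'; apply: (@integrable_rv_bounded _ _ _ _ _ 1) => // w; exact: norm_indic_le1.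
    have mAC : measurable (A `&` C') by exact: measurableI.
    rewrite ExB; [|exact: iC|by apply: integrable_rvZ; exact: iC].
    rewrite ExZ ?Ex_indic//; last exact: iC.
    rewrite (increment_indep Pcomplete WBM epsMC W_eps_indep st FA mB) -law//.
    have fA : P A \is a fin_num by exact: fin_num_measure.
    have fC : P C' \is a fin_num by exact: fin_num_measure.
    by rewrite -/C' fineM// subrr.
  - move=> B mB; apply: sub_gen_smallest; exists (g @^-1` B).
      by have := mg measurableT B mB; rewrite setTI.
    by rewrite setTI.
  - under [X in integrable_rv P X]eq_fun do rewrite mulrC.
    apply: (integrable_rvM_bounded (M := 1 + `|fine (P A)|)) => //.
      exact: measurable_funB.
    move=> w; apply: le_trans (ler_normB _ _) _; rewrite lerD2r.
    exact: norm_indic_le1.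
rewrite (_ : (fun w => _) = (fun w => \1_A w * g (W t w - W s w) - fine (P A) * g (W t w - W s w))); last first.
  by apply/funext => w; ring.
rewrite ExB; [|exact: integrable_rv_indicM|exact: integrable_rvZ].
by rewrite ExZ// Eg => /eqP; rewrite subr_eq0 => /eqP.
Qed.

Lemma DW_square_integrable s t : 0 <= s <= t ->
  L2 (DW s t) /\ L2 (fun w => (W t w - W s w) ^+ 2).
Proof.
move=> st; have [s0] := andP st; rewrite le_eqVlt => /orP[/eqP <-|st'].
  have z0 : L2 (fun=> 0).
    by apply: (@square_integrable_bounded _ _ _ _ _ 0) => // w; rewrite normr0.
  split.
    by rewrite (_ : (fun w => _) = fun=> 0)//; apply/funext => w; rewrite subrr.
  rewrite (_ : (fun w => _) = fun=> 0)//; apply/funext => w.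
  by rewrite subrr expr0n.
have s1 : 0 < Num.sqrt (t - s) by rewrite sqrtr_gt0 subr_gt0.
have mD := @DW_measurable s t st.
have FT : FF s setT by apply: (@measurableT _ (g_sigma_algebraType _)).
have st2 : 0 <= s < t by rewrite s0.
have [D4 _] := DW_law st2 FT (measurable_funX 4 (@measurable_id _ R setT)) (normal_fourth_integrable s1).
have [D2 _] := DW_law st2 FT (measurable_funX 2 (@measurable_id _ R setT))
  (square_integrable_integrable (normal_square_integrable s1)).
split; split => //; first exact: measurable_funX.
by under [X in integrable_rv P X]eq_fun do rewrite -exprM.
Qed.

Lemma DW_moments s t A : 0 <= s <= t -> FF s A ->
  [/\ Ex (fun w => \1_A w * (W t w - W s w)) = 0,
      Ex (fun w => \1_A w * ((W t w - W s w) ^+ 2 - (t - s))) = 0 &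
      Ex (fun w => \1_A w * (W t w - W s w) ^+ 4) <= 64 * (t - s) ^+ 2 * fine (P A)].
Proof.
move=> st FA; have [s0] := andP st; rewrite le_eqVlt => /orP[/eqP <-|st'].
  split.
  - by under eq_Rintegral do rewrite subrr mulr0; exact: Ex_cst.
  - by under eq_Rintegral do rewrite !subrr expr0n/= subrr mulr0; exact: Ex_cst.
  - under eq_Rintegral do rewrite subrr expr0n/= mulr0.
    by rewrite Ex_cst subrr expr0n/= mulr0 mul0r.
have h0 : 0 < t - s by rewrite subr_gt0.
have s1 : 0 < Num.sqrt (t - s) by rewrite sqrtr_gt0.
have st2 : 0 <= s < t by rewrite s0.
have [D1 E1] := DW_law st2 FA (@measurable_id _ R setT)
  (square_integrable_integrable (normal_id_integrable s1)).
have [D4 E4] := DW_law st2 FA (measurable_funX 4 (@measurable_id _ R setT)) (normal_fourth_integrable s1).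
have [D2 E2] := DW_law st2 FA (measurable_funX 2 (@measurable_id _ R setT))
  (square_integrable_integrable (normal_square_integrable s1)).
have mA := filtration_measurable FA.
have q2 : Num.sqrt (t - s) ^+ 2 = t - s by rewrite sqr_sqrtr// ltW.
split.
- by rewrite E1 normal_mean// mulr0.
- rewrite (_ : (fun w => _) = (fun w => \1_A w * (W t w - W s w) ^+ 2 - (t - s) * \1_A w)); last first.
    by apply/funext => w; ring.
  have iA : L1 (\1_A) by apply: (@integrable_rv_bounded _ _ _ _ _ 1) => // w; exact: norm_indic_le1.
  rewrite ExB; [|exact: integrable_rv_indicM|exact: integrable_rvZ].
  by rewrite ExZ// Ex_indic// E2 normal_variance// q2 mulrC subrr.
- rewrite E4 mulrC ler_wpM2r ?fine_ge0//.
  rewrite -lee_fin (EFin_Ex (normal_fourth_integrable s1)).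
  apply: le_trans (normal_fourth_moment s1) _.
  by rewrite lee_fin (exprM _ 2 2) q2.
Qed.

(** * Ito isometry for step sums, and the distance of the volatility to its initial value *)

Lemma indic_integrable A : measurable A -> L1 (\1_A).
Proof.
move=> mA; apply: (@integrable_rv_bounded _ _ _ _ _ 1) => // w.
exact: norm_indic_le1.
Qed.

(** Induction on the number of cells: given the past of the last cell, its increment has mean zero
    and its square has mean the length of the cell. Adaptedness is asked on non-degenerate cells
    only, because a cell collapsed by clamping may carry a coefficient known only later. *)
Lemma step_isometry s A n (tau : nat -> R) (e : nat -> T -> R) :
  0 <= s -> s <= tau 0%N -> FF s A ->
  (forall k, (k < n)%N -> tau k <= tau k.+1) ->
  (forall k, (k < n)%N -> tau k < tau k.+1 -> measurable_wrt (FF (tau k)) (e k)) ->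
  (forall k, (k < n)%N -> measurable_fun [set: T] (e k)) ->
  (forall k, (k < n)%N -> exists M, forall w, `|e k w| <= M) ->
  let S w := \sum_(k < n) e k w * (W (tau k.+1) w - W (tau k) w) in
  let Q w := \sum_(k < n) e k w ^+ 2 * (tau k.+1 - tau k) in
  [/\ measurable_wrt (FF (tau n)) S, L2 S, L1 Q,
      Ex (fun w => \1_A w * S w) = 0 &
      Ex (fun w => \1_A w * S w ^+ 2) = Ex (fun w => \1_A w * Q w)].
Proof.
move=> s0 s_tau FA; elim: n => [|n IH] mono adp me be S Q.
  have S0 : S = fun=> 0 by apply/funext => w; rewrite /S big_ord0.
  have Q0 : Q = fun=> 0 by apply/funext => w; rewrite /Q big_ord0.
  rewrite S0 Q0; split.
  - exact: FF_adapted_cst.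
  - by apply: (@square_integrable_bounded _ _ _ _ _ 0) => // w; rewrite normr0.
  - by apply: (@integrable_rv_bounded _ _ _ _ _ 0) => // w; rewrite normr0.
  - by under eq_Rintegral do rewrite mulr0; exact: Ex_cst.
  - by under eq_Rintegral do rewrite expr0n/=.
have [|||| mS S2 Q1 ES EQ] := IH.
- by move=> k kn; apply: mono; exact: ltnW.
- by move=> k kn; apply: adp; exact: ltnW.
- by move=> k kn; apply: me; exact: ltnW.
- by move=> k kn; apply: be; exact: ltnW.
set S' := (fun w => _) in mS S2 ES EQ; set Q' := (fun w => _) in Q1 EQ.
set u := tau n in mS *; set v := tau n.+1.
have su : s <= u.
  apply: le_trans s_tau _; apply: (@monotone_grid _ _ n.+1) => //.
  by rewrite leqnSn.
have uv : u <= v by exact: mono.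
have SE : S = fun w => S' w + e n w * (W v w - W u w).
  by apply/funext => w; rewrite /S big_ord_recr.
have QE : Q = fun w => Q' w + e n w ^+ 2 * (v - u).
  by apply/funext => w; rewrite /Q big_ord_recr.
have mA := filtration_measurable FA.
have u0 : 0 <= u := le_trans s0 su.
have uv0 : 0 <= u <= v by rewrite u0.
have v0 : 0 <= v := le_trans u0 uv.
move: uv; rewrite le_eqVlt => /orP[/eqP uv|uv].
  have SE' : S = S' by apply/funext => w; rewrite SE -uv subrr mulr0 addr0.
  have QE' : Q = Q' by apply/funext => w; rewrite QE -uv subrr mulr0 addr0.
  by rewrite SE' QE' -uv.
have adn : measurable_wrt (FF u) (e n) by apply: adp.
have men : measurable_fun [set: T] (e n) by exact: me.
have [M eM] := be n (ltnSn n).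
have FAu : FF u A := FF_mono su FA.
have mAI := FF_adapted_indic FAu.
have [D2 DD2] := DW_square_integrable uv0.
have [E1 E2 _] : [/\ _, _ & _] := DW_moments uv0 FAu.
have meanD B : FF u B -> Ex (fun w => \1_B w * (W v w - W u w)) = 0.
  by move=> FB; have [] := DW_moments uv0 FB.
have meanD2 B : FF u B ->
    Ex (fun w => \1_B w * ((W v w - W u w) ^+ 2 - (v - u))) = 0.
  by move=> FB; have [] := DW_moments uv0 FB.
have eD2 : L2 (fun w => e n w * (W v w - W u w)).
  exact: (square_integrableM_bounded men eM).
have Dh1 : L1 (fun w => (W v w - W u w) ^+ 2 - (v - u)).
  apply: integrable_rvB; first exact: square_integrable_integrable.
  by apply: (@integrable_rv_bounded _ _ _ _ _ `|v - u|).
have e2M w : `|e n w ^+ 2| <= M ^+ 2.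
  by rewrite normrX lerXn2r// nnegrE// (le_trans _ (eM w)).
have me2 : measurable_fun [set: T] (fun w => e n w ^+ 2) by exact: measurable_funX.
have e21 : L1 (fun w => e n w ^+ 2) by exact: integrable_rv_bounded e2M.
have ea2 : measurable_wrt (FF u) (fun w => e n w ^+ 2) by exact: FF_adaptedM.
have Q21 : L1 (fun w => e n w ^+ 2 * (v - u)).
  by under [X in L1 X]eq_fun do rewrite mulrC; exact: integrable_rvZ.
rewrite SE QE; split.
- apply: FF_adaptedD; first exact: (FF_adapted_mono (ltW uv)).
  apply: FF_adaptedM; first exact: (FF_adapted_mono (ltW uv)).
  apply: FF_adaptedB; apply: FF_W; first by rewrite v0 lexx.
  by rewrite u0 ltW.
- exact: square_integrableD.
- exact: integrable_rvD.
- rewrite (_ : (fun w => _) = (fun w => \1_A w * S' w +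
      (\1_A w * e n w) * (W v w - W u w))); last by apply/funext => w; ring.
  rewrite ExD ?ES ?add0r.
  + apply: (@FF_mean_zero u) => //; first exact: square_integrable_integrable.
      exact: FF_adaptedM.
    under [X in L1 X]eq_fun do rewrite -mulrA.
    by apply: integrable_rv_indicM => //; exact: square_integrable_integrable.
  + by apply: integrable_rv_indicM => //; exact: square_integrable_integrable.
  + under [X in L1 X]eq_fun do rewrite -mulrA.
    by apply: integrable_rv_indicM => //; exact: square_integrable_integrable.
(* With D the last increment, (S' + e D)^2 = S'^2 + 2 S' e D + e^2 (D^2 - (v - u)) + e^2 (v - u);
   the second and third terms have zero mean. *)
- pose X1 w := \1_A w * S' w ^+ 2.
  pose X2 w := (\1_A w * (S' w * e n w)) * (W v w - W u w).
  pose X3 w := (\1_A w * e n w ^+ 2) * ((W v w - W u w) ^+ 2 - (v - u)).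
  pose X4 w := \1_A w * (e n w ^+ 2 * (v - u)).
  have i1 : L1 X1 by apply: integrable_rv_indicM => //; case: S2.
  have i2 : L1 X2.
    rewrite (_ : X2 = fun w => \1_A w * (S' w * (e n w * (W v w - W u w)))).
      by apply: integrable_rv_indicM => //; exact: square_integrableM.
    by apply/funext => w; rewrite /X2; ring.
  have i3 : L1 X3.
    rewrite (_ : X3 = fun w => \1_A w * (e n w ^+ 2 * ((W v w - W u w) ^+ 2 - (v - u)))).
      by apply: integrable_rv_indicM => //; exact: (integrable_rvM_bounded me2 e2M).
    by apply/funext => w; rewrite /X3; ring.
  have i4 : L1 X4 by exact: integrable_rv_indicM.
  rewrite (_ : (fun w => _) = (fun w => X1 w + 2 * X2 w + X3 w + X4 w)); last first.
    by apply/funext => w; rewrite /X1 /X2 /X3 /X4; ring.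
  have z2 : Ex X2 = 0.
    apply: (@FF_mean_zero u) => //; first exact: square_integrable_integrable.
    by apply: FF_adaptedM => //; exact: FF_adaptedM.
  have z3 : Ex X3 = 0.
    by apply: (@FF_mean_zero u) => //; exact: FF_adaptedM.
  rewrite ExD//; last first.
    by apply: integrable_rvD => //; apply: integrable_rvD => //; exact: integrable_rvZ.
  rewrite ExD//; last by apply: integrable_rvD => //; exact: integrable_rvZ.
  rewrite ExD//; last exact: integrable_rvZ.
  rewrite ExZ// z2 z3 mulr0 !addr0 EQ -ExD//; last exact: integrable_rv_indicM.
  by congr (Rintegral _ _ _); apply/funext => w; rewrite /X4 /Q'; ring.
Qed.

Lemma Ex_setE A f : measurable A -> L1 f ->
  ((Ex (fun w => \1_A w * f w))%:E = \int[P]_(w in A) (f w)%:E)%E.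
Proof.
move=> mA f1; rewrite EFin_Ex; last exact: integrable_rv_indicM.
rewrite [RHS]integral_mkcond; apply: eq_integral => w _.
by rewrite patchE indicE; case: (w \in A); rewrite ?mul1r ?mul0r.
Qed.

Lemma regime_gap (sigma : 'I_2 -> R) (i j : 'I_2) :
  (sigma i - sigma j) ^+ 2 =
  (sigma ord0 - sigma ord_max) ^+ 2 * (i != j)%:R.
Proof.
have o : rev_ord (@ord0 1) = ord_max by exact: val_inj.
have oi k : k != (@ord0 1) -> k = ord_max by rewrite ord2_neq o => /eqP.
have [->|ij] := eqVneq i j; first by rewrite subrr expr0n mulr0.
have [i0|/oi i1] := eqVneq i ord0.
  by move: ij; rewrite i0 eq_sym => /oi ->; rewrite mulr1.
have [j0|/oi j1] := eqVneq j ord0; first by rewrite i1 j0 mulr1 -sqrrN opprB.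
by move: ij; rewrite i1 j1 eqxx.
Qed.

(* Riemann sums over the right end points of the grid: by right-continuity of
   the paths of [eps] they converge to the time integral, which avoids the joint
   measurability required by Fubini's theorem. *)
Definition gap_sum (sigma : 'I_2 -> R) s u m w : R :=
  \sum_(k < m.+1) (sigma (eps (uniform_grid s u m k.+1) w) - sigma (eps s w)) ^+ 2 *
    (uniform_grid s u m k.+1 - uniform_grid s u m k).

Lemma gap_sum_ge0 sigma s u m w : s <= u -> 0 <= gap_sum sigma s u m w.
Proof.
move=> su; apply: sumr_ge0 => k _; rewrite mulr_ge0 ?sqr_ge0// subr_ge0.
exact: uniform_grid_mono.
Qed.

Lemma uniform_grid_ge s u m k : s <= u -> s <= uniform_grid s u m k.
Proof. by move=> su; rewrite lerDl divr_ge0// mulr_ge0// subr_ge0. Qed.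

Lemma uniform_grid_le s u m k : s <= u -> (k <= m.+1)%N ->
  uniform_grid s u m k <= u.
Proof.
move=> su km; rewrite -[leRHS](uniform_gridn s u m).
apply: (@monotone_grid _ _ m.+1); last by rewrite km leqnn.
by move=> l _; exact: uniform_grid_mono.
Qed.

Lemma gap_sum_integrable sigma s u m : 0 <= s -> s <= u ->
  L1 (gap_sum sigma s u m).
Proof.
move=> s0 su; apply: (@integrable_rv_sum _ _ _ P _ _ (fun (k : 'I_m.+1) w =>
  (sigma (eps (uniform_grid s u m k.+1) w) - sigma (eps s w)) ^+ 2 *
    (uniform_grid s u m k.+1 - uniform_grid s u m k))) => k.
under [X in L1 X]eq_fun do rewrite mulrC.
apply: integrable_rvZ.
apply: (@integrable_rv_bounded _ _ _ _ _ ((sigma ord0 - sigma ord_max) ^+ 2)).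
  apply: measurable_funX; apply: (@FF_measurable_fun u).
  apply: FF_adaptedB; apply: FF_adapted_chain.
    rewrite (le_trans s0 (uniform_grid_ge _ _ su))/=.
    exact: uniform_grid_le.
  by rewrite s0.
move=> w; rewrite regime_gap ger0_norm; last first.
  by apply: mulr_ge0; [exact: sqr_ge0|exact: ler0n].
by rewrite ler_piMr ?sqr_ge0//; case: (_ != _).
Qed.

Definition gap_const (sigma : 'I_2 -> R) :=
  (sigma ord0 - sigma ord_max) ^+ 2 * total_rate lambda.

Lemma gap_const_ge0 sigma : 0 <= gap_const sigma.
Proof. by rewrite mulr_ge0 ?sqr_ge0// ltW// total_rate_gt0. Qed.

(** At a grid point the volatility differs from its value at [s] only if the regime has changed,
    which by [chain_change] has conditional probability at most the total rate times u - s. *)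
Lemma gap_sum_le sigma s u m A : 0 <= s -> s <= u -> FF s A ->
  Ex (fun w => \1_A w * gap_sum sigma s u m w) <=
  gap_const sigma * (u - s) ^+ 2 * fine (P A).
Proof.
move=> s0 su FA; have mA := filtration_measurable FA.
pose K := (sigma ord0 - sigma ord_max) ^+ 2.
have K0 : 0 <= K by exact: sqr_ge0.
pose g k := uniform_grid s u m k.
have gs k : s <= g k by exact: uniform_grid_ge.
have dg k : 0 <= g k.+1 - g k by rewrite subr_ge0; exact: uniform_grid_mono.
have L0 := total_rate_gt0 lambda_gt0.
have i1 (k : 'I_m.+1) : L1 (fun w => \1_A w * (eps (g k.+1) w != eps s w)%:R).
  apply: integrable_rv_indicM => //.
  apply: (@integrable_rv_bounded _ _ _ _ _ 1); last first.
    by move=> w; case: (_ != _); rewrite ?normr1 ?normr0.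
  under eq_fun do rewrite regime_change.
  apply: (@measurable_fun_approximation.measurable_sum _ _ _ _ _ _
    (fun (i : 'I_2) w => (eps s w == i)%:R * (eps (g k.+1) w == rev_ord i)%:R)) => i.
  by apply: measurable_funM; apply: measurable_regime_indic => //; rewrite (le_trans s0).
rewrite (_ : (fun w => _) = (fun w => \sum_(k < m.+1)
    (K * (g k.+1 - g k)) * (\1_A w * (eps (g k.+1) w != eps s w)%:R))); last first.
  apply/funext => w; rewrite /gap_sum mulr_sumr; apply: eq_bigr => k _.
  by rewrite regime_gap /K /g; ring.
rewrite Ex_sum; last by move=> k; exact: integrable_rvZ.
apply: (@le_trans _ _ (\sum_(k < m.+1) (K * (g k.+1 - g k)) *
    (total_rate lambda * (u - s) * fine (P A)))).
  apply: ler_sum => k _; rewrite ExZ//; apply: ler_wpM2l.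
    by rewrite mulr_ge0.
  apply: le_trans (chain_change (s := s) (t := g k.+1) _ FA) _.
    by rewrite s0 gs.
  apply: ler_wpM2r; first by rewrite fine_ge0.
  rewrite ler_pM2l// lerD2r; exact: uniform_grid_le.
rewrite -mulr_suml -mulr_sumr.
rewrite -(big_mkord xpredT (fun k => g k.+1 - g k)) telescope_sumr//.
rewrite /g uniform_gridn uniform_grid0 /gap_const.
by rewrite le_eqVlt; apply/orP; left; apply/eqP; rewrite /K; ring.
Qed.

Definition right_continuous_path w :=
  forall t, 0 <= t -> \forall s \near t^'+, eps s w = eps t w.

Lemma ae_right_continuous : {ae P, forall w, right_continuous_path w}.
Proof.
have [_ + _] := epsMC; apply: filterS => w /= [+ _]; exact.
Qed.

Lemma measurable_regime_path (sigma : 'I_2 -> R) s u w : 0 <= s ->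
  right_continuous_path w ->
  measurable_fun `]s, u] (fun r => sigma (eps r w) : R).
Proof.
move=> s0 rc; apply/measurable_EFinP.
apply: (@emeasurable_fun_cvg _ _ _ _ (fun m r => (\sum_(k < m.+1)
    sigma (eps (uniform_grid s u m k.+1) w) *
    \1_(`]uniform_grid s u m k, uniform_grid s u m k.+1]%classic) r)%:E)).
  by move=> m; apply/measurable_EFinP; exact: (measurable_step
    (fun k => sigma (eps (uniform_grid s u m k.+1) w))).
move=> r /=; rewrite in_itv/= => sru; apply/cvg_EFin; first exact: nearW.
exact: (@right_continuous_grid R 'I_2 (fun r => eps r w) sigma s u r rc s0 sru).
Qed.

(** Fatou's lemma in time, along the Riemann sums. The bound is useful because the sums, unlike the
    integral, are visibly measurable in [w]. *)
Lemma gap_integral_le (sigma : 'I_2 -> R) s u w : 0 <= s -> s <= u ->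
  right_continuous_path w ->
  (\int[mu]_(r in `]s, u]) ((sigma (eps r w) - sigma (eps s w)) ^+ 2)%:E <=
   limn_einf (fun m => (gap_sum sigma s u m w)%:E))%E.
Proof.
move=> s0 su rc.
pose phi (i : 'I_2) := (sigma i - sigma (eps s w)) ^+ 2.
pose f m (r : R) : \bar R := (\sum_(k < m.+1) phi (eps (uniform_grid s u m k.+1) w) *
    \1_(`]uniform_grid s u m k, uniform_grid s u m k.+1]%classic) r)%:E.
have mf m : measurable_fun `]s, u] (f m).
  by apply/measurable_EFinP; exact: (measurable_step
    (fun k => phi (eps (uniform_grid s u m k.+1) w))).
have f0 m r : (0 <= f m r)%E.
  rewrite lee_fin; apply: sumr_ge0 => k _.
  by apply: mulr_ge0; [exact: sqr_ge0|rewrite indicE].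
have flim r : (`]s, u]%classic : set R) r -> limn_einf (f ^~ r) = (phi (eps r w))%:E.
  rewrite /= in_itv/= => sru.
  have H : f m r @[m --> \oo] --> (phi (eps r w))%:E.
    apply/cvg_EFin; first exact: nearW.
    exact: (@right_continuous_grid R 'I_2 (fun r => eps r w) phi s u r rc s0 sru).
  by rewrite is_cvg_limn_einfE; [exact: cvg_lim|apply: cvgP; exact: H].
have fint m : (\int[mu]_(r in `]s, u]) f m r = (gap_sum sigma s u m w)%:E)%E.
  rewrite /f (@integral_step R (fun k => phi (eps (uniform_grid s u m k.+1) w))
    (uniform_grid s u m) m.+1 s u)//.
  - by move=> k _; exact: uniform_grid_mono.
  - by move=> k _; exact: sqr_ge0.
  - by rewrite uniform_grid0.
  - by rewrite uniform_gridn.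
have := @fatou _ _ _ mu `]s, u]%classic (measurable_itv _) f mf (fun m r _ => f0 m r).
under eq_integral => r /set_mem/flim -> do over.
by under [X in (_ <= limn_einf X)%E]eq_fun do rewrite fint.
Qed.

(** From (p - q)^2 <= 2 (p - o)^2 + 2 (o - q)^2 with p the step process, q = sigma(eps_s) and o =
    sigma(eps_r), integrated over ]s, u]. On the left stands half the quadratic variation of the
    refined step sum, which approximates the increment of the Ito integral minus sigma(eps_s) times
    that of W. *)
Lemma step_path_le (sigma : 'I_2 -> R) (H : step_process (R := R) T) s u w :
  0 <= s -> s < u -> right_continuous_path w ->
  (forall k, (k < sp_size H)%N -> sp_time H k <= sp_time H k.+1) ->
  let N := sp_size H in
  let e := refined_coef (fun k => sp_coef H k w) N (sigma (eps s w)) in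
  let tau := refined_time (sp_time H) N s u in
  ((2^-1 * \sum_(k < N.+2) e k ^+ 2 * (tau k.+1 - tau k))%:E <=
   \int[mu]_(r in `[0%R, u]) ((sp_value H r w - sigma (eps r w)) ^+ 2)%:E +
   limn_einf (fun m => (gap_sum sigma s u m w)%:E))%E : Prop.
Proof.
move=> s0 su rc mono N e tau.
have taum k : (k < N.+2)%N -> tau k <= tau k.+1.
  by apply: refined_time_mono => //; exact: ltW.
have m1 : measurable_fun `]s, u] (fun r => sp_value H r w : R).
  exact: (measurable_step (fun k => sp_coef H k w)).
have m2 := measurable_regime_path sigma (u := u) s0 rc.
pose v := sigma (eps s w).
have half0 : (0 <= (2^-1 : R)%:E)%E by rewrite lee_fin invr_ge0.
have -> : (2^-1 * \sum_(k < N.+2) e k ^+ 2 * (tau k.+1 - tau k))%:E =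
    (\int[mu]_(r in `]s, u]) (2^-1 * (sp_value H r w - v) ^+ 2)%:E)%E.
  rewrite EFinM -(@integral_step R (fun k => e k ^+ 2) tau N.+2 s u taum)//; last 2 first.
  - by move=> k _; exact: sqr_ge0.
  - by rewrite /tau /= ltnn.
  rewrite -ge0_integralZl//.
  - apply: eq_integral => r; rewrite inE/= in_itv/= => sru.
    by rewrite -EFinM -sqr_step// refined_value// ltW.
  - by apply/measurable_EFinP; exact: (measurable_step (fun k => e k ^+ 2)).
  - move=> r _; rewrite lee_fin; apply: sumr_ge0 => k _.
    by apply: mulr_ge0; [exact: sqr_ge0|rewrite indicE].
apply: (@le_trans _ _ (\int[mu]_(r in `]s, u])
    (((sp_value H r w - sigma (eps r w)) ^+ 2)%:E +
     ((sigma (eps r w) - v) ^+ 2)%:E))%E).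
  apply: ge0_le_integral => //.
  - by move=> r _; rewrite lee_fin mulr_ge0// sqr_ge0.
  - apply/measurable_EFinP; apply: measurable_funM => //.
    by apply: measurable_funX; exact: measurable_funB.
  - apply: emeasurable_funD; apply/measurable_EFinP; apply: measurable_funX;
      exact: measurable_funB.
  - move=> r _; rewrite -EFinD lee_fin.
    set x := sp_value H r w; set y := sigma _.
    have := sqr_ge0 (x - y - (y - v)); nra.
rewrite ge0_integralD//; first last.
- by apply/measurable_EFinP; apply: measurable_funX; exact: measurable_funB.
- by move=> r _; rewrite lee_fin sqr_ge0.
- by apply/measurable_EFinP; apply: measurable_funX; exact: measurable_funB.
- by move=> r _; rewrite lee_fin sqr_ge0.
apply: leeD; last by apply: gap_integral_le => //; exact: ltW.
apply: ge0_le_integral_nonmeasurable => //.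
- move=> r /=; rewrite !in_itv/= => /andP[/ltW sr ->].
  by rewrite (le_trans s0 sr).
- by move=> r; rewrite lee_fin sqr_ge0.
- by move=> r; rewrite lee_fin sqr_ge0.
Qed.

Lemma sp_time_ge0 (H : step_process (R := R) T) k : adapted_step_process FF H ->
  (k <= sp_size H)%N -> 0 <= sp_time H k.
Proof.
move=> [t0 adp] kn; apply: le_trans t0 _.
apply: (@monotone_grid _ _ (sp_size H)); last by rewrite kn.
by move=> l ln; have [] := adp l ln.
Qed.

Lemma sp_coef_measurable (H : step_process (R := R) T) k : adapted_step_process FF H ->
  (k < sp_size H)%N -> measurable_fun [set: T] (sp_coef H k).
Proof.
by move=> [_ adp] kn; have [_ + _] := adp k kn; exact: FF_measurable_fun.
Qed.

Lemma sp_integral_square_integrable (H : step_process (R := R) T) t : 0 <= t ->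
  adapted_step_process FF H -> L2 (sp_integral H W t).
Proof.
move=> t0 adp; apply: (@square_integrable_sum _ _ _ P _ _ (fun (k : 'I_(sp_size H)) w =>
  sp_coef H k w * (W (Num.min (sp_time H k.+1) t) w - W (Num.min (sp_time H k) t) w))) => k.
have [_ /(_ k (ltn_ord k))[mono _ [M cM]]] := adp.
have h1 : 0 <= Num.min (sp_time H k) t.
  by rewrite le_min t0 andbT; apply: sp_time_ge0 => //; exact: ltnW.
apply: (square_integrableM_bounded _ cM).
  by apply: sp_coef_measurable.
apply: (DW_square_integrable _).1; rewrite h1/=.
by rewrite le_min !ge_min mono lexx !orbT.
Qed.

Lemma ge0_integral_square_integrable (f : T -> R) : measurable_fun [set: T] f ->
  (\int[P]_w (f w ^+ 2)%:E < +oo)%E -> L2 f.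
Proof.
move=> mf fy; split => //; apply/integrableP; split.
  by apply/measurable_EFinP; exact: measurable_funX.
by under eq_integral do rewrite /= ger0_norm ?sqr_ge0//.
Qed.

(** * Mean and mean square of the increments of the Ito integral *)

Section ItoProcess.
Variables (sigma : 'I_2 -> R) (J : R -> T -> R).
Hypothesis JI : ito_integral P FF W (fun t w => sigma (eps t w)) J.

Lemma ito_adapted t : 0 <= t -> measurable_wrt (FF t) (J t).
Proof. by case: JI => + _ _; exact. Qed.

(** A step integral is square integrable, and some step integral has mean square distance less than
    1 to [J t]. *)
Lemma ito_square_integrable t : 0 <= t -> L2 (J t).
Proof.
move=> t0; have [mJ _ [H [adp cvH]]] := JI.
have [_ c2] := cvH t t0.
have nb : nbhs 0%E (fun x : \bar R => (x < 1%:E)%E).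
  by apply: (nbhs_open_ereal_lt (r := 0) (f := fun=> 1)).
have [n _ /(_ n (leqnn n)) hn] := c2 _ nb.
have I2 := sp_integral_square_integrable t0 (adp n).
have mJt : measurable_fun [set: T] (J t) by exact: (FF_measurable_fun (mJ t t0)).
rewrite (_ : J t = fun w => sp_integral (H n) W t w - (sp_integral (H n) W t w - J t w)); last first.
  by apply/funext => w; ring.
apply: square_integrableB => //; apply: ge0_integral_square_integrable.
  by apply: measurable_funB => //; case: I2.
by rewrite (lt_trans hn)// ltry.
Qed.

(* The increment of [J] minus [sigma(eps_s)] times that of [W] is a step sum [y]
   plus an error [r] which is small in mean square. *)
Lemma ito_increment_approx s t A eta : 0 <= s < t -> FF s A -> 0 < eta ->
  exists y r : T -> R,
  [/\ forall w, J t w - J s w - sigma (eps s w) * (W t w - W s w) = y w + r w,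
      L2 y /\ L2 r, Ex (fun w => \1_A w * y w) = 0,
      Ex (fun w => \1_A w * y w ^+ 2) <=
        2 * (eta + gap_const sigma * (t - s) ^+ 2 * fine (P A)) &
      Ex (fun w => r w ^+ 2) <= 4 * eta].
Proof.
move=> /andP[s0 st] FA eta0; have [mJ _ [H [adpH cvH]]] := JI.
have t0 : 0 <= t := le_trans s0 (ltW st).
have mA := filtration_measurable FA.
have Jt2 := ito_square_integrable t0; have Js2 := ito_square_integrable s0.
have [n [hn1 hn2 hn3]] : exists n,
  [/\ (\int[P]_w \int[mu]_(r in `[0%R, t])
        ((sp_value (H n) r w - sigma (eps r w)) ^+ 2)%:E < eta%:E)%E,
      (\int[P]_w ((sp_integral (H n) W t w - J t w) ^+ 2)%:E < eta%:E)%E &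
      (\int[P]_w ((sp_integral (H n) W s w - J s w) ^+ 2)%:E < eta%:E)%E].
  have [c1 c2] := cvH t t0; have [_ c3] := cvH s s0.
  have nb : nbhs 0%E (fun x => (x < eta%:E)%E).
    exact: (nbhs_open_ereal_lt (r := 0) (f := fun=> eta)).
  have [n1 _ h1] := c1 _ nb; have [n2 _ h2] := c2 _ nb; have [n3 _ h3] := c3 _ nb.
  pose m := maxn n1 (maxn n2 n3).
  have m1 : (n1 <= m)%N by rewrite leq_maxl.
  have m2 : (n2 <= m)%N by rewrite !leq_max leqnn orbT.
  have m3 : (n3 <= m)%N by rewrite !leq_max leqnn !orbT.
  exists m; split; [exact: (h1 m m1)|exact: (h2 m m2)|exact: (h3 m m3)].
set G := H n in hn1 hn2 hn3; have adp : adapted_step_process FF G by exact: adpH.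
have [_ adpk] := adp.
pose N := sp_size G; pose tau := refined_time (sp_time G) N s t.
pose e k w := refined_coef (fun k => sp_coef G k w) N (sigma (eps s w)) k.
have mono k : (k < sp_size G)%N -> sp_time G k <= sp_time G k.+1.
  by move=> kn; have [] := adpk k kn.
have taum k : (k < N.+2)%N -> tau k <= tau k.+1.
  by apply: refined_time_mono => //; exact: ltW.
have taus k : (k <= N.+2)%N -> s <= tau k.
  move=> kn; apply: (@le_trans _ _ (tau 0%N)) => //.
  by apply: (@monotone_grid _ _ N.+2) => //; rewrite kn.
have adv k : (k <= N.+2)%N -> measurable_wrt (FF (tau k)) (fun w => sigma (eps s w)).
  by move=> kn; apply: FF_adapted_chain; rewrite s0 taus.
have mv : measurable_fun [set: T] (fun w => sigma (eps s w)).
  by apply: (@FF_measurable_fun s); apply: FF_adapted_chain; rewrite s0 lexx.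
have vb w : `|sigma (eps s w)| <= \sum_i `|sigma i|.
  by rewrite (bigD1 (eps s w))//= lerDl sumr_ge0.
pose S w := \sum_(k < N.+2) e k w * (W (tau k.+1) w - W (tau k) w).
pose Q w := \sum_(k < N.+2) e k w ^+ 2 * (tau k.+1 - tau k).
have [_ S2 Q1 ES EQ] : [/\ measurable_wrt (FF (tau N.+2)) S, L2 S, L1 Q,
    Ex (fun w => \1_A w * S w) = 0 &
    Ex (fun w => \1_A w * S w ^+ 2) = Ex (fun w => \1_A w * Q w)].
  apply: (step_isometry (s := s)) => //.
  - move=> [|k] kn tk.
      rewrite (_ : e 0%N = fun w => 0 - sigma (eps s w)); last first.
        by apply/funext => w; rewrite /e /= sub0r.
      by apply: FF_adaptedB; [exact: FF_adapted_cst|exact: adv].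
    have kN : (k <= N)%N by [].
    rewrite /e /refined_coef; case: (boolP (k < N)%N) => kn1; last first.
      rewrite (_ : (fun w => _) = fun w => 0 - sigma (eps s w)); last first.
        by apply/funext => w; rewrite sub0r.
      by apply: FF_adaptedB; [exact: FF_adapted_cst|apply: adv; exact: ltnW].
    apply: FF_adaptedB; last by apply: adv; exact: ltnW.
    have [_ + _] := adpk k kn1; apply: FF_adapted_mono.
    (* If the k-th time came after [t], both ends of its cell would be clamped to the same point. So
       a non-degenerate cell starts at or after the time at which its coefficient is known. *)
    move: tk; rewrite /tau /refined_time kN kn1.
    have [kt|tk] := leP (sp_time G k) t; first by rewrite le_max lexx orbT.
    have tk1 : t <= sp_time G k.+1 := le_trans (ltW tk) (mono k kn1).
    by rewrite (min_idPr tk1) ltxx.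
  - move=> [|k] kn; rewrite /e /refined_coef.
      by apply: measurableT_comp.
    case: (boolP (k < N)%N) => kn1; last by apply: measurableT_comp.
    by apply: measurable_funB => //; exact: sp_coef_measurable.
  - move=> [|k] kn; rewrite /e /refined_coef.
      by exists (\sum_i `|sigma i|) => w; rewrite normrN.
    case: (boolP (k < N)%N) => kn1; last by exists (\sum_i `|sigma i|) => w; rewrite normrN.
    have [_ _ [M cM]] := adpk k kn1.
    exists (M + \sum_i `|sigma i|) => w.
    by apply: le_trans (ler_normB _ _) _; exact: lerD.
pose rt w := sp_integral G W t w - J t w.
pose rs w := sp_integral G W s w - J s w.
have It2 := sp_integral_square_integrable t0 adp.
have Is2 := sp_integral_square_integrable s0 adp.
have rt2 : L2 rt by exact: square_integrableB.
have rs2 : L2 rs by exact: square_integrableB.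
exists S, (fun w => rs w - rt w); split => //.
- move=> w; rewrite /S /e /tau.
  rewrite (@refined_sum R (sp_time G) (fun k => sp_coef G k w) N s t (sigma (eps s w)) (W^~ w) (ltW st)).
  by rewrite /rs /rt /sp_integral; ring.
- by split => //; exact: square_integrableB.
(* By the isometry it remains to bound the quadratic variation, which [step_path_le] does path by
   path: [al] is the distance of the step process to the volatility along the path, [gl] the lower
   limit of the Riemann sums. *)
- have Qh1 : L1 (fun w => 2^-1 * Q w) by exact: integrable_rvZ.
  have -> : Ex (fun w => \1_A w * S w ^+ 2) = 2 * Ex (fun w => \1_A w * (2^-1 * Q w)).
    rewrite EQ -ExZ; last exact: integrable_rv_indicM.
    by congr (Rintegral _ _ _); apply/funext => w; field.
  rewrite ler_pM2l//.
  rewrite -lee_fin (Ex_setE mA Qh1) EFinD.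
  pose gl w := limn_einf (fun m => (gap_sum sigma s t m w)%:E).
  pose al w := (\int[mu]_(r in `[0%R, t]) ((sp_value G r w - sigma (eps r w)) ^+ 2)%:E)%E.
  have gm m : measurable_fun [set: T] (fun w => (gap_sum sigma s t m w)%:E).
    by apply/measurable_EFinP; apply: integrable_rv_measurable; apply: gap_sum_integrable => //; exact: ltW.
  have g0 m w : (0 <= (gap_sum sigma s t m w)%:E)%E.
    by rewrite lee_fin; apply: gap_sum_ge0; exact: ltW.
  have mgl : measurable_fun [set: T] gl.
    rewrite (_ : gl = fun w => - limn_esup (-%E \o (fun m => (gap_sum sigma s t m w)%:E)))%E.
      apply: measurableT_comp => //; apply: measurable_fun_limn_esup => m.
      exact: measurableT_comp.
    by apply/funext => w; rewrite limn_esupN oppeK.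
  have gl0 w : (0 <= gl w)%E.
    rewrite /gl limn_einf_lim; apply: lime_ge; first exact: is_cvg_einfs.
    by apply: nearW => k; apply: le_ereal_inf_tmp => _ [l /= _ <-].
  have al0 w : (0 <= al w)%E by apply: integral_ge0 => r _; rewrite lee_fin sqr_ge0.
  apply: (@le_trans _ _ (\int[P]_(w in A) al w + \int[P]_(w in A) gl w)%E).
    apply: ge0_integral_le_add => //.
    + by apply/measurable_EFinP; exact: (integrable_rv_measurable Qh1).
    + move=> w; rewrite lee_fin mulr_ge0//; apply: sumr_ge0 => k _.
      by apply: mulr_ge0; [exact: sqr_ge0|rewrite subr_ge0 taum].
    + apply: filterS ae_right_continuous => w rc.
      exact: (step_path_le sigma s0 st rc mono).
  apply: leeD.
    by apply: le_trans (ltW hn1); apply: ge0_le_integral_nonmeasurable.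
  have := @fatou _ _ _ P A mA (fun m w => (gap_sum sigma s t m w)%:E)
    (fun m => measurable_funTS (gm m)) (fun m w _ => g0 m w).
  move=> /le_trans; apply; rewrite limn_einf_lim; apply: lime_le; first exact: is_cvg_einfs.
  apply: nearW => k; apply: le_trans.
    by apply: ereal_inf_lbound; exists k => /=.
  rewrite -Ex_setE ?lee_fin//; last by apply: gap_sum_integrable => //; exact: ltW.
  by apply: gap_sum_le => //; exact: ltW.
- have bound f : L2 f -> (\int[P]_w (f w ^+ 2)%:E < eta%:E)%E ->
      Ex (fun w => f w ^+ 2) <= eta.
    by move=> [_ f1] h; rewrite -lee_fin EFin_Ex// ltW.
  apply: (@le_trans _ _ (Ex (fun w => 2 * rs w ^+ 2 + 2 * rt w ^+ 2))).
    apply: Ex_le.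
    + by case: (square_integrableB rs2 rt2).
    + by apply: integrable_rvD; apply: integrable_rvZ; [by case: rs2|by case: rt2].
    + by move=> w; have := sqr_ge0 (rs w + rt w); nra.
  rewrite ExD; [|by apply: integrable_rvZ; case: rs2|by apply: integrable_rvZ; case: rt2].
  rewrite !ExZ; [|by case: rt2|by case: rs2].
  have := bound rs rs2 hn3; have := bound rt rt2 hn2; lra.
Qed.

Lemma ito_increment_mean s t A : 0 <= s < t -> FF s A ->
  Ex (fun w => \1_A w * (J t w - J s w)) = 0.
Proof.
move=> st FA; have [s0 st'] := andP st.
have mA := filtration_measurable FA.
have t0 : 0 <= t := le_trans s0 (ltW st').
have st2 : 0 <= s <= t by rewrite s0 ltW.
have [D2 _] := DW_square_integrable st2.
have av : measurable_wrt (FF s) (fun w => \1_A w * sigma (eps s w)).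
  apply: FF_adaptedM; first exact: FF_adapted_indic.
  by apply: FF_adapted_chain; rewrite s0 lexx.
have vb w : `|\1_A w * sigma (eps s w)| <= \sum_i `|sigma i|.
  rewrite normrM (bigD1 (eps s w))//= -[leLHS]addr0; apply: lerD; last exact: sumr_ge0.
  by rewrite ler_piMl//; exact: norm_indic_le1.
have vD2 : L2 (fun w => (\1_A w * sigma (eps s w)) * (W t w - W s w)).
  exact: (square_integrableM_bounded (FF_measurable_fun av) vb).
have ED : Ex (fun w => (\1_A w * sigma (eps s w)) * (W t w - W s w)) = 0.
  apply: (@FF_mean_zero s) => //; try exact: square_integrable_integrable.
  by move=> B FB; have [] := DW_moments st2 FB.
apply/eqP; rewrite -normr_le0; apply/ler_addgt0Pr => del del0; rewrite add0r.
(* With this [eta] the mean square of [r] is at most del^2/4, and |r| <= del/2 + r^2/(2 del) bounds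
   the mean of |r| by less than [del]. *)
have eta0 : 0 < (del / 4) ^+ 2 by rewrite exprn_gt0// divr_gt0.
have [y [r [yrE [y2 r2] Ey _ Er]]] := ito_increment_approx st FA eta0.
rewrite (_ : (fun w => _) = (fun w => \1_A w * y w + \1_A w * r w +
    (\1_A w * sigma (eps s w)) * (W t w - W s w))); last first.
  by apply/funext => w; rewrite -mulrDr -yrE; ring.
have r1 : L1 (fun w => \1_A w * r w).
  by apply: integrable_rv_indicM => //; exact: square_integrable_integrable.
have y1 : L1 (fun w => \1_A w * y w).
  by apply: integrable_rv_indicM => //; exact: square_integrable_integrable.
rewrite ExD; [|exact: integrable_rvD|exact: square_integrable_integrable].
rewrite ED addr0 ExD// Ey add0r.
apply: le_trans (Ex_norm r1) _.
apply: (@le_trans _ _ (Ex (fun w => del / 2 + (2 * del)^-1 * r w ^+ 2))).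
  apply: Ex_le; first exact: integrable_rv_norm.
    apply: integrable_rvD.
      by apply: (@integrable_rv_bounded _ _ _ _ _ `|del / 2|).
    by apply: integrable_rvZ; case: r2.
  move=> w; rewrite normrM; apply: (@le_trans _ _ `|r w|).
    by rewrite ler_piMl//; exact: norm_indic_le1.
  have := sqr_ge0 (`|r w| - del); rewrite sqrrB real_normK ?num_real// => h.
  rewrite -(ler_pM2l (x := 2 * del)) ?mulr_gt0//.
  rewrite [leRHS](_ : _ = del ^+ 2 + r w ^+ 2); last by field; rewrite gt_eqF.
  by lra.
rewrite ExD; [|by apply: (@integrable_rv_bounded _ _ _ _ _ `|del / 2|)|by apply: integrable_rvZ; case: r2].
rewrite Ex_cst ExZ; last by case: r2.
have : (2 * del)^-1 * Ex (fun w => r w ^+ 2) <= (2 * del)^-1 * (4 * (del / 4) ^+ 2).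
  by rewrite ler_pM2l// invr_gt0 mulr_gt0.
rewrite [X in _ <= X -> _](_ : _ = del / 8); first by lra.
by field; rewrite gt_eqF.
Qed.

Lemma ito_increment_error s t A : 0 <= s < t -> FF s A ->
  Ex (fun w => \1_A w * (J t w - J s w - sigma (eps s w) * (W t w - W s w)) ^+ 2) <=
  4 * gap_const sigma * (t - s) ^+ 2 * fine (P A).
Proof.
move=> st FA; have mA := filtration_measurable FA.
apply/ler_addgt0Pr => del del0.
(* Expanding the square of y + r costs 2 (2 eta) + 2 (4 eta) = 12 eta beyond the main term. *)
have eta0 : 0 < del / 12 by rewrite divr_gt0.
have [y [r [yrE [y2 r2] _ Ey Er]]] := ito_increment_approx st FA eta0.
have yy : L1 (fun w => \1_A w * y w ^+ 2) by apply: integrable_rv_indicM => //; case: y2.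
have rr : L1 (fun w => r w ^+ 2) by case: r2.
apply: (@le_trans _ _ (Ex (fun w => 2 * (\1_A w * y w ^+ 2) + 2 * r w ^+ 2))).
  apply: Ex_le.
  - under [X in L1 X]eq_fun do rewrite yrE.
    by apply: integrable_rv_indicM => //; case: (square_integrableD y2 r2).
  - by apply: integrable_rvD; apply: integrable_rvZ.
  - move=> w; rewrite yrE indicE; case: (w \in A); rewrite ?mul1r ?mul0r.
      by have := sqr_ge0 (y w - r w); nra.
    by rewrite mulr0 add0r mulr_ge0// sqr_ge0.
rewrite ExD; [|exact: integrable_rvZ|exact: integrable_rvZ].
rewrite !ExZ//; lra.
Qed.

(** The times of the step processes are nonnegative, so their integrals vanish at time 0 and so does
    their mean square limit. *)
Lemma ito_start : {ae P, forall w, J 0 w = 0}.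
Proof.
have [mJ _ [H [adpH cvH]]] := JI.
have I0 n w : sp_integral (H n) W 0 w = 0.
  apply: big1 => k _; rewrite !(min_idPr _) ?subrr ?mulr0//; apply: sp_time_ge0 => //.
  exact: ltnW.
have [_ c2] := cvH 0 (lexx 0).
have mJ0 : measurable_fun [set: T] (fun w => (J 0 w ^+ 2)%:E).
  by apply/measurable_EFinP; apply: measurable_funX; exact: (FF_measurable_fun (mJ 0 (lexx 0))).
have z : (\int[P]_w (J 0 w ^+ 2)%:E = 0)%E.
  have e n : (\int[P]_w ((sp_integral (H n) W 0 w - J 0 w) ^+ 2)%:E =
      \int[P]_w (J 0 w ^+ 2)%:E)%E.
    by apply: eq_integral => w _; rewrite I0 sub0r sqrrN.
  move: c2; rewrite (funext e) => /(cvg_lim (@ereal_hausdorff R)) <-.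
  by rewrite lim_cst//; exact: ereal_hausdorff.
have : (\int[P]_w `|(J 0 w ^+ 2)%:E| = 0)%E.
  by rewrite -[RHS]z; apply: eq_integral => w _; rewrite gee0_abs// lee_fin sqr_ge0.
move=> /(ae_eq_integral_abs P measurableT mJ0); apply: filterS => w /(_ I).
by case=> /eqP; rewrite sqrf_eq0 => /eqP.
Qed.

End ItoProcess.

(** * The diffusion and smooth test functions *)

Section Diffusion.
Variables (sigma : 'I_2 -> R) (x : R) (X : R -> T -> R).
Hypothesis XI : regime_switching_diffusion P W eps sigma x X.

Let incE s t w : (X t w - x) - (X s w - x) = X t w - X s w.
Proof. by ring. Qed.

Lemma X_adapted t : 0 <= t -> measurable_wrt (FF t) (X t).
Proof.
move=> t0; rewrite (_ : X t = fun w => (X t w - x) + x); last first.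
  by apply/funext => w; rewrite subrK.
by apply: FF_adaptedD; [exact: (ito_adapted XI)|exact: FF_adapted_cst].
Qed.

Lemma X_square_integrable t : 0 <= t -> L2 (X t).
Proof.
move=> t0; rewrite (_ : X t = fun w => (X t w - x) + x); last first.
  by apply/funext => w; rewrite subrK.
apply: square_integrableD; first exact: (ito_square_integrable XI).
by apply: (@square_integrable_bounded _ _ _ _ _ `|x|).
Qed.

Lemma X_start : {ae P, forall w, X 0 w = x}.
Proof.
by apply: filterS (ito_start XI) => w /eqP; rewrite subr_eq0 => /eqP.
Qed.

Lemma X_mean s t A : 0 <= s < t -> FF s A ->
  Ex (fun w => \1_A w * (X t w - X s w)) = 0.
Proof.
move=> st FA; have := ito_increment_mean XI st FA.
by under eq_Rintegral do rewrite incE.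
Qed.

Lemma X_error s t A : 0 <= s < t -> FF s A ->
  Ex (fun w => \1_A w * (X t w - X s w - sigma (eps s w) * (W t w - W s w)) ^+ 2) <=
  4 * gap_const sigma * (t - s) ^+ 2 * fine (P A).
Proof.
move=> st FA; have := ito_increment_error XI st FA.
by under eq_Rintegral do rewrite incE.
Qed.

(** Functions with bounded derivatives [phi1], [phi2] and a Lipschitz second derivative, stated
    through the Taylor estimates that the one-step expansion uses, with a single constant. *)
Definition smooth_test (K : R) (phi phi1 phi2 : R -> 'I_2 -> R) :=
  [/\ forall i, [/\ measurable_fun [set: R] (phi ^~ i),
        measurable_fun [set: R] (phi1 ^~ i) & measurable_fun [set: R] (phi2 ^~ i)],
      forall i y, [/\ `|phi1 y i| <= K, `|phi2 y i| <= K &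
        `|phi y (rev_ord i) - phi y i| <= K],
      forall i y e, `|phi1 (y + e) i - phi1 y i| <= K * `|e|,
      forall i y e, `|phi (y + e) i - phi y i - phi1 y i * e| <= K * e ^+ 2 /\
        `|phi (y + e) i - phi y i| <= K * `|e| &
      forall i y e, `|phi (y + e) i - phi y i - phi1 y i * e -
        phi2 y i / 2 * e ^+ 2| <= K * `|e| ^+ 3].

Definition gen_test (phi phi2 : R -> 'I_2 -> R) (y : R) (i : 'I_2) : R :=
  sigma i ^+ 2 / 2 * phi2 y i + lambda i * (phi y (rev_ord i) - phi y i).

Definition one_step_const (K : R) :=
  let s2 := sigma ord0 ^+ 2 + sigma ord_max ^+ 2 in
  4 * K * (4 * gap_const sigma + s2 + 64 * s2 ^+ 2 + total_rate lambda) +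
  K * total_rate lambda ^+ 2.

Lemma rev_ord_neq i : (rev_ord i == i) = false.
Proof. by apply/negbTE; rewrite ord2_neq. Qed.

Lemma rate_le i : lambda i <= total_rate lambda.
Proof. by rewrite (total_rateE lambda i) lerDl ltW. Qed.

Lemma sigma_sqr_le i : sigma i ^+ 2 <= sigma ord0 ^+ 2 + sigma ord_max ^+ 2.
Proof.
have [->|] := eqVneq i ord0; first by rewrite lerDl sqr_ge0.
have o : rev_ord (@ord0 1) = ord_max by exact: val_inj.
by rewrite ord2_neq o => /eqP ->; rewrite lerDr sqr_ge0.
Qed.

(* Expansion of [phi] along [D = D' + E], with [D'] the Brownian part and [E] the
   error due to the regime changes; the mixed terms are split by Young's
   inequality with the weights dictated by [h = k^4]. *)
Lemma one_step_pointwise K phi phi1 phi2 k y D De i j :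
  smooth_test K phi phi1 phi2 -> 0 < k <= 1 ->
  `|phi (y + D) j - phi y i - k ^+ 4 * gen_test phi phi2 y i
    - phi1 y i * D - phi2 y i / 2 * (De ^+ 2 - sigma i ^+ 2 * k ^+ 4)
    - ((j == rev_ord i)%:R - jump_prob lambda i (k ^+ 4)) * (phi y (rev_ord i) - phi y i)|
  <= 4 * K * ((k ^+ 2)^-1 * (D - De) ^+ 2 + k ^+ 2 * De ^+ 2 + (k ^+ 3)^-1 * De ^+ 4 +
       k * (j != i)%:R) + K * total_rate lambda ^+ 2 * k ^+ 8.
Proof.
move=> [_ hb hL hT hT3] /andP[k0 k1].
pose E := D - De; pose h := k ^+ 4; rewrite -/E -/h.
have h0 : 0 <= h by rewrite exprn_ge0// ltW.
have K0 : 0 <= K by have [+ _ _] := hb i y; apply: le_trans.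
have L0 := total_rate_gt0 lambda_gt0.
pose J : R := (j != i)%:R.
have J0 : 0 <= J by rewrite /J.
(* The path from (y, i) to (y + D, j): [a1] is the Taylor remainder in E at the displaced point,
   [a2] and [a3] bring the slope in front of E back to (y, i), [a4] is the effect of the regime
   change on the increment over De, [a5] the second-order remainder in De, and [a6] replaces the
   jump probability by its rate. *)
pose a1 := phi (y + De + E) j - phi (y + De) j - phi1 (y + De) j * E.
pose a2 := (phi1 (y + De) j - phi1 y j) * E.
pose a3 := (phi1 y j - phi1 y i) * E.
pose a4 := phi (y + De) j - phi y j - (phi (y + De) i - phi y i).
pose a5 := phi (y + De) i - phi y i - phi1 y i * De - phi2 y i / 2 * De ^+ 2.
pose a6 := (jump_prob lambda i h - h * lambda i) * (phi y (rev_ord i) - phi y i).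
have jE : phi y j - phi y i = (j == rev_ord i)%:R * (phi y (rev_ord i) - phi y i).
  have [->|ji] := eqVneq j (rev_ord i); first by rewrite mul1r.
  by move: ji; rewrite -ord2_neq negbK => /eqP ->; rewrite subrr mul0r.
rewrite (_ : _ - _ * _ = a1 + a2 + a3 + a4 + a5 + a6); last first.
  rewrite /a1 /a2 /a3 /a4 /a5 /a6 /gen_test mulrBl -jE /E.
  by rewrite (_ : y + De + (D - De) = y + D); [ring|ring].
have b1 : `|a1| <= K * E ^+ 2 by have [] := hT j (y + De) E.
have b2 : `|a2| <= K * `|De| * `|E| by rewrite normrM ler_wpM2r.
have b3 : `|a3| <= 2 * K * J * `|E|.
  rewrite normrM ler_wpM2r// /J; have [->|ji] := eqVneq j i.
    by rewrite subrr normr0 mulr0.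
  rewrite mulr1; apply: le_trans (ler_normB _ _) _.
  have [h1 _ _] := hb j y; have [h2 _ _] := hb i y; lra.
have b4 : `|a4| <= 2 * K * J * `|De|.
  rewrite /a4 /J; have [->|ji] := eqVneq j i.
    by rewrite subrr normr0 mulr0 mul0r.
  rewrite mulr1; apply: le_trans (ler_normB _ _) _.
  have [_ h1] := hT j y De; have [_ h2] := hT i y De; lra.
have b5 : `|a5| <= K * `|De| ^+ 3 by exact: hT3.
have b6 : `|a6| <= K * total_rate lambda ^+ 2 * k ^+ 8.
  rewrite normrM mulrC -mulrA; apply: ler_pM => //; first by have [] := hb i y.
  apply: le_trans (jump_prob_approx lambda_gt0 i h0) _.
  have -> : k ^+ 8 = h ^+ 2 by rewrite /h -exprM.
  apply: ler_wpM2r; first exact: sqr_ge0.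
  by rewrite [leRHS]expr2 ler_wpM2r ?rate_le// ltW.
set e := `|E| in b2 b3; set dd := `|De| in b2 b4 b5.
have e0 : 0 <= e by exact: normr_ge0.
have d0 : 0 <= dd by exact: normr_ge0.
have eE : E ^+ 2 = e ^+ 2 by rewrite real_normK ?num_real.
have dE : De ^+ 2 = dd ^+ 2 by rewrite real_normK ?num_real.
have dE4 : De ^+ 4 = dd ^+ 4 by rewrite (exprM _ 2 2) dE -exprM.
rewrite eE in b1 *; rewrite dE dE4.
have J1 : J ^+ 2 = J by rewrite /J; case: (_ != _); rewrite ?expr1n ?expr0n.
have k20 : 0 < k ^+ 2 by rewrite exprn_gt0.
have k30 : 0 < k ^+ 3 by rewrite exprn_gt0.
pose u := (k ^+ 2)^-1 * e ^+ 2; pose v := (k ^+ 3)^-1 * dd ^+ 4.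
have uE : e ^+ 2 = k ^+ 2 * u by rewrite /u mulrA divff ?mul1r// gt_eqF.
have vE : dd ^+ 4 = k ^+ 3 * v by rewrite /v mulrA divff ?mul1r// gt_eqF.
have u0 : 0 <= u by apply: mulr_ge0; [rewrite invr_ge0 ltW|exact: sqr_ge0].
have v0 : 0 <= v by apply: mulr_ge0; [rewrite invr_ge0 ltW|exact: exprn_ge0].
have k21 : k ^+ 2 <= 1 by rewrite expr2 mulr_ile1// ltW.
have k2k : k ^+ 2 <= k by rewrite expr2 ler_piMl// ltW.
have c1 : e ^+ 2 <= u by rewrite uE ler_piMl.
have c2 : 2 * (dd * e) <= k ^+ 2 * dd ^+ 2 + u.
  suff : 0 <= (k * dd - e / k) ^+ 2.
    rewrite sqrrB exprMn expr_div_n -[e ^+ 2 / _]mulrC -/u.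
    rewrite (_ : k * dd * (e / k) = dd * e); first by lra.
    by field; rewrite gt_eqF.
  exact: sqr_ge0.
have c3 : 2 * (J * e) <= k ^+ 2 * J + u.
  suff : 0 <= (k * J - e / k) ^+ 2.
    rewrite sqrrB exprMn J1 expr_div_n -[e ^+ 2 / _]mulrC -/u.
    rewrite (_ : k * J * (e / k) = J * e); first by lra.
    by field; rewrite gt_eqF.
  exact: sqr_ge0.
have c5 : 2 * dd ^+ 3 <= k ^+ 2 * dd ^+ 2 + v.
  suff : 0 <= (k * dd - dd ^+ 2 / k) ^+ 2.
    rewrite sqrrB exprMn expr_div_n -exprM.
    rewrite (_ : k * dd * (dd ^+ 2 / k) = dd ^+ 3); last by field; rewrite gt_eqF.
    have : dd ^+ 4 / k ^+ 2 <= v.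
      rewrite /v mulrC ler_wpM2r ?exprn_ge0// lef_pV2 ?posrE//.
      by rewrite exprS ler_piMl// ltW.
    by move: (dd ^+ _ / _) => q /=; lra.
  exact: sqr_ge0.
(* If dd <= k the left-hand side is at most k J; otherwise dd^4/k^3 >= dd. *)
have c4 : J * dd <= k * J + v.
  have [dk|kd] := leP dd k.
    apply: (@le_trans _ _ (k * J)); last by rewrite lerDl.
    by rewrite mulrC ler_wpM2r.
  apply: (@le_trans _ _ dd).
    by rewrite ler_piMl// /J; case: (_ != _).
  apply: (@le_trans _ _ v); last by rewrite lerDr mulr_ge0// ltW.
  rewrite -(ler_pM2l k30) -vE [dd ^+ 4]exprSr ler_wpM2r//.
  by rewrite lerXn2r ?nnegrE// ltW.
apply: le_trans (ler_normD _ _) _; apply: lerD b6.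
apply: (@le_trans _ _ (`|a1| + `|a2| + `|a3| + `|a4| + `|a5|)).
  do 4 (apply: le_trans (ler_normD _ _) _; rewrite lerD2r).
  exact: lexx.
rewrite -/u -/v -/J.
apply: (@le_trans _ _ (K * (e ^+ 2 + dd * e + 2 * (J * e) + 2 * (J * dd) + dd ^+ 3))).
  by lra.
rewrite [leRHS](_ : _ = K * (4 * (u + k ^+ 2 * dd ^+ 2 + v + k * J))); last by ring.
rewrite ler_wpM2l//.
have kJ : k ^+ 2 * J <= k * J by rewrite ler_wpM2r.
have kJ0 : 0 <= k * J by rewrite mulr_ge0// ltW.
have kd0 : 0 <= k ^+ 2 * dd ^+ 2 by apply: mulr_ge0; exact: sqr_ge0.
lra.
Qed.

Lemma chain_measurable (g : 'I_2 -> R) t : 0 <= t ->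
  measurable_fun [set: T] (fun w => g (eps t w)).
Proof.
by move=> t0; apply: (@FF_measurable_fun t); apply: FF_adapted_chain; rewrite t0 lexx.
Qed.

(** * One step of the expansion in expectation *)

Section TestFunction.
Variables (K : R) (phi phi1 phi2 : R -> 'I_2 -> R).
Hypothesis smooth : smooth_test K phi phi1 phi2.

Lemma test_const_ge0 : 0 <= K.
Proof.
by have [_ /(_ ord0 0)[+ _ _] _ _ _] := smooth; apply: le_trans.
Qed.

Lemma test_adapted t : 0 <= t ->
  measurable_wrt (FF t) (fun w => phi (X t w) (eps t w)).
Proof.
move=> t0; have [hm _ _ _ _] := smooth.
apply: FF_adapted_regime; rewrite ?t0 ?lexx//; last exact: X_adapted.
by move=> i; have [] := hm i.
Qed.

Lemma test_growth y i : `|phi y i| <= (\sum_j `|phi 0 j|) + K * `|y|.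
Proof.
have [_ _ _ hT _] := smooth.
have [_] := hT i 0 y; rewrite add0r => h.
have : `|phi 0 i| <= \sum_j `|phi 0 j| by rewrite (bigD1 i)//= lerDl sumr_ge0.
have := ler_normD (phi y i - phi 0 i) (phi 0 i); rewrite subrK; lra.
Qed.

Lemma test_integrable t : 0 <= t -> L1 (fun w => phi (X t w) (eps t w)).
Proof.
move=> t0; apply: (integrable_rv_le (g := fun w => (\sum_j `|phi 0 j|) + K * `|X t w|)).
- exact: (FF_measurable_fun (test_adapted t0)).
- by move=> w; exact: test_growth.
- apply: integrable_rvD.
    by apply: (@integrable_rv_bounded _ _ _ _ _ `|\sum_j `|phi 0 j| |).
  apply/integrable_rvZ/integrable_rv_norm/square_integrable_integrable.
  exact: X_square_integrable.
Qed.

Lemma gen_test_adapted t : 0 <= t ->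
  measurable_wrt (FF t) (fun w => gen_test phi phi2 (X t w) (eps t w)).
Proof.
move=> t0; have [hm _ _ _ _] := smooth.
apply: FF_adapted_regime; rewrite ?t0 ?lexx//; last exact: X_adapted.
move=> i; have [h0 _ h2] := hm i; have [h0' _ _] := hm (rev_ord i).
apply: measurable_funD; apply: measurable_funM => //; exact: measurable_funB.
Qed.

Lemma gen_test_bounded : exists M, forall y i, `|gen_test phi phi2 y i| <= M.
Proof.
have [_ hb _ _ _] := smooth; have K0 := test_const_ge0.
exists ((sigma ord0 ^+ 2 + sigma ord_max ^+ 2) * K + total_rate lambda * K) => y i.
have [_ b2 b3] := hb i y.
apply: le_trans (ler_normD _ _) _.
rewrite (normrM (sigma i ^+ 2 / 2)) (normrM (lambda i)); apply: lerD.
  apply: ler_pM => //.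
  rewrite ger0_norm; last by apply: divr_ge0 => //; exact: sqr_ge0.
  have := sigma_sqr_le i; have := sqr_ge0 (sigma i); lra.
by apply: ler_pM => //; rewrite ger0_norm ?rate_le// ltW.
Qed.

Lemma gen_test_integrable t : 0 <= t ->
  L1 (fun w => gen_test phi phi2 (X t w) (eps t w)).
Proof.
move=> t0; have [M hM] := gen_test_bounded.
apply: (@integrable_rv_bounded _ _ _ _ _ M) => //.
exact: (FF_measurable_fun (gen_test_adapted t0)).
Qed.

(** The first-order terms of [one_step_pointwise] have zero mean. With h = k^4, the mean of (D -
    De)^2 is of order h^2, of De^2 of order h, of De^4 of order h^2, and a regime change has
    probability of order h; with the weights k^-2, k^2, k^-3 and k every remainder is O(k^5), that
    is o(h). *)
Lemma one_step s k A : 0 <= s -> 0 < k <= 1 -> FF s A ->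
  `|Ex (fun w => \1_A w * (phi (X (s + k ^+ 4) w) (eps (s + k ^+ 4) w) -
     phi (X s w) (eps s w) - k ^+ 4 * gen_test phi phi2 (X s w) (eps s w)))|
  <= one_step_const K * k ^+ 5 * fine (P A).
Proof.
move=> s0 k01 FA; have [k0 k1] := andP k01; have K0 := test_const_ge0.
have [hm hb _ _ _] := smooth.
have mA := filtration_measurable FA.
set h := k ^+ 4; set t := s + h.
have h0 : 0 < h by rewrite exprn_gt0.
have tsE : t - s = h by rewrite /t addrAC subrr add0r.
have st : 0 <= s < t by rewrite s0 ltrDl.
have st2 : 0 <= s <= t by rewrite s0 lerDl ltW.
have t0 : 0 <= t by rewrite addr_ge0// ltW.
have ss : 0 <= s <= s by rewrite s0 lexx.
have L0 := total_rate_gt0 lambda_gt0.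
set s2 := sigma ord0 ^+ 2 + sigma ord_max ^+ 2.
have s20 : 0 <= s2 by rewrite addr_ge0 ?sqr_ge0.
pose V1 w := phi1 (X s w) (eps s w).
pose V2 w := phi2 (X s w) (eps s w) / 2 * sigma (eps s w) ^+ 2.
pose V3 i w := phi (X s w) (rev_ord i) - phi (X s w) i.
pose D w := X t w - X s w.
pose Dw w := W t w - W s w.
pose De w := sigma (eps s w) * Dw w.
pose Y3 i w : R := (eps s w == i)%:R * ((eps t w == rev_ord i)%:R - jump_prob lambda i h).
have aV1 : measurable_wrt (FF s) V1.
  apply: FF_adapted_regime => //; last exact: X_adapted.
  by move=> i; have [] := hm i.
have aV2 : measurable_wrt (FF s) V2.
  apply: (FF_adapted_regime (g := fun y i => phi2 y i / 2 * sigma i ^+ 2)) => //; last exact: X_adapted.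
  move=> i; have [_ _ h2] := hm i.
  by apply: measurable_funM => //; exact: measurable_funM.
have aV3 i : measurable_wrt (FF s) (V3 i).
  have [hm0 _ _] := hm i; have [hm1 _ _] := hm (rev_ord i).
  by apply: FF_adaptedB; [exact: (FF_adapted_comp hm1 (X_adapted s0))|exact: (FF_adapted_comp hm0 (X_adapted s0))].
have bV1 w : `|V1 w| <= K by have [] := hb (eps s w) (X s w).
have bV2 w : `|V2 w| <= K * s2.
  have [_ b2 _] := hb (eps s w) (X s w).
  rewrite /V2 normrM; apply: ler_pM => //.
    rewrite normrM (ger0_norm (x := 2^-1)) ?invr_ge0//; lra.
  by rewrite ger0_norm ?sqr_ge0//; exact: sigma_sqr_le.
have bV3 i w : `|V3 i w| <= K by have [] := hb i (X s w).
have D2 : L2 D by apply: square_integrableB; exact: X_square_integrable.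
have [Dw2 Dww2] := DW_square_integrable st2.
have mv : measurable_fun [set: T] (fun w => sigma (eps s w)) by exact: chain_measurable.
have bv w : `|sigma (eps s w)| <= 1 + s2.
  have := sigma_sqr_le (eps s w); rewrite -/s2 -(real_normK (num_real (sigma _))).
  move: `|_| (normr_ge0 (sigma (eps s w))) => a a0 h2; nra.
have De2 : L2 De by exact: (square_integrableM_bounded mv bv).
have mDw : measurable_fun [set: T] Dw by case: Dw2.
have E2 : L2 (fun w => D w - De w) by exact: square_integrableB.
have Dw4 : L1 (fun w => Dw w ^+ 4).
  have [_ h4] := Dww2; rewrite (_ : (fun w => _) = fun w => ((W t w - W s w) ^+ 2) ^+ 2)//.
  by apply/funext => w; rewrite -exprM.
have De4 : L1 (fun w => De w ^+ 4).
  under [X in L1 X]eq_fun do rewrite exprMn.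
  apply: (integrable_rvM_bounded (M := (1 + s2) ^+ 4)) => //; first exact: measurable_funX.
  by move=> w; rewrite normrX lerXn2r// nnegrE addr_ge0.
have mJ (i : 'I_2) r : 0 <= r -> measurable_fun [set: T] (fun w => (eps r w == i)%:R : R).
  by move=> r0; exact: measurable_regime_indic.
have bb (b : bool) : `|b%:R : R| <= 1 by case: b; rewrite ?normr1 ?normr0.
have Y31 i : L1 (Y3 i).
  apply: (integrable_rvM_bounded (M := 1)) => //; first exact: mJ.
  apply: integrable_rvB; first by apply: (@integrable_rv_bounded _ _ _ _ _ 1) => //; exact: mJ.
  by apply: (@integrable_rv_bounded _ _ _ _ _ `|jump_prob lambda i h|).
have J1 : L1 (fun w => (eps t w != eps s w)%:R).
  under [X in L1 X]eq_fun do rewrite regime_change.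
  apply: integrable_rv_sum => i; apply: (integrable_rvM_bounded (M := 1)) => //; first exact: mJ.
  by apply: (@integrable_rv_bounded _ _ _ _ _ 1) => //; exact: mJ.
(* Each of [Z1], [Z2], [Z3] is an adapted factor times a variable of zero conditional mean: the
   increment of X, the compensated square of that of W, and the compensated jump. *)
pose Z1 w := (\1_A w * V1 w) * D w.
pose Z2 w := (\1_A w * V2 w) * (Dw w ^+ 2 - h).
pose Z3 i w := (\1_A w * V3 i w) * Y3 i w.
have Z11 : L1 Z1.
  under [X in L1 X]eq_fun do rewrite -mulrA.
  apply: integrable_rv_indicM => //.
  apply: (integrable_rvM_bounded (M := K)) => //; first exact: (FF_measurable_fun aV1).
  exact: square_integrable_integrable.
have Dh1 : L1 (fun w => Dw w ^+ 2 - h).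
  apply: integrable_rvB; first exact: square_integrable_integrable.
  by apply: (@integrable_rv_bounded _ _ _ _ _ `|h|).
have Z21 : L1 Z2.
  under [X in L1 X]eq_fun do rewrite -mulrA.
  apply: integrable_rv_indicM => //.
  by apply: (integrable_rvM_bounded (M := K * s2)) => //; exact: (FF_measurable_fun aV2).
have Z31 i : L1 (Z3 i).
  under [X in L1 X]eq_fun do rewrite -mulrA.
  apply: integrable_rv_indicM => //.
  by apply: (integrable_rvM_bounded (M := K)) => //; exact: (FF_measurable_fun (aV3 i)).
have aA := FF_adapted_indic FA.
have EZ1 : Ex Z1 = 0.
  apply: (@FF_mean_zero s) => //; first exact: square_integrable_integrable.
    by move=> B FB; exact: X_mean.
  exact: FF_adaptedM.
have EZ2 : Ex Z2 = 0.
  apply: (@FF_mean_zero s) => //; last exact: FF_adaptedM.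
  by move=> B FB; have [_ h2 _] := DW_moments st2 FB; rewrite -tsE.
have EZ3 i : Ex (Z3 i) = 0.
  apply: (FF_mean_zero (Y31 i) _ (FF_adaptedM aA (aV3 i)) (Z31 i)) => B FB.
  by have := chain_jump i st2 FB; rewrite tsE.
pose Sum w := Z1 w + Z2 w + \sum_i Z3 i w.
have Z31s : L1 (fun w => \sum_i Z3 i w) by exact: (@integrable_rv_sum _ _ _ P _ _ Z3 Z31).
have Sum1 : L1 Sum by apply: integrable_rvD => //; exact: integrable_rvD.
have ESum : Ex Sum = 0.
  rewrite ExD//; last exact: integrable_rvD.
  by rewrite ExD// EZ1 EZ2 (@Ex_sum _ _ _ P _ _ Z3 Z31) !add0r big1.
pose F w := \1_A w * (phi (X t w) (eps t w) - phi (X s w) (eps s w) -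
  h * gen_test phi phi2 (X s w) (eps s w)).
have F1 : L1 F.
  apply: integrable_rv_indicM => //; apply: integrable_rvB.
    by apply: integrable_rvB; exact: test_integrable.
  by apply: integrable_rvZ; exact: gen_test_integrable.
have -> : Ex F = Ex (fun w => F w - Sum w) by rewrite ExB// ESum subr0.
apply: le_trans (Ex_norm (integrable_rvB F1 Sum1)) _.
pose B1 w := \1_A w * (D w - De w) ^+ 2.
pose B2 w := \1_A w * De w ^+ 2.
pose B3 w := \1_A w * De w ^+ 4.
pose B4 w : R := \1_A w * (eps t w != eps s w)%:R.
have B11 : L1 B1 by apply: integrable_rv_indicM => //; case: E2.
have B21 : L1 B2 by apply: integrable_rv_indicM => //; case: De2.
have B31 : L1 B3 by exact: integrable_rv_indicM.
have B41 : L1 B4 by exact: integrable_rv_indicM.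
have A1 : L1 (\1_A) by exact: indic_integrable.
pose Bd w := 4 * K * ((k ^+ 2)^-1 * B1 w + k ^+ 2 * B2 w + (k ^+ 3)^-1 * B3 w + k * B4 w) +
  K * total_rate lambda ^+ 2 * k ^+ 8 * \1_A w.
have Bd1a : L1 (fun w => (k ^+ 2)^-1 * B1 w + k ^+ 2 * B2 w).
  by apply: integrable_rvD; exact: integrable_rvZ.
have Bd1b : L1 (fun w => (k ^+ 2)^-1 * B1 w + k ^+ 2 * B2 w + (k ^+ 3)^-1 * B3 w).
  by apply: integrable_rvD => //; exact: integrable_rvZ.
have Bd1c : L1 (fun w => (k ^+ 2)^-1 * B1 w + k ^+ 2 * B2 w + (k ^+ 3)^-1 * B3 w + k * B4 w).
  by apply: integrable_rvD => //; exact: integrable_rvZ.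
apply: (@le_trans _ _ (Ex Bd)).
  apply: Ex_le.
  - by apply: integrable_rv_norm; exact: integrable_rvB.
  - by apply: integrable_rvD; exact: integrable_rvZ.
  move=> w; have := @one_step_pointwise K phi phi1 phi2 k (X s w) (D w) (De w)
    (eps s w) (eps t w) smooth k01.
  rewrite -/h.
  have -> : X s w + D w = X t w by rewrite /D addrC subrK.
  move=> H.
  have -> : F w - Sum w = \1_A w * (phi (X t w) (eps t w) - phi (X s w) (eps s w) -
     h * gen_test phi phi2 (X s w) (eps s w) - phi1 (X s w) (eps s w) * D w -
     phi2 (X s w) (eps s w) / 2 * (De w ^+ 2 - sigma (eps s w) ^+ 2 * h) -
     ((eps t w == rev_ord (eps s w))%:R - jump_prob lambda (eps s w) h) *
     (phi (X s w) (rev_ord (eps s w)) - phi (X s w) (eps s w))).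
    rewrite /F /Sum (bigD1 (eps s w))//= big1 ?addr0; last first.
      by move=> j /negbTE jn; rewrite /Z3 /Y3 eq_sym jn mul0r mulr0.
    by rewrite /Z1 /Z2 /Z3 /Y3 eqxx mul1r /V1 /V2 /V3 /De; ring.
  rewrite normrM.
  have -> : Bd w = \1_A w * (4 * K * ((k ^+ 2)^-1 * (D w - De w) ^+ 2 + k ^+ 2 * De w ^+ 2 +
      (k ^+ 3)^-1 * De w ^+ 4 + k * (eps t w != eps s w)%:R) + K * total_rate lambda ^+ 2 * k ^+ 8).
    rewrite /Bd /B1 /B2 /B3 /B4; move: (k ^- 2) (k ^- 3) => q2 q3; ring.
  have iA0 : 0 <= \1_A w :> R by rewrite indicE.
  by rewrite ger0_norm// ler_wpM2l.
rewrite /Bd ExD; [|exact: integrable_rvZ|exact: integrable_rvZ].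
rewrite !ExZ// Ex_indic//.
rewrite ExD//; last exact: integrable_rvZ.
rewrite ExD//; last exact: integrable_rvZ.
rewrite ExD; [|exact: integrable_rvZ|exact: integrable_rvZ].
rewrite !ExZ//.
set p := fine (P A).
have p0 : 0 <= p by rewrite fine_ge0.
have e1 : Ex B1 <= 4 * gap_const sigma * h ^+ 2 * p by have := X_error st FA; rewrite tsE.
have e4 : Ex B4 <= total_rate lambda * h * p by have := chain_change st2 FA; rewrite tsE.
have sw n w : De w ^+ (2 * n) <= s2 ^+ n * Dw w ^+ (2 * n).
  rewrite /De exprMn ler_wpM2r ?exprn_even_ge0// ?oddM//.
  by rewrite exprM lerXn2r ?nnegrE ?sqr_ge0//; exact: sigma_sqr_le.
have e2 : Ex B2 <= s2 * h * p.
  apply: (@le_trans _ _ (Ex (fun w => s2 * (\1_A w * Dw w ^+ 2)))).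
    apply: Ex_le => //.
      by apply: integrable_rvZ; apply: integrable_rv_indicM => //; exact: square_integrable_integrable.
    by move=> w; rewrite mulrCA ler_wpM2l ?indicE//; exact: (sw 1%N).
  rewrite ExZ; last by apply: integrable_rv_indicM => //; exact: square_integrable_integrable.
  rewrite -mulrA ler_wpM2l//.
  have [_ + _] := DW_moments st2 FA; rewrite tsE.
  rewrite (_ : (fun w => _) = (fun w => \1_A w * Dw w ^+ 2 - h * \1_A w)); last first.
    by apply/funext => w; rewrite /Dw; ring.
  rewrite ExB; [|by apply: integrable_rv_indicM => //; exact: square_integrable_integrable|exact: integrable_rvZ].
  by rewrite ExZ// Ex_indic// -/p; lra.
have e3 : Ex B3 <= 64 * s2 ^+ 2 * h ^+ 2 * p.
  apply: (@le_trans _ _ (Ex (fun w => s2 ^+ 2 * (\1_A w * Dw w ^+ 4)))).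
    apply: Ex_le => //.
      by apply: integrable_rvZ; exact: integrable_rv_indicM.
    by move=> w; rewrite mulrCA ler_wpM2l ?indicE//; exact: (sw 2%N).
  rewrite ExZ; last exact: integrable_rv_indicM.
  have [_ _] := DW_moments st2 FA; rewrite tsE -/p => h4.
  rewrite (_ : 64 * s2 ^+ 2 * h ^+ 2 * p = s2 ^+ 2 * (64 * h ^+ 2 * p)); last by ring.
  by rewrite ler_wpM2l ?sqr_ge0.
have g0 := gap_const_ge0 sigma.
have k00 : 0 <= k by exact: ltW.
have k5 : 0 < k ^+ 5 by rewrite exprn_gt0.
have k65 : k ^+ 6 <= k ^+ 5 by rewrite exprS ler_piMl// ltW.
have k85 : k ^+ 8 <= k ^+ 5.
  rewrite (exprD k 3 5); apply: ler_piMl; first exact: ltW.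
  by apply: exprn_ile1.
have f1 : (k ^+ 2)^-1 * Ex B1 <= 4 * gap_const sigma * k ^+ 5 * p.
  rewrite mulrC ler_pdivrMr ?exprn_gt0//; apply: le_trans e1 _.
  rewrite [leLHS](_ : _ = (4 * gap_const sigma * p) * k ^+ 2 * k ^+ 6); last by rewrite /h; ring.
  rewrite [leRHS](_ : _ = (4 * gap_const sigma * p) * k ^+ 2 * k ^+ 5); last by ring.
  apply: ler_wpM2l => //; apply: mulr_ge0; last exact: sqr_ge0.
  by apply: mulr_ge0 => //; exact: mulr_ge0.
have f2 : k ^+ 2 * Ex B2 <= s2 * k ^+ 5 * p.
  apply: (@le_trans _ _ (k ^+ 2 * (s2 * h * p))); first by rewrite ler_wpM2l ?sqr_ge0.
  rewrite [leLHS](_ : _ = (s2 * p) * k ^+ 6); last by rewrite /h; ring.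
  rewrite [leRHS](_ : _ = (s2 * p) * k ^+ 5); last by ring.
  by apply: ler_wpM2l => //; exact: mulr_ge0.
have f3 : (k ^+ 3)^-1 * Ex B3 <= 64 * s2 ^+ 2 * k ^+ 5 * p.
  rewrite mulrC ler_pdivrMr ?exprn_gt0//; apply: le_trans e3 _.
  by rewrite le_eqVlt; apply/orP; left; apply/eqP; rewrite /h; ring.
have f4 : k * Ex B4 <= total_rate lambda * k ^+ 5 * p.
  apply: (@le_trans _ _ (k * (total_rate lambda * h * p))); first by rewrite ler_wpM2l.
  by rewrite le_eqVlt; apply/orP; left; apply/eqP; rewrite /h; ring.
rewrite /one_step_const -/s2.
rewrite [leRHS](_ : _ = 4 * K * (4 * gap_const sigma * k ^+ 5 * p + s2 * k ^+ 5 * p +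
  64 * s2 ^+ 2 * k ^+ 5 * p + total_rate lambda * k ^+ 5 * p) +
  K * total_rate lambda ^+ 2 * k ^+ 5 * p); last by ring.
apply: lerD.
  apply: ler_wpM2l; first exact: mulr_ge0.
  by lra.
apply: ler_wpM2r => //; apply: ler_wpM2l => //.
by apply: mulr_ge0 => //; exact: sqr_ge0.
Qed.

(** * Discounted sums on the grid *)

Section Discounted.
Variables (rho : R).
Hypothesis rho_gt0 : 0 < rho.
Variable k : R.
Hypothesis k01 : 0 < k <= 1.
Local Notation h := (k ^+ 4).

Let k0 : 0 < k. Proof. by case/andP: k01. Qed.
Let h0 : 0 < h. Proof. by rewrite exprn_gt0. Qed.
Let jh0 j : 0 <= j%:R * h. Proof. by rewrite mulr_ge0// ltW. Qed.

Definition discounted (j : nat) (w : T) : R :=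
  expR (- (rho * (j%:R * h))) * phi (X (j%:R * h) w) (eps (j%:R * h) w).

Let rest j w := phi (X (j.+1%:R * h) w) (eps (j.+1%:R * h) w) -
   phi (X (j%:R * h) w) (eps (j%:R * h) w) -
   h * gen_test phi phi2 (X (j%:R * h) w) (eps (j%:R * h) w).

Let dj j : R := expR (- (rho * (j%:R * h))).

Lemma discounted_integrable j : L1 (discounted j).
Proof. by apply: integrable_rvZ; exact: test_integrable. Qed.

Lemma discounted_increment_integrable j A : FF (j%:R * h) A ->
  L1 (fun w => \1_A w * (discounted j.+1 w - discounted j w)).
Proof.
move=> FA; apply: integrable_rv_indicM; first exact: filtration_measurable FA.
by apply: integrable_rvB; exact: discounted_integrable.
Qed.

Let rest_integrable j A : FF (j%:R * h) A ->
  L1 (fun w => \1_A w * rest j w).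
Proof.
move=> FA; apply: integrable_rv_indicM; first exact: filtration_measurable FA.
apply: integrable_rvB; first by apply: integrable_rvB; exact: test_integrable.
by apply: integrable_rvZ; exact: gen_test_integrable.
Qed.

Let C0 : 0 <= one_step_const K * k ^+ 5.
Proof.
have := one_step (lexx 0) k01 (@FF_setT 0); apply: contraTT; rewrite -!ltNge => c0.
by apply: lt_le_trans (normr_ge0 _); rewrite probability_setT mulr1.
Qed.

Let rest_le j A : FF (j%:R * h) A ->
  `|Ex (fun w => \1_A w * rest j w)| <= one_step_const K * k ^+ 5.
Proof.
move=> FA; have := one_step (jh0 j) k01 FA.
rewrite (_ : j%:R * h + h = j.+1%:R * h); last by rewrite -natr1; ring.
move=> /le_trans; apply; rewrite ler_piMr//.
have mA := filtration_measurable FA.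
by rewrite -lee_fin -(probability_EFin P mA) probability_le1.
Qed.

Let djS j : dj j = expR (rho * h) * dj j.+1.
Proof. by rewrite /dj -expRD -natr1; congr expR; ring. Qed.

Let incrementE j w : discounted j.+1 w - discounted j w =
  dj j.+1 * (rest j w + (h * gen_test phi phi2 (X (j%:R * h) w) (eps (j%:R * h) w) -
  (expR (rho * h) - 1) * phi (X (j%:R * h) w) (eps (j%:R * h) w))).
Proof. by rewrite /discounted -/(dj j) -/(dj j.+1) (djS j) /rest; ring. Qed.

(** For a nonnegative supersolution h G phi <= rho h phi <= (e^(rho h) - 1) phi, so that in
    [incrementE] only the one-step error remains. *)
Lemma discounted_increment_le j A : (forall y i, 0 <= phi y i) ->
  (forall y i, gen_test phi phi2 y i <= rho * phi y i) -> FF (j%:R * h) A ->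
  Ex (fun w => \1_A w * (discounted j.+1 w - discounted j w)) <=
  dj j.+1 * (one_step_const K * k ^+ 5).
Proof.
move=> phi0 sup FA.
apply: (@le_trans _ _ (Ex (fun w => dj j.+1 * (\1_A w * rest j w)))).
  apply: Ex_le.
  - exact: discounted_increment_integrable.
  - by apply: integrable_rvZ; exact: rest_integrable.
  move=> w; rewrite incrementE mulrCA ler_pM2l ?expR_gt0// ler_wpM2l ?indicE//.
  rewrite gerDl subr_le0.
  have := expR_ge1Dx (rho * h); have := phi0 (X (j%:R * h) w) (eps (j%:R * h) w).
  have := sup (X (j%:R * h) w) (eps (j%:R * h) w).
  move: (phi _ _) (gen_test phi phi2 _ _) => p g gp p0 e1.
  by have := h0; nra.
rewrite ExZ; last exact: rest_integrable.
by rewrite ler_pM2l ?expR_gt0//; apply: le_trans (ler_norm _) _; exact: rest_le.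
Qed.

(** Where G phi = rho phi, the drift in [incrementE] is -(e^(rho h) - 1 - rho h) phi, which is of
    order h^2 because phi is bounded by [B] on the event. *)
Lemma discounted_increment_ge j A B : FF (j%:R * h) A ->
  (forall w, A w -> gen_test phi phi2 (X (j%:R * h) w) (eps (j%:R * h) w) =
     rho * phi (X (j%:R * h) w) (eps (j%:R * h) w) /\
     `|phi (X (j%:R * h) w) (eps (j%:R * h) w)| <= B) -> 0 <= B ->
  - (dj j.+1 * (one_step_const K * k ^+ 5 + expR rho * (rho * h) ^+ 2 * B)) <=
  Ex (fun w => \1_A w * (discounted j.+1 w - discounted j w)).
Proof.
move=> FA eqA B0; set D := expR rho * (rho * h) ^+ 2 * B.
have D0 : 0 <= D by rewrite !mulr_ge0 ?expR_ge0 ?sqr_ge0// ltW.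
apply: (@le_trans _ _ (Ex (fun w => dj j.+1 * (\1_A w * rest j w - D)))).
  rewrite ExZ; last first.
    by apply: integrable_rvB; [exact: rest_integrable|exact: (@integrable_rv_bounded _ _ _ _ _ `|D|)].
  rewrite ExB ?Ex_cst; [|exact: rest_integrable|exact: (@integrable_rv_bounded _ _ _ _ _ `|D|)].
  have := rest_le FA; rewrite ler_norml => /andP[+ _].
  have : 0 < dj j.+1 by exact: expR_gt0.
  by move: (Ex _) => e; nra.
apply: Ex_le.
- apply: integrable_rvZ; apply: integrable_rvB; first exact: rest_integrable.
  exact: (@integrable_rv_bounded _ _ _ _ _ `|D|).
- exact: discounted_increment_integrable.
move=> w; rewrite incrementE mulrCA ler_pM2l ?expR_gt0//.
have [Aw|nAw] := boolP (w \in A); rewrite indicE ?Aw ?(negbTE nAw) ?mul0r ?mul1r ?sub0r ?oppr_le0//.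
have [-> pB] := eqA w (set_mem Aw).
rewrite lerD2l; move: (phi _ _) pB => p pB.
have r1 : 1 + rho * h <= expR (rho * h) by exact: expR_ge1Dx.
(* From e^z (1 - z) <= 1 with z = rho h, and z <= rho because h <= 1. *)
have r2 : expR (rho * h) - 1 - rho * h <= expR rho * (rho * h) ^+ 2.
  have q := expR_ge1Dx (- (rho * h)); rewrite expRN in q.
  have e0 := expR_gt0 (rho * h).
  have : expR (rho * h) * (1 + - (rho * h)) <= 1.
    by rewrite -(ler_pM2l e0) mulfV ?gt_eqF// in q.
  have : expR (rho * h) <= expR rho.
    rewrite ler_expR ler_piMr//; first exact: ltW.
    by case/andP: k01 => _ k1; rewrite exprn_ile1// ltW.
  have := mulr_gt0 rho_gt0 h0; move: (expR (rho * h)) e0 r1 (expR rho) (rho * h) => e e0 r1 E a a0.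
  nra.
rewrite (_ : h * (rho * p) - _ = - ((expR (rho * h) - 1 - rho * h) * p)); last by ring.
rewrite lerN2 /D; apply: (le_trans (ler_norm _)); rewrite normrM.
have e0 : 0 <= expR (rho * h) - 1 - rho * h by rewrite subr_ge0 lerBrDl.
by rewrite (ger0_norm e0) ler_pM.
Qed.

Variable i : 'I_2.
Local Notation E := [set w | eps 0 w = i].

(** The discounted process stopped at the first index j < N outside [A j], when [A] is a decreasing
    sequence of events of still running ([stopped_sumE]). As a sum of increments it has an
    expectation computable term by term. *)
Definition stopped_sum (A : nat -> set T) N (w : T) : R :=
  \1_E w * discounted 0 w +
  \sum_(j < N) \1_(A j) w * (discounted j.+1 w - discounted j w).

Let FE : FF 0 E.
Proof. by apply: (@FF_eps _ _ _ P W eps 0 0 [set i]); rewrite lexx. Qed.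

Let start_integrable : L1 (fun w => \1_E w * discounted 0 w).
Proof.
apply: integrable_rv_indicM; first exact: filtration_measurable FE.
exact: discounted_integrable.
Qed.

Let start_value : Ex (fun w => \1_E w * discounted 0 w) = phi x i * fine (P E).
Proof.
have mE := filtration_measurable FE.
rewrite -(Ex_indic P mE) -ExZ; last exact: indic_integrable.
apply: Ex_ae_eq.
- exact: (integrable_rv_measurable start_integrable).
- apply: (integrable_rv_measurable (P := P)); apply: integrable_rvZ.
  by apply: indic_integrable; exact: filtration_measurable FE.
apply: filterS X_start => w X0; rewrite /discounted !mul0r mulr0 oppr0 expR0 mul1r X0.
by rewrite indicE; have [/set_mem -> |] := boolP (w \in E); rewrite ?mulr1 ?mul1r ?mul0r ?mulr0.
Qed.

Section Stopped.
Variable A : nat -> set T.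
Hypothesis FA : forall j, FF (j%:R * h) (A j).

Lemma stopped_sum_integrable N : L1 (stopped_sum A N).
Proof.
apply: integrable_rvD => //.
apply: (@integrable_rv_sum _ _ _ P _ _ (fun (j : 'I_N) w => \1_(A j) w * (discounted j.+1 w - discounted j w))).
by move=> j; exact: discounted_increment_integrable.
Qed.

Let Ex_stopped_sum N : Ex (stopped_sum A N) = phi x i * fine (P E) +
  \sum_(j < N) Ex (fun w => \1_(A j) w * (discounted j.+1 w - discounted j w)).
Proof.
have hL1 (j : 'I_N) : L1 (fun w => \1_(A j) w * (discounted j.+1 w - discounted j w)).
  exact: discounted_increment_integrable.
rewrite /stopped_sum ExD ?start_value ?(@Ex_sum _ _ _ P _ _ _ hL1)//.
exact: (@integrable_rv_sum _ _ _ P _ _ _ hL1).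
Qed.

Let geometric N (c : R) : 0 <= c -> \sum_(j < N) dj j.+1 * c <= (rho * h)^-1 * c.
Proof.
move=> c0; rewrite -mulr_suml ler_wpM2r//.
have := @discount_sum R (rho * h) N (mulr_gt0 rho_gt0 h0); apply: le_trans.
by apply: ler_sum => j _; rewrite ler_expR lerN2 mulrA [X in X * _ <= _]mulrC mulrC mulrAC mulrA.
Qed.

(** The discount factors sum to at most 1/(rho h), which turns the error k^5 of one step into k/rho
    whatever the number of steps. *)
Lemma stopped_sum_le N : (forall y i, 0 <= phi y i) ->
  (forall y i, gen_test phi phi2 y i <= rho * phi y i) ->
  Ex (stopped_sum A N) <= phi x i * fine (P E) + one_step_const K / rho * k.
Proof.
move=> phi0 sup; rewrite Ex_stopped_sum lerD2l.
apply: (@le_trans _ _ (\sum_(j < N) dj j.+1 * (one_step_const K * k ^+ 5))).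
  by apply: ler_sum => j _; exact: discounted_increment_le.
apply: le_trans (geometric _ C0) _; rewrite le_eqVlt; apply/orP; left; apply/eqP.
by field; rewrite !gt_eqF//.
Qed.

Lemma stopped_sum_ge N B :
  (forall j w, A j w -> gen_test phi phi2 (X (j%:R * h) w) (eps (j%:R * h) w) =
     rho * phi (X (j%:R * h) w) (eps (j%:R * h) w) /\
     `|phi (X (j%:R * h) w) (eps (j%:R * h) w)| <= B) -> 0 <= B ->
  phi x i * fine (P E) - (one_step_const K / rho * k + expR rho * rho * B * k ^+ 4) <=
  Ex (stopped_sum A N).
Proof.
move=> eqA B0; rewrite Ex_stopped_sum lerD2l.
set c := one_step_const K * k ^+ 5 + expR rho * (rho * h) ^+ 2 * B.
apply: (@le_trans _ _ (\sum_(j < N) - (dj j.+1 * c))); last first.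
  by apply: ler_sum => j _; apply: discounted_increment_ge => //; exact: eqA.
rewrite sumrN lerN2.
have c0 : 0 <= c.
  by rewrite addr_ge0 ?C0// !mulr_ge0 ?expR_ge0 ?sqr_ge0// ltW.
apply: le_trans (geometric _ c0) _; rewrite /c le_eqVlt; apply/orP; left; apply/eqP.
by field; rewrite !gt_eqF//.
Qed.

Lemma stopped_sumE N m w : (m <= N)%N -> eps 0 w = i ->
  (forall j, (j < m)%N -> A j w) -> (forall j, (m <= j < N)%N -> ~ A j w) ->
  stopped_sum A N w = discounted m w.
Proof.
move=> mN Ew At Af; rewrite /stopped_sum indicE mem_set// mul1r.
under eq_bigr do rewrite indicE.
rewrite (@stopped_telescope _ (discounted ^~ w) (fun j => w \in A j) m)//.
  by move=> j /At; rewrite inE.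
by move=> j /Af; rewrite notin_setE.
Qed.

End Stopped.
End Discounted.
End TestFunction.

(** * Growth and continuity of the diffusion *)

Definition moment_const : R :=
  `|x| + 2 + 4 * gap_const sigma + (sigma ord0 ^+ 2 + sigma ord_max ^+ 2).

(** Over [0, t] the increment of X is sigma(eps_0) times that of W plus an error bounded by
    [X_error], and |z| <= 1 + z^2. The rate t^2 is crude, but the discount absorbs any power. *)
Lemma X_norm_le t : 1 <= t -> Ex (fun w => `|X t w|) <= moment_const * t ^+ 2.
Proof.
move=> t1; have t0 : 0 < t by exact: lt_le_trans t1.
have t00 : 0 <= (0:R) < t by rewrite lexx t0.
have t01 : 0 <= (0:R) <= t by rewrite lexx ltW.
pose s2 := sigma ord0 ^+ 2 + sigma ord_max ^+ 2.
pose er w := X t w - X 0 w - sigma (eps 0 w) * (W t w - W 0 w).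
have s20 : 0 <= s2 by rewrite addr_ge0 ?sqr_ge0.
have g0 := gap_const_ge0 sigma.
have eL2 : L2 er.
  apply: square_integrableB.
    by apply: square_integrableB; apply: X_square_integrable => //; exact: ltW.
  apply: (@square_integrableM_bounded _ _ _ P (fun w => sigma (eps 0 w)) (fun w => W t w - W 0 w) (\sum_j `|sigma j|)).
  - by apply: (chain_measurable sigma).
  - by move=> w; rewrite (bigD1 (eps 0 w))//= lerDl sumr_ge0.
  - by have [] := DW_square_integrable t01.
have [dL2 _] := DW_square_integrable t01.
have eL1 : L1 (fun w => er w ^+ 2) by case: eL2.
have dL1 : L1 (fun w => (W t w - W 0 w) ^+ 2) by case: dL2.
have cL1 (c : R) : L1 (fun=> c) by apply: (@integrable_rv_bounded _ _ _ _ _ `|c|).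
have e2 : Ex (fun w => er w ^+ 2) <= 4 * gap_const sigma * t ^+ 2.
  have := X_error t00 (@FF_setT 0).
  have p1 : fine (P [set: T]) = 1 by rewrite probability_setT.
  rewrite subr0 p1 mulr1; apply: le_trans; rewrite le_eqVlt; apply/orP; left; apply/eqP.
  by apply: eq_Rintegral => w _; rewrite indicT mul1r.
have d2 : Ex (fun w => (W t w - W 0 w) ^+ 2) = t.
  have [_ + _] := DW_moments t01 (@FF_setT 0).
  under eq_Rintegral do rewrite indicT mul1r.
  by rewrite ExB// Ex_cst subr0 => /eqP; rewrite subr_eq0 => /eqP.
have xL1 : L1 (fun w => `|X t w|).
  by apply/integrable_rv_norm/square_integrable_integrable/X_square_integrable/ltW.
pose f w := `|x| + 2 + er w ^+ 2 + s2 * (W t w - W 0 w) ^+ 2.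
have fL1 : L1 f.
  apply: integrable_rvD; last exact: integrable_rvZ.
  by apply: integrable_rvD.
have fE : Ex f = `|x| + 2 + Ex (fun w => er w ^+ 2) + s2 * t.
  rewrite /f ExD; [|by apply: integrable_rvD|exact: integrable_rvZ].
  by rewrite ExD// ExZ// Ex_cst d2.
(* The bound by [f] holds only almost surely, where X_0 = x. The minimum satisfies it everywhere and
   has the same mean as |X_t|. *)
pose Z := fun w => Num.min `|X t w| (f w).
have ZE : Ex (fun w => `|X t w|) = Ex Z.
  apply: Ex_ae_eq.
  - exact: (integrable_rv_measurable xL1).
  - by apply: measurable_minr; [exact: (integrable_rv_measurable xL1)|exact: (integrable_rv_measurable fL1)].
  apply: filterS X_start => w X0; rewrite /Z min_l//.
  have -> : X t w = x + er w + sigma (eps 0 w) * (W t w - W 0 w) by rewrite /er X0; ring.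
  apply: le_trans (ler_normD _ _) _; apply: le_trans (lerD (ler_normD _ _) (lexx _)) _.
  have n1 (z : R) : `|z| <= 1 + z ^+ 2.
    by rewrite -[z ^+ 2]real_normK ?num_real//; have := sqr_ge0 (`|z| - 1); have := normr_ge0 z; nra.
  have q : (sigma (eps 0 w) * (W t w - W 0 w)) ^+ 2 <= s2 * (W t w - W 0 w) ^+ 2.
    by rewrite exprMn ler_wpM2r ?sqr_ge0//; exact: sigma_sqr_le.
  have := n1 (er w); have := n1 (sigma (eps 0 w) * (W t w - W 0 w)).
  by rewrite /f; move: q; move: (_ ^+ 2) `|_ * _| => ? ?; lra.
have : Ex Z <= Ex f.
  apply: Ex_le => //; last by move=> w; rewrite /Z ge_min lexx orbT.
  apply: (integrable_rv_le (g := fun w => `|X t w|)) => //.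
    by apply: measurable_minr; [exact: (integrable_rv_measurable xL1)|exact: (integrable_rv_measurable fL1)].
  have f0 w : 0 <= f w.
    rewrite /f; apply: addr_ge0; last by apply: mulr_ge0 => //; exact: sqr_ge0.
    by apply: addr_ge0; [exact: addr_ge0|exact: sqr_ge0].
  by move=> w; rewrite /Z ger0_norm ?ge_min ?lexx// le_min normr_ge0 f0.
rewrite -ZE fE => /le_trans; apply.
have tt : t <= t ^+ 2 by rewrite -[leLHS]mulr1 expr2 ler_pM2l.
have t21 : 1 <= t ^+ 2 by exact: le_trans tt.
have : `|x| + 2 <= (`|x| + 2) * t ^+ 2 by rewrite ler_peMr// addr_ge0.
have : s2 * t <= s2 * t ^+ 2 by rewrite ler_wpM2l.
by rewrite /moment_const -/s2; move: (Ex _) (t ^+ 2) e2 => ? ?; lra.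
Qed.

Lemma X_continuous : {ae P, forall w, continuous_at_nonneg (X ^~ w)}.
Proof.
have [_ + _] := XI; apply: filterS => w /continuous_nonnegP c r r0 e e0.
have [eta eta0 h] := c r r0 e e0; exists eta => // t t0 tr.
by have := h t t0 tr; rewrite (_ : X t w - x - (X r w - x) = X t w - X r w)//; ring.
Qed.

Variables (rho : R).
Hypothesis rho_gt0 : 0 < rho.
Variables (v : R -> 'I_2 -> R) (a : 'I_2 -> R) (B : R).
Hypothesis B_ge0 : 0 <= B.
Hypothesis v_ge0 : forall y i, 0 <= v y i.
Hypothesis v_ge : forall y i, y <= v y i.
Hypothesis v_stop : forall y i, a i <= y -> v y i = y.
Hypothesis v_le : forall y i, y < a i -> v y i <= B.

(** What a smooth substitute for [v] must keep: the supersolution inequality everywhere, equality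
    below the thresholds, and uniform closeness to [v]. *)
Definition near_solution (delta K : R) (phi phi1 phi2 : R -> 'I_2 -> R) :=
  [/\ smooth_test K phi phi1 phi2,
      forall y i, gen_test phi phi2 y i <= rho * phi y i,
      forall y i, y < a i -> gen_test phi phi2 y i = rho * phi y i &
      forall y i, `|phi y i - v y i| <= delta].

Variable i : 'I_2.
Local Notation E := [set w | eps 0 w = i].

Definition payoff (tau : T -> \bar R) (w : T) : R :=
  expR (- rho * fine (tau w)) * X (fine (tau w)) w.

Let FE : FF 0 E.
Proof. by apply: (@FF_eps _ _ _ P W eps 0 0 [set i]); rewrite lexx. Qed.

Lemma below_adapted t : 0 <= t -> FF t [set w | X t w < a (eps t w)].
Proof.
move=> t0.
have := FF_adaptedB (X_adapted t0) (FF_adapted_chain a (_ : 0 <= t <= t)).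
rewrite t0 lexx => /(_ isT _ (measurable_itv `]-oo, 0[)).
congr (FF t _); apply/seteqP; split => w /=; by rewrite in_itv/= subr_lt0.
Qed.

(** * A nearly optimal stopping time on the grid *)

Section Lower.
Variables (delta K : R) (phi phi1 phi2 : R -> 'I_2 -> R).
Hypothesis delta01 : 0 < delta <= 1.
Hypothesis near_sol : near_solution delta K phi phi1 phi2.
Variables (k : R) (N : nat).
Hypothesis k01 : 0 < k <= 1.
Local Notation h := (k ^+ 4).

Let h0 : 0 < h. Proof. by rewrite exprn_gt0//; case/andP: k01. Qed.
Let jh0 j : 0 <= j%:R * h. Proof. by rewrite mulr_ge0// ltW. Qed.

Let below j w := X (j%:R * h) w < a (eps (j%:R * h) w).
(** The first grid index in the stopping region, or [N] if there is none before [N]: [find] returns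
    the length of the list when nothing is found. *)
Let hit w := find (fun j => ~~ below j w) (iota 0 N).

Let hit_le w : (hit w <= N)%N.
Proof. by rewrite -[leqRHS](size_iota 0 N) find_size. Qed.

Let below_hit w j : (j < hit w)%N -> below j w.
Proof.
move=> jh; have := before_find 0%N jh; rewrite nth_iota ?add0n; last exact: leq_trans jh (hit_le w).
by move/negbT; rewrite negbK.
Qed.

Let hitP w : (hit w < N)%N -> a (eps ((hit w)%:R * h) w) <= X ((hit w)%:R * h) w.
Proof.
move=> hN; have := @nth_find _ 0%N (fun j => ~~ below j w) (iota 0 N).
rewrite has_find size_iota => /(_ hN); rewrite nth_iota// add0n.
by rewrite /below -leNgt.
Qed.

Let tau w : \bar R := ((hit w)%:R * h)%:E.

Let tau_stopping : stopping_time FF tau.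
Proof.
split=> [w|t t0]; first by rewrite lee_fin.
have [Nt|tN] := leP (N%:R * h) t.
  rewrite (_ : [set w | _] = setT); first exact: FF_setT.
  apply/seteqP; split => // w _ /=; rewrite lee_fin (le_trans _ Nt)// ler_wpM2r ?ler_nat//.
  exact: ltW.
rewrite (_ : [set w | _] = \bigcup_j (if (j < N)%N && (j%:R * h <= t)
    then ~` [set w | below j w] else set0)).
  apply: (@bigcup_measurable _ (g_sigma_algebraType _)) => j _.
  case: ifPn => [/andP[_ jt]|_]; last exact: (@measurable0 _ (g_sigma_algebraType _)).
  apply: (@measurableC _ (g_sigma_algebraType _)).
  by apply: (FF_mono jt); exact: below_adapted.
apply/seteqP; split => w /=.
  rewrite lee_fin => ht; exists (hit w) => //.
  have hN : (hit w < N)%N.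
    by rewrite ltnNge; apply/negP => Nh; have := le_lt_trans ht tN; rewrite ltr_pM2r// ltr_nat ltnNge Nh.
  by rewrite hN ht /=; have := hitP hN; rewrite leNgt => /negP.
move=> [j _]; case: ifPn => // /andP[jN jt] /= nb.
rewrite lee_fin (le_trans _ jt)// ler_wpM2r ?ler_nat ?(ltW h0)//.
by rewrite leqNgt; apply/negP => /below_hit.
Qed.

(** The condition includes l = j: the increment from j to j + 1 is kept only if the state at j
    itself lies below the threshold. *)
Let cont j := [set w | eps 0 w = i /\ forall l, (l <= j)%N -> below l w].

Let cont_adapted j : FF (j%:R * h) (cont j).
Proof.
rewrite (_ : cont j = E `&` \bigcap_l (if (l <= j)%N then [set w | below l w] else setT)).
  apply: (@measurableI _ (g_sigma_algebraType _)); first exact: (FF_mono (jh0 j)).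
  apply: (@bigcap_measurable _ (g_sigma_algebraType _)) => // l _.
  case: ifPn => lj; last exact: (@measurableT _ (g_sigma_algebraType _)).
  have le : l%:R * h <= j%:R * h by rewrite ler_wpM2r ?ler_nat ?ltW.
  by apply: (FF_mono le); exact: below_adapted.
apply/seteqP; split=> w /= [Ew bw]; split=> // l.
  by move=> _; case: ifPn => // /bw.
by move=> lj; have := bw l I; rewrite lj.
Qed.

Let cont_hit j w : eps 0 w = i -> (j < hit w)%N -> cont j w.
Proof. by move=> Ew jh; split=> // l lj; apply: below_hit; exact: leq_ltn_trans jh. Qed.

Let cont_nhit j w : (hit w <= j < N)%N -> ~ cont j w.
Proof.
by move=> /andP[hj jN] [_ /(_ _ hj)]; rewrite /below ltNge hitP// (leq_ltn_trans hj).
Qed.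

Let gains j w : R := expR (- (rho * (j%:R * h))) * X (j%:R * h) w.

Let gainsE w : \1_E w * payoff tau w =
  \1_E w * gains 0 w + \sum_(j < N) \1_(cont j) w * (gains j.+1 w - gains j w).
Proof.
have [Ew|nE] := pselect (eps 0 w = i); last first.
  rewrite !indicE memNset// !mul0r big1 ?addr0// => j _.
  by rewrite indicE memNset ?mul0r// => -[].
rewrite indicE mem_set// !mul1r.
under eq_bigr do rewrite indicE.
rewrite (@stopped_telescope _ (gains ^~ w) (fun j => w \in cont j) (hit w))//.
- by rewrite /payoff /tau /= mulNr.
- by move=> j jh; rewrite mem_set//; exact: cont_hit.
- by move=> j jh; rewrite memNset//; exact: cont_nhit.
Qed.

Let gains_integrable j : L1 (gains j).
Proof. by apply: integrable_rvZ; apply: square_integrable_integrable; exact: X_square_integrable. Qed.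

Let payoff_integrable : L1 (fun w => \1_E w * payoff tau w).
Proof.
under [X in L1 X]eq_fun do rewrite gainsE.
apply: integrable_rvD.
  by apply: integrable_rv_indicM => //; exact: filtration_measurable FE.
apply: (@integrable_rv_sum _ _ _ P _ _ (fun (j : 'I_N) w => \1_(cont j) w * (gains j.+1 w - gains j w))) => j.
apply: integrable_rv_indicM; first exact: (filtration_measurable (@cont_adapted j)).
exact: integrable_rvB.
Qed.

Let near_v y j : `|phi y j| <= v y j + delta.
Proof.
have [_ _ _ /(_ y j)] := near_sol.
have := v_ge0 y j; rewrite !ler_norml => v0 /andP[? ?].
by apply/andP; split; lra.
Qed.

(** Up to the hitting index the discounted [phi] is nearly a martingale. At a hit, phi exceeds the
    payoff by at most delta; without a hit before the horizon, the discounted difference is at most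
    the last term, by [X_norm_le]. *)
Lemma grid_stopping_value : 1 <= N%:R * h -> exists tau : T -> \bar R,
  [/\ stopping_time FF tau, forall w, (tau w < +oo)%E,
      L1 (fun w => \1_E w * payoff tau w) &
      phi x i * fine (P E)
        - (one_step_const K / rho * k + expR rho * rho * (B + 1) * k ^+ 4) - delta
        - expR (- (rho * (N%:R * h))) * (B + 1 + moment_const * (N%:R * h) ^+ 2)
      <= Ex (fun w => \1_E w * payoff tau w)].
Proof.
move=> Nh1; exists tau; split => //; first by move=> w; rewrite ltry.
have [smooth sup eq near] := near_sol; have [d0 d1] := andP delta01.
have XI' : L1 (fun w => `|X (N%:R * h) w|).
  by apply/integrable_rv_norm/square_integrable_integrable/X_square_integrable.
have cL1 (c : R) : L1 (fun=> c) by apply: (@integrable_rv_bounded _ _ _ _ _ `|c|).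
set S := stopped_sum phi rho k i cont N.
have SL1 : L1 S by exact: (stopped_sum_integrable smooth rho k01 i cont_adapted).
set D := expR (- (rho * (N%:R * h))).
have D0 : 0 < D by exact: expR_gt0.
have lb : phi x i * fine (P E) - (one_step_const K / rho * k + expR rho * rho * (B + 1) * k ^+ 4) <= Ex S.
  apply: (stopped_sum_ge smooth rho_gt0 k01 i cont_adapted); last by rewrite addr_ge0.
  move=> j w [_ /(_ j (leqnn _)) bj]; split; first exact: eq.
  by apply: le_trans (near_v _ _) _; rewrite lerD// v_le.
have fL1 : L1 (fun w => \1_E w * payoff tau w + delta + D * (B + 1 + `|X (N%:R * h) w|)).
  by do ![apply: integrable_rvD => //|apply: integrable_rvZ => //].
have : Ex S <= Ex (fun w => \1_E w * payoff tau w + delta + D * (B + 1 + `|X (N%:R * h) w|)).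
  apply: Ex_le => // w.
  have [Ew|nE] := pselect (eps 0 w = i); last first.
    rewrite /S /stopped_sum !indicE memNset// !mul0r big1 ?addr0; last first.
      by move=> j _; rewrite indicE memNset ?mul0r// => -[].
    by rewrite add0r; apply: addr_ge0; [exact: ltW|rewrite mulr_ge0 ?addr_ge0// ltW].
  rewrite /S (@stopped_sumE phi rho k i cont N (hit w))//; first last.
  - by move=> j; exact: cont_nhit.
  - by move=> j; exact: cont_hit.
  rewrite indicE mem_set// mul1r /payoff /tau /= /discounted mulNr.
  set m := hit w; set e := expR (- (rho * (m%:R * h))).
  have e0 : 0 < e by exact: expR_gt0.
  have e1 : e <= 1.
    by rewrite /e -[leRHS]expR0 ler_expR oppr_le0; apply: mulr_ge0; [exact: ltW|exact: jh0].
  have := hit_le w; rewrite -/m leq_eqVlt => /predU1P[mN|mN].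
    (* At the horizon the state may still lie below the threshold; then phi <= B + 1, and exchanging
       phi for X costs at most B + 1 + |X|, discounted. *)
    have [ha|hb] := leP (a (eps (m%:R * h) w)) (X (m%:R * h) w).
      have := near (X (m%:R * h) w) (eps (m%:R * h) w).
      rewrite v_stop// ler_distl => /andP[_ pX].
      have : 0 <= D * (B + 1 + `|X (N%:R * h) w|) by rewrite mulr_ge0 ?addr_ge0// ltW.
      move: (D * _) => q q0.
      have : e * phi (X (m%:R * h) w) (eps (m%:R * h) w) <= e * (X (m%:R * h) w + delta).
        by rewrite ler_pM2l.
      have : e * delta <= delta by rewrite ler_piMl// ltW.
      by rewrite mulrDr; lra.
    have -> : e = D by rewrite /e /D mN.
    rewrite mN -mN; have := near_v (X (m%:R * h) w) (eps (m%:R * h) w).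
    have := v_le hb; have := ler_norm (phi (X (m%:R * h) w) (eps (m%:R * h) w)).
    have := ler_norm (- X (m%:R * h) w); rewrite normrN => h1 h2 h3 h4.
    have : D * phi (X (m%:R * h) w) (eps (m%:R * h) w) <= D * (X (m%:R * h) w + (B + 1 + `|X (m%:R * h) w|)).
      by rewrite ler_pM2l//; lra.
    by rewrite [D * (X _ _ + _)]mulrDr; lra.
  have := near (X (m%:R * h) w) (eps (m%:R * h) w).
  rewrite v_stop ?hitP// ler_distl => /andP[_ pX].
  have : 0 <= D * (B + 1 + `|X (N%:R * h) w|) by rewrite mulr_ge0 ?addr_ge0// ltW.
  move: (D * _) => q q0.
  have : e * phi (X (m%:R * h) w) (eps (m%:R * h) w) <= e * (X (m%:R * h) w + delta).
    by rewrite ler_pM2l.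
  have : e * delta <= delta by rewrite ler_piMl// ltW.
  by rewrite mulrDr; lra.
have XD : L1 (fun w => B + 1 + `|X (N%:R * h) w|) by exact: integrable_rvD.
have pdL1 : L1 (fun w => \1_E w * payoff tau w + delta) by exact: integrable_rvD.
rewrite (ExD pdL1 (integrable_rvZ D XD)) (ExD payoff_integrable (cL1 _)) (ExZ _ XD) (ExD (cL1 _) XI') !Ex_cst.
have : D * (B + 1 + Ex (fun w => `|X (N%:R * h) w|)) <= D * (B + 1 + moment_const * (N%:R * h) ^+ 2).
  by rewrite ler_pM2l// lerD2l; exact: X_norm_le.
by move: lb; move: (Ex S) (D * _) (D * _) => ? ? ?; lra.
Qed.

End Lower.

(** * An upper bound for every stopping time *)

Section Upper.
Variables (delta K : R) (phi phi1 phi2 : R -> 'I_2 -> R).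
Hypothesis delta01 : 0 < delta <= 1.
Hypothesis near_sol : near_solution delta K phi phi1 phi2.
Variable tau : T -> \bar R.
Hypothesis tau_stopping : stopping_time FF tau.
Hypothesis tau_fin : {ae P, forall w, eps 0 w = i -> (tau w < +oo)%E}.

(** Raised by delta, [phi] dominates the payoff and 0, and it remains a supersolution because rho
    delta >= 0. *)
Let psi y j := phi y j + delta.

Let psi_smooth : smooth_test K psi phi1 phi2.
Proof.
have [[hm hb hL hT hT3] _ _ _] := near_sol.
have psiB y j y' j' : psi y j - psi y' j' = phi y j - phi y' j'.
  by rewrite /psi; ring.
split=> //.
- by move=> j; have [? ? ?] := hm j; split=> //; exact: measurable_funD.
- by move=> j y; rewrite psiB.
- by move=> j y e; rewrite psiB; exact: hT.
- by move=> j y e; rewrite psiB; exact: hT3.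
Qed.

Let psi_ge y j : Num.max y 0 <= psi y j.
Proof.
have [_ _ _ /(_ y j)] := near_sol; rewrite ler_distl => /andP[h _].
by rewrite /psi ge_max; have := v_ge y j; have := v_ge0 y j => ? ?; apply/andP; split; lra.
Qed.

Let psi_ge0 y j : 0 <= psi y j.
Proof. by have := psi_ge y j; rewrite ge_max => /andP[]. Qed.

Let psi_super y j : gen_test psi phi2 y j <= rho * psi y j.
Proof.
have [_ /(_ y j) sup _ _] := near_sol; have [d0 _] := andP delta01.
apply: le_trans (_ : rho * phi y j <= _); last by rewrite ler_pM2l// lerDl ltW.
by apply: le_trans sup; rewrite /gen_test /psi opprD addrACA subrr addr0.
Qed.

(** With mesh (n + 1)^-4 and (n + 1)^5 steps, the horizon n + 1 grows while the total error,
    proportional to k = 1/(n + 1), vanishes. *)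
Let step n : R := n.+1%:R^-1.
Local Notation h n := (step n ^+ 4).
Let step01 n : 0 < step n <= 1.
Proof. by rewrite invr_gt0 ltr0n invf_le1 ?ler1n ?ltr0n. Qed.
Let h0 n : 0 < h n. Proof. by rewrite exprn_gt0// /step invr_gt0. Qed.
Let horizon n : (n.+1 ^ 5)%:R * h n = n.+1%:R.
Proof.
have : n.+1%:R != 0 :> R by rewrite pnatr_eq0.
by rewrite natrX /step; move: (n.+1%:R) => z z0; field.
Qed.

(** The process runs while the grid time is before [tau], so it stops at the first grid time not
    before [tau], or at the horizon. Rounding up keeps these events adapted. *)
Let run n j := E `&` [set w | ((j%:R * h n)%:E < tau w)%E].

Let run_adapted n j : FF (j%:R * h n) (run n j).
Proof.
have j0 : 0 <= j%:R * h n by rewrite mulr_ge0// ltW.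
apply: (@measurableI _ (g_sigma_algebraType _)); first exact: (FF_mono j0).
have [_ /(_ _ j0)] := tau_stopping.
move=> /(@measurableC _ (g_sigma_algebraType _)); congr (FF _ _).
by apply/seteqP; split => w /=; [move=> /negP; rewrite -ltNge|rewrite ltNge => /negP].
Qed.

Let Y n := stopped_sum psi rho (step n) i (run n) (n.+1 ^ 5).

Let Y_value n w : eps 0 w = i -> exists m, [/\ (m <= n.+1 ^ 5)%N,
    Y n w = discounted psi rho (step n) m w,
    (forall j, (j < m)%N -> ((j%:R * h n)%:E < tau w)%E) &
    (m < n.+1 ^ 5)%N -> (tau w <= (m%:R * h n)%:E)%E].
Proof.
move=> Ew; pose N := (n.+1 ^ 5)%N.
pose q j := (tau w <= (j%:R * h n)%:E)%E.
pose m := find q (iota 0 N).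
have mN : (m <= N)%N by rewrite -[leqRHS](size_iota 0 N) find_size.
have before j : (j < m)%N -> ((j%:R * h n)%:E < tau w)%E.
  move=> jm; have := before_find 0%N jm; rewrite nth_iota ?add0n; last exact: leq_trans jm mN.
  by move/negbT; rewrite /q -ltNge.
have after : (m < N)%N -> (tau w <= (m%:R * h n)%:E)%E.
  move=> hN; have := @nth_find _ 0%N q (iota 0 N).
  by rewrite has_find size_iota => /(_ hN); rewrite nth_iota// add0n.
exists m; split => //; apply: stopped_sumE => //.
  by move=> j /before jt; split.
move=> j /andP[mj jN] [_ /=]; rewrite ltNge => /negP; apply.
apply: le_trans (after (leq_ltn_trans mj jN)) _.
by rewrite lee_fin ler_wpM2r ?ler_nat// ltW.
Qed.

Let Y_ge0 n w : 0 <= Y n w.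
Proof.
have [/(Y_value n) [m [_ -> _ _]]|nE] := pselect (eps 0 w = i).
  by rewrite mulr_ge0 ?expR_ge0.
rewrite /Y /stopped_sum indicE memNset// mul0r add0r sumr_ge0// => j _.
by rewrite indicE memNset ?mul0r// => -[].
Qed.

(** Once the horizon exceeds [tau], the grid time of stopping is at most one mesh after [tau]; the
    path is continuous there and psi dominates the payoff. *)
Let Y_limit w : continuous_at_nonneg (X ^~ w) -> eps 0 w = i -> (tau w < +oo)%E ->
  forall e, 0 < e -> exists n0, forall n, (n0 <= n)%N -> payoff tau w - e <= Y n w.
Proof.
move=> Xc Ew taufin e e0; have [tau0 _] := tau_stopping.
have [r rE] : exists r, tau w = r%:E.
  by exists (fine (tau w)); rewrite fineK// ge0_fin_numE.
have r0 : 0 <= r by rewrite -lee_fin -rE.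
rewrite /payoff rE /=.
have [m hm] := choice (fun n => Y_value n Ew).
pose g t := expR (- rho * t) * X t w.
have gc : continuous_at_nonneg g.
  exact: continuous_nonneg_discount.
have [eta eta0 heta] := gc r r0 e e0.
exists (maxn (Num.truncn r) (Num.truncn eta^-1)) => n; rewrite geq_max => /andP[nr neta].
have rn : r < n.+1%:R by apply: lt_le_trans (truncnS_gt _) _; rewrite ler_nat ltnS.
have hn : h n < eta.
  have s1 := step01 n; case/andP: s1 => s0 s1.
  apply: (@le_lt_trans _ _ (step n)).
    by rewrite exprS; apply: ler_piMr; [exact: ltW|apply: exprn_ile1 => //; exact: ltW].
  rewrite /step invf_plt ?posrE//.
  by apply: lt_le_trans (truncnS_gt _) _; rewrite ler_nat ltnS.
have [mN YE before after] := hm n.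
have rt : r <= (m n)%:R * h n.
  move: mN; rewrite leq_eqVlt => /predU1P[->|/after]; first by rewrite horizon ltW.
  by rewrite rE lee_fin.
have tr : (m n)%:R * h n - r < eta.
  apply: le_lt_trans hn; rewrite lerBlDr.
  case: (m n) before => [|m'] before; first by rewrite mul0r addr_ge0// ltW.
  by have := before m' (ltnSn _); rewrite rE lte_fin -(natr1 m') mulrDl mul1r addrC lerD2l => /ltW.
have : `|g ((m n)%:R * h n) - g r| < e.
  apply: heta; first exact: le_trans rt.
  by rewrite ger0_norm// subr_ge0.
rewrite ltr_norml => /andP[+ _] => ge.
have : g ((m n)%:R * h n) <= Y n w.
  rewrite YE /discounted /g mulNr ler_pM2l ?expR_gt0//.
  by apply: le_trans (psi_ge _ _); rewrite le_max lexx.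
by rewrite /g in ge *; lra.
Qed.

(** The variables [Y n] are nonnegative, have mean at most that of psi at the start plus C/(n + 1),
    and almost surely their lower limit dominates the payoff on [E]. Fatou's lemma concludes. *)
Lemma stopping_time_payoff_le :
  (\int[P]_(w in E) (payoff tau w)%:E <= ((phi x i + delta) * fine (P E))%:E)%E.
Proof.
apply: (fatou_nonmeasurable (Y := Y) (C := one_step_const K / rho)) => //.
- by move=> n; exact: (stopped_sum_integrable psi_smooth rho (step01 n) i (@run_adapted n)).
- move=> n; exact: (stopped_sum_le psi_smooth rho_gt0 (step01 n) i (@run_adapted n)).
apply: filterS2 X_continuous tau_fin => w Xc tf Ew; exact: Y_limit (tf Ew).
Qed.

End Upper.

(** * Identification of the value *)

Hypothesis E_gt0 : (0 < P E)%E.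
Hypothesis approximable : forall delta, 0 < delta <= 1 ->
  exists K phi phi1 phi2, near_solution delta K phi phi1 phi2.

Let p := fine (P E).
Let mE : measurable E. Proof. exact: filtration_measurable FE. Qed.
Let pE : P E = p%:E. Proof. exact: probability_EFin. Qed.
Let p0 : 0 < p. Proof. by rewrite -lte_fin -pE. Qed.

Let near_value delta K phi phi1 phi2 : near_solution delta K phi phi1 phi2 ->
  v x i - delta <= phi x i <= v x i + delta.
Proof. by move=> [_ _ _ /(_ x i)]; rewrite ler_distl. Qed.

Let payoff_le_value tau : stopping_time FF tau ->
  {ae P, forall w, eps 0 w = i -> (tau w < +oo)%E} ->
  (expectation_given P E (payoff tau) <= (v x i)%:E)%E.
Proof.
move=> st tf; apply/lee_addgt0Pr => e e0.
pose delta := Num.min 1 (e / 2).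
have d01 : 0 < delta <= 1 by rewrite lt_min ltr01 divr_gt0//= ge_min lexx.
have de : 2 * delta <= e by rewrite mulrC -ler_pdivlMr// ge_min lexx orbT.
have [K [phi [phi1 [phi2 ns]]]] := approximable d01.
have := stopping_time_payoff_le d01 ns st tf; have /andP[_ nv] := near_value ns.
rewrite /expectation_given pE /= => h.
apply: (@le_trans _ _ (((phi x i + delta) * p)%:E * p^-1%:E)%E).
  by apply: lee_wpmul2r => //; rewrite lee_fin invr_ge0 ltW.
by rewrite -EFinM mulfK ?gt_eqF// -EFinD lee_fin; lra.
Qed.

Lemma stopping_sup :
  ereal_sup [set r | exists tau : T -> \bar R, [/\ stopping_time FF tau,
    {ae P, forall w, eps 0 w = i -> (tau w < +oo)%E} &
    r = expectation_given P E (payoff tau)]] = (v x i)%:E.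
Proof.
apply/eqP; rewrite eq_le; apply/andP; split.
  by apply: ge_ereal_sup => _ [tau [st tf ->]]; exact: payoff_le_value.
apply/lee_subgt0Pr => e e0.
have p1 : p <= 1 by rewrite -lee_fin -pE probability_le1.
(* The two losses delta p and delta then add up to at most half of e p. *)
pose delta := Num.min 1 (e * p / 4).
have d01 : 0 < delta <= 1 by rewrite lt_min ltr01 divr_gt0 ?mulr_gt0//= ge_min lexx.
have de : delta * 4 <= e * p by rewrite -ler_pdivlMr// ge_min lexx orbT.
have [K [phi [phi1 [phi2 ns]]]] := approximable d01.
have /andP[nv _] := near_value ns.
have m0 : 0 <= moment_const.
  rewrite /moment_const !addr_ge0 ?sqr_ge0// mulr_ge0//; exact: gap_const_ge0.
(* The coefficients of k in [grid_stopping_value] when the horizon is n + 1 = 1/k; by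
   [discount_sqr_le] the loss at the horizon is also of order k. The choice of [n] makes C k at most
   the other half of e p. *)
pose C := one_step_const K / rho + expR rho * rho * (B + 1) +
  6 / rho ^+ 3 * (B + 1 + moment_const).
pose n := Num.truncn (`|C| * 2 / (e * p)).
pose k : R := n.+1%:R^-1.
have k0 : 0 < k by rewrite invr_gt0.
have k1 : k <= 1 by rewrite invf_le1 ?ler1n.
have k01 : 0 < k <= 1 by rewrite k0.
have horizon : (n.+1 ^ 5)%:R * k ^+ 4 = n.+1%:R.
  have : n.+1%:R != 0 :> R by rewrite pnatr_eq0.
  by rewrite natrX /k; move: (n.+1%:R) => z z0; field.
have [] := grid_stopping_value d01 ns k01 (_ : 1 <= (n.+1 ^ 5)%:R * k ^+ 4).
  by rewrite horizon ler1n.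
move=> tau [st tf L1p]; rewrite horizon => lb.
apply: (@le_trans _ _ (expectation_given P E (payoff tau))); last first.
  by apply: ereal_sup_ubound; exists tau; split => //; apply: nearW.
have -> : expectation_given P E (payoff tau) =
    ((Ex (fun w => \1_E w * payoff tau w)) * p^-1)%:E.
  rewrite /expectation_given EFinM EFin_Ex// integral_mkcond; congr (_ * _)%E.
  apply: eq_integral => w _.
  by rewrite patchE indicE; case: (w \in E); rewrite ?mul1r ?mul0r.
rewrite -EFinB lee_fin ler_pdivlMr//; apply: le_trans lb.
have t1 : 1 <= n.+1%:R :> R by rewrite ler1n.
have := discount_sqr_le rho_gt0 t1 (_ : 0 <= B + 1) m0.
rewrite -/k addr_ge0// => /(_ isT) dl.
have k4 : expR rho * rho * (B + 1) * k ^+ 4 <= expR rho * rho * (B + 1) * k.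
  rewrite ler_wpM2l ?mulr_ge0 ?expR_ge0 ?addr_ge0 ?(ltW rho_gt0)//.
  by rewrite exprS; apply: ler_piMr; [exact: ltW|apply: exprn_ile1 => //; exact: ltW].
have Ck : C * k <= e * p / 2.
  apply: (@le_trans _ _ (`|C| * k)); first by rewrite ler_wpM2r ?ler_norm ?ltW.
  have ep : 0 < e * p by rewrite mulr_gt0.
  rewrite /k ler_pdivrMr// -ler_pdivrMl ?divr_gt0// invf_div mulrC mulrA.
  exact/ltW/truncnS_gt.
have np : (v x i - delta) * p <= phi x i * p by rewrite ler_pM2r.
have dp : delta * p <= delta by rewrite ler_piMr// ltW; case/andP: d01.
move: Ck dp np k4 dl de; rewrite -/p /C; move: (one_step_const K / rho)
  (expR rho * rho * (B + 1)) (6 / rho ^+ 3 * (B + 1 + moment_const))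
  (expR _ * (_ + _)) (k ^+ 4) (v x i) (phi x i) => C1 C2 C3 D kk vx px.
by rewrite !mulrDl !mulNr; lra.
Qed.
End Diffusion.
End RegimeSwitchingDiffusion.

(* Replacing [X] by [X - theta] reduces the payoff to the case [theta = 0]. *)
Theorem verification d (T : measurableType d) (R : realType) (P : probability T R)
  (W : R -> T -> R) (eps : R -> T -> 'I_2) (lambda sigma : 'I_2 -> R) (rho : R)
  (v : R -> 'I_2 -> R) (a : 'I_2 -> R) (B x theta : R) (X : R -> T -> R) (i : 'I_2) :
  (forall i, 0 < lambda i) -> measure_is_complete P -> brownian_motion P W ->
  markov_chain P (regime_rates lambda) eps ->
  independent_systems P <<s events measurable W `[0, +oo[ >>
    <<s events [set: set 'I_2] eps `[0, +oo[ >> ->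
  regime_switching_diffusion P W eps sigma x X -> 0 < rho -> 0 <= B ->
  (forall y i, 0 <= v y i) -> (forall y i, y <= v y i) ->
  (forall y i, a i <= y -> v y i = y) -> (forall y i, y < a i -> v y i <= B) ->
  (0 < P [set w | eps 0%R w = i])%E ->
  (forall delta, 0 < delta <= 1 -> exists K phi phi1 phi2,
     near_solution lambda sigma rho v a delta K phi phi1 phi2) ->
  stopping_value P W eps rho X i theta = (v (x - theta) i)%:E.
Proof.
move=> l0 Pc WB eM ind XI r0 B0 v0 vge vst vle E0 appr.
have XI' : regime_switching_diffusion P W eps sigma (x - theta) (fun t w => X t w - theta).
  rewrite /regime_switching_diffusion.
  rewrite (_ : (fun t w => X t w - theta - (x - theta)) = (fun t w => X t w - x))//.
  by apply/funext => t; apply/funext => w; ring.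
exact: (stopping_sup l0 Pc WB eM ind XI' r0 B0 v0 vge vst vle E0 appr).
Qed.

(** * Characteristic exponents of the coupled equations *)

Section Thresholds.
Context {R : realType}.

Lemma sign_change_root (g : R -> R) (y z : R) : y <= z ->
  {within `[y, z], continuous g} ->
  (g y <= 0 <= g z) || (g z <= 0 <= g y) -> exists2 c, y <= c <= z & g c = 0.
Proof.
move=> yz gc sg; have := @IVT R g y z 0 yz gc.
have : Num.min (g y) (g z) <= 0 <= Num.max (g y) (g z).
  by case/orP: sg => /andP[h1 h2]; rewrite ge_min le_max h1 h2 ?orbT.
by move=> mm /(_ mm)[c]; rewrite in_itv/=; exists c.
Qed.

Variables (s1 s2 l1 l2 rho : R).
Hypotheses (s10 : 0 < s1) (s12 : s1 <= s2) (l10 : 0 < l1) (l20 : 0 < l2)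
  (rho0 : 0 < rho).
Let p1 := rho + l1.
Let p2 := rho + l2.
Let s20 : 0 < s2. Proof. exact: lt_le_trans s12. Qed.

(** The determinant of the system satisfied by the amplitudes of a solution proportional to e^(bx)
    in both regimes, as a function of z = b^2. *)
Let char_poly (z : R) := (s1 / 2 * z - p1) * (s2 / 2 * z - p2) - l1 * l2.

Let char_poly_continuous : continuous char_poly.
Proof.
have lc (s p : R) : continuous (fun z => s * z - p).
  by move=> z; apply: cvgB; [exact: mulrl_continuous|exact: cvg_cst].
by move=> z; apply: cvgB; [apply: cvgM; exact: lc|exact: cvg_cst].
Qed.

(* The square of the exponent is the root of [char_poly] below, resp. above,
   [2 (rho + l1) / s1]; [s1 <= s2] forces the first one below [2 rho / s1]. *)
Lemma characteristic_exponents : exists b1 b2 v1 v2 : R,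
  [/\ 0 < b1 < b2, 1 <= v1, v2 < 0,
     (s1 / 2 * b1 ^+ 2 - p1 + l1 * v1 = 0 /\ (s2 / 2 * b1 ^+ 2 - p2) * v1 + l2 = 0) &
     (s1 / 2 * b2 ^+ 2 - p1 + l1 * v2 = 0 /\ (s2 / 2 * b2 ^+ 2 - p2) * v2 + l2 = 0)].
Proof.
have z0 : 0 <= 2 * rho / s1 by rewrite divr_ge0 ?mulr_ge0// ltW.
have [|z1 /andP[z10 z1r] cz1] := sign_change_root z0 (continuous_subspaceT char_poly_continuous).
  apply/orP; right; apply/andP; split.
    have -> : char_poly (2 * rho / s1) = l1 * (rho * (1 - s2 / s1)).
      by rewrite /char_poly /p1 /p2; field; rewrite gt_eqF.
    by rewrite !(pmulr_rle0 _ (_ : 0 < _))// subr_le0 ler_pdivlMr// mul1r.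
  by rewrite /char_poly !mulr0 !sub0r mulrNN /p1 /p2; have := l10; have := l20; have := rho0; nra.
have z1p : 0 < z1.
  rewrite lt_neqAle z10 andbT; apply/eqP => z1E; move: cz1; rewrite -z1E.
  by rewrite /char_poly !mulr0 !sub0r mulrNN /p1 /p2; have := l10; have := l20; have := rho0; nra.
pose M := 2 * (p1 + l1) / s1 + 2 * (p2 + l2) / s2.
have zM : 2 * p1 / s1 <= M.
  have : 0 <= 2 * (p2 + l2) / s2 by rewrite divr_ge0 ?mulr_ge0 ?addr_ge0// ltW.
  have : 2 * p1 / s1 <= 2 * (p1 + l1) / s1 by rewrite ler_pM2r ?invr_gt0// ler_pM2l// lerDl ltW.
  by rewrite /M; lra.
have [|z2 /andP[z20 z2M] cz2] := sign_change_root zM (continuous_subspaceT char_poly_continuous).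
  apply/orP; left; apply/andP; split.
    have -> : char_poly (2 * p1 / s1) = - (l1 * l2).
      by rewrite /char_poly; field; rewrite gt_eqF.
    by rewrite oppr_le0 mulr_ge0// ltW.
  have -> : char_poly M = (l1 + s1 / 2 * (2 * (p2 + l2) / s2)) *
      (l2 + s2 / 2 * (2 * (p1 + l1) / s1)) - l1 * l2.
    by rewrite /char_poly /M; field; rewrite !gt_eqF.
  rewrite subr_ge0; apply: ler_pM; try exact: ltW; rewrite lerDl;
    by rewrite !mulr_ge0 ?invr_ge0 ?addr_ge0// ltW.
(* The ratio of the amplitude in regime 2 to that in regime 1, read off the first equation; the
   second then says that [char_poly] vanishes. *)
pose v1 := (p1 - s1 / 2 * z1) / l1; pose v2 := (p1 - s1 / 2 * z2) / l1.
have z2p : 2 * p1 / s1 < z2.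
  rewrite lt_neqAle z20 andbT; apply/eqP => zE; move: cz2; rewrite -zE.
  have -> : char_poly (2 * p1 / s1) = - (l1 * l2).
    by rewrite /char_poly; field; rewrite gt_eqF.
  by have := mulr_gt0 l10 l20; lra.
have z12 : z1 < z2.
  apply: le_lt_trans z1r _; apply: lt_trans z2p.
  by rewrite ltr_pM2r ?invr_gt0// ltr_pM2l// ltrDl.
have eqs z : char_poly z = 0 -> s1 / 2 * z - p1 + l1 * ((p1 - s1 / 2 * z) / l1) = 0 /\
    (s2 / 2 * z - p2) * ((p1 - s1 / 2 * z) / l1) + l2 = 0.
  rewrite /char_poly => /eqP; rewrite subr_eq0 => /eqP cz; split.
    by field; rewrite gt_eqF.
  apply: (mulfI (x := l1)); first by rewrite gt_eqF.
  rewrite mulr0 mulrDr -cz; field; by rewrite gt_eqF.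
have z20' : 0 < z2 by exact: lt_trans z12.
exists (Num.sqrt z1), (Num.sqrt z2), v1, v2; rewrite (sqr_sqrtr (ltW z1p)) (sqr_sqrtr (ltW z20')); split.
- by rewrite sqrtr_gt0 z1p ltr_sqrt.
- rewrite /v1 ler_pdivlMr// mul1r lerBrDr -lerBrDl /p1 addrK.
  by move: z1r; rewrite ler_pdivlMr//; lra.
- rewrite /v2 ltr_pdivrMr// mul0r subr_lt0.
  by move: z2p; rewrite ltr_pdivrMr//; lra.
- exact: eqs.
- exact: eqs.
Qed.

End Thresholds.

(** * The two free boundaries *)

Section FreeBoundaries.
Context {R : realType}.
Variables (b1 b2 v1 v2 k r : R).
Hypotheses (b10 : 0 < b1) (b12 : b1 < b2) (v11 : 1 <= v1) (v20 : v2 < 0)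
  (k0 : 0 < k) (r01 : 0 < r < 1).

(** The amplitudes of e^(b1(x-a)) and e^(b2(x-a)) in regime 1, determined by smooth fit with the
    payoff at [a]: value a ([weightD]) and slope 1 ([weight_slope]). *)
Definition weight1 (a : R) : R := (b2 * a - 1) / (b2 - b1).
Definition weight2 (a : R) : R := (1 - b1 * a) / (b2 - b1).

(** [G] and [D] are the excess over the payoff, in value and in slope, of the regime 2 function at
    the regime 1 threshold [a]. *)
Let G a := v1 * weight1 a + v2 * weight2 a - a.
Let D a := v1 * b1 * weight1 a + v2 * b2 * weight2 a - 1.
Let b20 : 0 < b2. Proof. exact: lt_trans b12. Qed.
Let b120 : 0 < b2 - b1. Proof. by rewrite subr_gt0. Qed.

Lemma weightD a : weight1 a + weight2 a = a.
Proof. by rewrite /weight1 /weight2; field; rewrite gt_eqF. Qed.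

Lemma weight_slope a : b1 * weight1 a + b2 * weight2 a = 1.
Proof. by rewrite /weight1 /weight2; field; rewrite gt_eqF. Qed.

Lemma weight1_ge0 a : b2^-1 <= a -> 0 <= weight1 a.
Proof.
move=> ha; rewrite divr_ge0 ?(ltW b120)// subr_ge0.
by rewrite -ler_pdivrMl// mulr1.
Qed.

Lemma weight2_ge0 a : a <= b1^-1 -> 0 <= weight2 a.
Proof.
move=> ha; rewrite divr_ge0 ?(ltW b120)// subr_ge0.
by rewrite -ler_pdivlMl// mulr1.
Qed.

Let GE a : G a = (v1 - 1) * weight1 a - (1 - v2) * weight2 a.
Proof. by rewrite /G -[in X in _ - X](weightD a); ring. Qed.

Let DE a : D a = (v1 - 1) * b1 * weight1 a - (1 - v2) * b2 * weight2 a.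
Proof. by rewrite /D -[in X in _ - X](weight_slope a); ring. Qed.

Let bet1 := k * ((v1 * b2 - v2 * b1) / (b2 - b1) - 1) + b1 * b2 * (v1 - v2) / (b2 - b1).
Let bet0 := k * ((v2 - v1) / (b2 - b1)) + (v2 * b2 - v1 * b1) / (b2 - b1) - 1.

Let affine a : k * G a + D a = bet0 + bet1 * a.
Proof. by rewrite /G /D /weight1 /weight2 /bet0 /bet1; field; rewrite gt_eqF. Qed.

Let bet1_gt0 : 0 < bet1.
Proof.
apply: addr_gt0; last first.
  rewrite divr_gt0// mulr_gt0 ?mulr_gt0// subr_gt0.
  by apply: lt_trans v20 _; exact: lt_le_trans v11.
rewrite mulr_gt0// subr_gt0 ltr_pdivlMr// mul1r.
have : b2 <= v1 * b2 by rewrite ler_peMl// ltW.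
have : v2 * b1 < 0 by rewrite pmulr_llt0.
have := b10; lra.
Qed.

(** For fixed [l] the second equation of [free_boundaries] is affine in [a], with slope [den l] > 0
    and root [af l]. *)
Let den (l : R) := bet1 + r * k * (1 - expR (- l)).
Let num (l : R) := r * ((l + 1) * expR (- l) - 1) - bet0.
Let af l := num l / den l.

Let den_gt0 l : 0 <= l -> 0 < den l.
Proof.
move=> l0; apply: ltr_wpDr => //; case/andP: r01 => r0 _.
by apply: mulr_ge0; [rewrite mulr_ge0// ltW|rewrite subr_ge0 expR_le1 oppr_le0].
Qed.

Let gap l a := k * G a + D a - r * ((k * a + l + 1) * expR (- l) - (k * a + 1)).

Let gapE l a : gap l a = den l * a - num l.
Proof. by rewrite /gap affine /den /num; ring. Qed.

Let gap_af l : 0 <= l -> gap l (af l) = 0.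
Proof. by move=> l0; rewrite gapE /af mulrC divfK ?subrr// gt_eqF// den_gt0. Qed.

(** Since [gap l] increases in its argument, the claim is that it is nonpositive at 1/b2, where
    [weight1] vanishes. Likewise [af_le] tests the sign at 1/b1, where [weight2] vanishes. Together
    they make both weights nonnegative at [af l]. *)
Let af_ge l : 0 <= l -> b2^-1 <= af l.
Proof.
move=> l0; have dl := den_gt0 l0; rewrite -(ler_pM2l dl) -(lerD2r (- num l)) -!gapE gap_af//.
have w1 : weight1 b2^-1 = 0 by rewrite /weight1 divff ?subrr ?mul0r// gt_eqF.
have w2 : weight2 b2^-1 = b2^-1 by rewrite -{2}(weightD b2^-1) w1 add0r.
rewrite /gap GE DE w1 w2 !mulr0 !sub0r.
have -> : (1 - v2) * b2 * b2^-1 = 1 - v2 by rewrite mulfK// gt_eqF.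
have c0 : 0 <= k * b2^-1 by rewrite mulr_ge0 ?invr_ge0 ?ltW.
case/andP: r01 => r0 r1; have e0 := expR_gt0 (- l).
have : 0 <= r * ((k * b2^-1 + l + 1) * expR (- l)).
  by rewrite !mulr_ge0 ?addr_ge0// ltW.
rewrite [k * - _](_ : _ = - ((1 - v2) * (k * b2^-1))); last by ring.
move: (k * b2^-1) (_ * expR _) c0 => c E c0 E0.
have : r * (c + 1) <= (1 - v2) * (c + 1).
  by rewrite ler_pM2r ?ltr_wpDl//; have := v20; lra.
by lra.
Qed.

Let af_le l : 0 <= l -> af l <= b1^-1.
Proof.
move=> l0; have dl := den_gt0 l0; rewrite -(ler_pM2l dl) -(lerD2r (- num l)) -!gapE gap_af//.
have w2 : weight2 b1^-1 = 0 by rewrite /weight2 divff ?subrr ?mul0r// gt_eqF.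
have w1 : weight1 b1^-1 = b1^-1 by rewrite -{2}(weightD b1^-1) w2 addr0.
rewrite /gap GE DE w1 w2 !mulr0 !subr0.
have c0 : 0 <= k * b1^-1 by rewrite mulr_ge0 ?invr_ge0 ?ltW.
case/andP: r01 => r0 r1; have e0 := expR_gt0 (- l).
have -> : (v1 - 1) * b1 * b1^-1 = v1 - 1 by rewrite mulfK// gt_eqF.
rewrite [k * _](_ : _ = (v1 - 1) * (k * b1^-1)); last by ring.
move: (k * b1^-1) c0 => c c0.
have : (c + l + 1) * expR (- l) <= c + 1.
  rewrite expRN ler_pdivrMr ?expR_gt0//.
  have := expR_ge1Dx l; have : 0 <= c * l by rewrite mulr_ge0.
  move=> cl el; have : (c + 1) * (1 + l) <= (c + 1) * expR l by rewrite ler_wpM2l ?addr_ge0.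
  by rewrite mulrDl mulrDr; lra.
move=> h; have : 0 <= (v1 - 1) * c by rewrite mulr_ge0 ?subr_ge0.
have : r * ((c + l + 1) * expR (- l) - (c + 1)) <= 0 by rewrite pmulr_rle0// subr_le0.
by have := v11; lra.
Qed.

Let diff l := r * ((k * af l + l - 1) * expR l - (k * af l - 1)) - (k * G (af l) - D (af l)).

Let af_continuous l : 0 <= l -> {for l, continuous af}.
Proof.
move=> l0; have ec : continuous (fun l : R => expR (- l)).
  by move=> t; apply: continuous_comp; [exact: opp_continuous|exact: continuous_expR].
apply: cvgM; last apply: cvgV.
- apply: cvgB; last exact: cvg_cst.
  apply: cvgM; first exact: cvg_cst.
  apply: cvgB; last exact: cvg_cst.
  by apply: cvgM; [apply: cvgD; [exact: cvg_id|exact: cvg_cst]|exact: ec].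
- by rewrite gt_eqF// den_gt0.
- apply: cvgD; first exact: cvg_cst.
  apply: cvgM; first exact: cvg_cst.
  by apply: cvgB; [exact: cvg_cst|exact: ec].
Qed.

Let diff_continuous l : 0 <= l -> {for l, continuous diff}.
Proof.
move=> l0; have ac := af_continuous l0.
have w1c : weight1 (af t) @[t --> l] --> weight1 (af l).
  by apply: cvgM; last exact: cvg_cst; apply: cvgB; last exact: cvg_cst; apply: cvgM => //; exact: cvg_cst.
have w2c : weight2 (af t) @[t --> l] --> weight2 (af l).
  by apply: cvgM; last exact: cvg_cst; apply: cvgB; first exact: cvg_cst; apply: cvgM => //; exact: cvg_cst.
have kac : k * af t @[t --> l] --> k * af l by apply: cvgM => //; exact: cvg_cst.
apply: cvgB.
  apply: cvgM; first exact: cvg_cst.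
  apply: cvgB; last by apply: cvgB => //; exact: cvg_cst.
  apply: cvgM; last exact: continuous_expR.
  by apply: cvgB; [apply: cvgD => //; exact: cvg_id|exact: cvg_cst].
apply: cvgB.
  apply: cvgM; first exact: cvg_cst.
  by apply: cvgB => //; apply: cvgD; apply: cvgM => //; exact: cvg_cst.
apply: cvgB; last exact: cvg_cst.
by apply: cvgD; apply: cvgM => //; exact: cvg_cst.
Qed.

(* [l / k] is the distance between the two thresholds. For each [l] the second
   equation is solved by [af l], and the first one then has a root in [l]. *)
Lemma free_boundaries : exists a l : R,
  [/\ b2^-1 <= a <= b1^-1, 0 <= l,
      k * (v1 * weight1 a + v2 * weight2 a - a) -
        (v1 * b1 * weight1 a + v2 * b2 * weight2 a - 1) =
        r * ((k * a + l - 1) * expR l - (k * a - 1)) &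
      k * (v1 * weight1 a + v2 * weight2 a - a) +
        (v1 * b1 * weight1 a + v2 * b2 * weight2 a - 1) =
        r * ((k * a + l + 1) * expR (- l) - (k * a + 1))].
Proof.
have [r0 r1] := andP r01.
(* A bound for k G - D at [af l], since both weights are at most af l <= 1/b1; [L] is chosen with r
   (L - 1) = M. *)
pose M := k * (v1 - 1) / b1 + b2 * (1 - v2) / b1.
have v2' : 0 <= 1 - v2 by have := v20; lra.
have M0 : 0 <= M.
  by rewrite /M addr_ge0// divr_ge0 ?mulr_ge0 ?subr_ge0 ?(ltW k0) ?(ltW b10) ?(ltW b20)// -subr_ge0.
pose L := 1 + M / r.
have L1 : 1 <= L by rewrite lerDl divr_ge0// ltW.
have L0 : 0 <= L by exact: le_trans L1.
have dc : {within `[0, L], continuous diff}.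
  apply: continuous_in_subspaceT => l; rewrite inE/= in_itv/= => /andP[l0 _].
  exact: diff_continuous.
have w10 l : 0 <= l -> 0 <= weight1 (af l) by move=> /af_ge/weight1_ge0.
have w20 l : 0 <= l -> 0 <= weight2 (af l) by move=> /af_le/weight2_ge0.
have [|l /andP[l0 _] dl] := sign_change_root L0 dc.
  (* At l = 0 the second equation reads k G + D = 0 and [diff] equals -2 k G. Written in the
     weights, it says (k + b1)(v1 - 1) w1 = (k + b2)(1 - v2) w2, and b1 < b2 gives G >= 0. *)
  apply/orP; left; apply/andP; split.
    have := gap_af (lexx 0); rewrite /gap oppr0 expR0 => g0.
    have e1 : k * G (af 0) + D (af 0) = 0 by rewrite -[RHS]g0; ring.
    have -> : diff 0 = - (2 * k * G (af 0)) + (k * G (af 0) + D (af 0)).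
      by rewrite /diff expR0; ring.
    rewrite e1 addr0 oppr_le0 !mulr_ge0// ?(ltW k0)// GE subr_ge0.
    move: e1; rewrite GE DE => e1.
    have x0 : 0 <= (1 - v2) * weight2 (af 0) by rewrite mulr_ge0 ?w20.
    have kb : 0 < k + b1 by exact: addr_gt0.
    rewrite -(ler_pM2l kb).
    have -> : (k + b1) * ((v1 - 1) * weight1 (af 0)) = (k + b2) * ((1 - v2) * weight2 (af 0)).
      by apply/eqP; rewrite -subr_eq0 -[X in _ == X]e1; apply/eqP; ring.
    by rewrite ler_wpM2r// lerD2l ltW.
  have a0 : 0 <= k * af L.
    by rewrite mulr_ge0 ?(ltW k0)// (le_trans _ (af_ge L0))// invr_ge0 ltW.
  have e1 := expR_ge1Dx L.
  have P0 : L - 1 <= (k * af L + L - 1) * expR L - (k * af L - 1).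
    have : 0 <= k * af L * (expR L - 1) by rewrite mulr_ge0//; lra.
    have : L - 1 <= (L - 1) * expR L by rewrite ler_peMr ?subr_ge0//; lra.
    by move: (k * af L) (expR L) => m e; lra.
  have rM : M <= r * ((k * af L + L - 1) * expR L - (k * af L - 1)).
    apply: le_trans (_ : r * (L - 1) <= _); last by rewrite ler_pM2l.
    by rewrite /L addrAC subrr add0r mulrC divfK// gt_eqF.
  rewrite subr_ge0; apply: le_trans rM; rewrite GE DE /M.
  have aw := weightD (af L); have ab := af_le L0.
  have x1 := w10 _ L0; have x2 := w20 _ L0.
  have u1 : k * (v1 - 1) * weight1 (af L) <= k * (v1 - 1) / b1.
    apply: ler_wpM2l; last by lra.
    by apply: mulr_ge0; [exact: ltW|rewrite subr_ge0].
  have u2 : b2 * (1 - v2) * weight2 (af L) <= b2 * (1 - v2) / b1.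
    apply: ler_wpM2l; last by lra.
    by apply: mulr_ge0 => //; exact: ltW.
  have u3 : 0 <= k * ((1 - v2) * weight2 (af L)).
    by apply: mulr_ge0; [exact: ltW|exact: mulr_ge0].
  have u4 : 0 <= (v1 - 1) * b1 * weight1 (af L).
    by apply: mulr_ge0 => //; apply: mulr_ge0; [rewrite subr_ge0|exact: ltW].
  by move: u1 u2 u3 u4; move: (weight1 _) (weight2 _) => ? ?; lra.
exists (af l), l; split; rewrite ?af_ge ?af_le//.
  by move/eqP: dl; rewrite subr_eq0 => /eqP <-.
by have /eqP := gap_af l0; rewrite subr_eq0 => /eqP.
Qed.

End FreeBoundaries.

(** * Derivatives of pasted functions and of sums of exponentials *)

Section Derivatives.
Context {R : realType}.
Implicit Types (f g df dg : R -> R) (x y l a : R).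

(** Free of division, this form is directly usable on either side of a pasting point and inside an
    integral. *)
Lemma is_derive1P f x l : is_derive x 1 f l <->
  forall e, 0 < e -> exists2 eta, 0 < eta &
    forall h, `|h| < eta -> `|f (x + h) - f x - l * h| <= e * `|h|.
Proof.
have rate h : h != 0 -> h^-1 *: ((f \o shift x) (h *: (1 : R)) - f x) - l =
    h^-1 * (f (x + h) - f x - l * h).
  by move=> h0; rewrite /= [h *: 1]mulr1 [h + x]addrC /GRing.scale/=; field.
split=> [[df dE] e e0|H].
  have : h^-1 *: ((f \o shift x) (h *: (1:R)) - f x) @[h --> 0^'] --> l.
    by rewrite -dE; exact: df.
  move=> /cvgrPdist_le /(_ _ e0) [eta /= eta0 H]; exists eta => // h heta.
  have [->|h0] := eqVneq h 0; first by rewrite addr0 subrr mulr0 subr0 normr0 mulr0.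
  have := H h; rewrite /= sub0r normrN => /(_ heta h0).
  rewrite distrC rate// normrM normfV mulrC ler_pdivrMr//.
  by rewrite normr_gt0.
have cl : h^-1 *: ((f \o shift x) (h *: (1:R)) - f x) @[h --> 0^'] --> l.
  apply/cvgrPdist_le => e e0; have [eta eta0 h1] := H e e0.
  exists eta => //= h; rewrite /= sub0r normrN => heta h0.
  rewrite distrC rate// normrM normfV mulrC ler_pdivrMr ?normr_gt0//.
  exact: h1.
by apply: DeriveDef; [exact: cvgP cl|exact: cvg_lim cl].
Qed.

Lemma is_derive_continuous f df : (forall x, is_derive x 1 f (df x)) -> continuous f.
Proof. by move=> fd x; apply/differentiable_continuous/derivable1_diffP; exact: ex_derive. Qed.

Lemma mean_value f df x y : (forall z : R, is_derive z 1 f (df z)) -> x <= y ->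
  exists2 z, x <= z <= y & f y - f x = df z * (y - x).
Proof.
move=> fd xy; have [z] := MVT_segment xy (fun z _ => fd z)
  (continuous_subspaceT (is_derive_continuous fd)).
by rewrite in_itv/=; exists z.
Qed.

Lemma derive_ge0_le f df x y : (forall z : R, is_derive z 1 f (df z)) -> x <= y ->
  (forall z, x <= z <= y -> 0 <= df z) -> f x <= f y.
Proof.
move=> fd xy d0; have [z zxy E] := mean_value fd xy.
by rewrite -subr_ge0 E mulr_ge0 ?d0 ?subr_ge0.
Qed.

Lemma derive_bounded_lipschitz f df K x y : (forall z : R, is_derive z 1 f (df z)) ->
  (forall z, `|df z| <= K) -> `|f y - f x| <= K * `|y - x|.
Proof.
move=> fd dK; wlog xy : x y / x <= y.
  by move=> H; case: (leP x y) => [/H//|/ltW/H]; rewrite distrC [in leRHS]distrC.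
by have [z _ ->] := mean_value fd xy; rewrite normrM ler_wpM2r.
Qed.

Definition paste a f g x := if x < a then f x else g x.

Lemma is_derive_paste a f g df dg x : f a = g a -> df a = dg a ->
  (x <= a -> is_derive x 1 f (df x)) -> (a <= x -> is_derive x 1 g (dg x)) ->
  is_derive x 1 (paste a f g) (paste a df dg x).
Proof.
move=> fga dfga fd gd; apply/is_derive1P => e e0; rewrite /paste.
have [xa|ax|xa] := ltgtP x a.
- have /is_derive1P/(_ e e0)[eta eta0 H] := fd (ltW xa).
  exists (Num.min eta (a - x)); first by rewrite lt_min eta0 subr_gt0.
  move=> h; rewrite lt_min => /andP[h1 h2].
  by rewrite ifT ?H//; have := ler_norm h; lra.
- have /is_derive1P/(_ e e0)[eta eta0 H] := gd (ltW ax).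
  exists (Num.min eta (x - a)); first by rewrite lt_min eta0 subr_gt0.
  move=> h; rewrite lt_min => /andP[h1 h2].
  rewrite ifN ?H// -leNgt; have := ler_norm (- h); rewrite normrN; lra.
- have /is_derive1P/(_ e e0)[eta1 eta10 H1] : is_derive x 1 f (df x) by apply: fd; rewrite xa.
  have /is_derive1P/(_ e e0)[eta2 eta20 H2] : is_derive x 1 g (dg x) by apply: gd; rewrite xa.
  exists (Num.min eta1 eta2); first by rewrite lt_min eta10.
  move=> h; rewrite lt_min => /andP[h1 h2]; case: ifP => _; last exact: H2.
  by rewrite xa -fga -dfga -xa H1.
Qed.

Lemma continuous_paste a f g : continuous f -> continuous g -> f a = g a ->
  continuous (paste a f g).
Proof.
move=> fc gc fga x; apply/cvgrPdist_le => e e0; rewrite /paste.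
have /cvgrPdist_le/(_ e e0) Hf := fc x; have /cvgrPdist_le/(_ e e0) Hg := gc x.
have [xa|ax|xa] := ltgtP x a.
- near=> t; rewrite ifT; [by near: t|by near: t; exact: lt_nbhsl].
- near=> t; rewrite ifN; [by near: t|].
  by rewrite -leNgt; apply: ltW; near: t; exact: lt_nbhsr.
- near=> t; case: ifP => _; last by near: t.
  by rewrite xa -fga -xa; near: t.
Unshelve. all: by end_near. Qed.

(* [c0 + m x + c1 e^(k1 (x - a)) + c2 e^(k2 (x - a))] *)
Definition expsum (c0 m c1 k1 c2 k2 a x : R) :=
  c0 + m * x + c1 * expR (k1 * (x - a)) + c2 * expR (k2 * (x - a)).

Lemma is_derive_expsum c0 m c1 k1 c2 k2 a x :
  is_derive x 1 (expsum c0 m c1 k1 c2 k2 a)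
    (expsum m 0 (c1 * k1) k1 (c2 * k2) k2 a x).
Proof.
have lin (c k : R) : is_derive x 1 (fun x => c + k * x) k.
  apply/is_derive1P => e e0; exists 1 => // h _.
  by rewrite (_ : _ - _ = 0) ?normr0 ?mulr_ge0 ?(ltW e0)//; ring.
have e (c k : R) : is_derive x 1 (fun x => c * expR (k * (x - a))) (c * k * expR (k * (x - a))).
  have -> : (fun x => c * expR (k * (x - a))) = (fun x => c * expR (- (k * a) + k * x)).
    by apply/funext => y; congr (_ * expR _); ring.
  have d := lin (- (k * a)) k.
  have dc : is_derive x 1 (expR \o (fun x => - (k * a) + k * x)) (expR (k * (x - a)) * k).
    apply: DeriveDef.
      by apply/derivable1_diffP/differentiable_comp; apply/derivable1_diffP; exact: ex_derive.
    rewrite -derive1E derive1_comp//; [|exact: ex_derive..].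
    rewrite !derive1E !derive_val; congr (expR _ * _); ring.
  have := @is_deriveZ _ _ _ _ c x 1 _ dc.
  by move/is_derive_eq; apply; rewrite /GRing.scale/=; ring.
have l := lin c0 m.
have := is_deriveD (is_deriveD l (e c1 k1)) (e c2 k2).
move/is_derive_eq; apply.
by rewrite /expsum mul0r addr0.
Qed.

(** Primitives of the value serve to average it, and they are available in closed form for all its
    pieces. *)
Definition has_primitive f : Prop := exists F, forall x : R, is_derive x 1 F (f x).

Lemma expsum_primitive c0 m c1 k1 c2 k2 a : k1 != 0 -> k2 != 0 ->
  has_primitive (expsum c0 m c1 k1 c2 k2 a).
Proof.
move=> k10 k20.
exists (fun x => expsum 0 c0 (c1 / k1) k1 (c2 / k2) k2 a x + m / 2 * x ^+ 2) => x.
have q : is_derive x 1 (fun x : R => m / 2 * x ^+ 2) (m * x).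
  by apply: is_derive_eq; rewrite /GRing.scale/=; field.
have := is_deriveD (is_derive_expsum 0 c0 (c1 / k1) k1 (c2 / k2) k2 a x) q.
by move/is_derive_eq; apply; rewrite /expsum mulfVK// mulfVK//; ring.
Qed.

Lemma paste_primitive a f g : f a = g a -> has_primitive f -> has_primitive g ->
  has_primitive (paste a f g).
Proof.
move=> fga [F dF] [G dG]; exists (paste a F (fun x => G x + (F a - G a))) => x.
apply: is_derive_paste => // [|_]; first by ring.
have := is_deriveD (dG x) (is_derive_cst (F a - G a) x 1).
by move/is_derive_eq; apply; rewrite addr0.
Qed.

End Derivatives.

(** * The variational inequality of the stopping problem *)

Section ValueSolution.
Context {R : realType}.
Variables (sigma lambda : 'I_2 -> R) (rho : R).

(** The second derivative forced by (G - rho)v = 0; the equation is encoded by requiring [v1] to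
    have this derivative below the threshold. *)
Definition curvature (v : R -> 'I_2 -> R) (y : R) (i : 'I_2) : R :=
  2 / sigma i ^+ 2 * ((rho + lambda i) * v y i - lambda i * v y (rev_ord i)).

(* [v] solves the variational inequality of the stopping problem with payoff [y],
   with stopping regions [[a i, +oo[]; [v1] is its derivative. *)
Definition value_solution (v v1 : R -> 'I_2 -> R) (a : 'I_2 -> R) : Prop :=
  [/\ forall i, 0 < a i,
     forall y i, 0 <= v y i,
     forall y i, a i <= y -> [/\ v y i = y, v1 y i = 1 &
       lambda i * (v y (rev_ord i) - v y i) <= rho * v y i],
     forall (y : R) i, is_derive y 1 (v ^~ i) (v1 y i) /\ 0 <= v1 y i <= 1 &
     forall (i : 'I_2), [/\ continuous (v1 ^~ i), has_primitive (v ^~ i) &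
       forall y : R, y < a i -> is_derive y 1 (v1 ^~ i) (curvature v y i)]].

End ValueSolution.

Lemma ord2P (i : 'I_2) : i = ord0 \/ i = rev_ord ord0.
Proof. by case: i => -[|[|//]] i0; [left|right]; exact: val_inj. Qed.

(** * The explicit solution *)

Section ExplicitSolution.
Context {R : realType}.
Variables (s1 s2 l1 l2 rho b1 b2 u1 u2 k a l : R).
Let p1 := rho + l1.
Let p2 := rho + l2.
Let r := rho / p2.
Hypotheses (s10 : 0 < s1) (s20 : 0 < s2) (l10 : 0 < l1) (l20 : 0 < l2)
  (rho0 : 0 < rho) (b10 : 0 < b1) (b12 : b1 < b2) (u11 : 1 <= u1) (u20 : u2 < 0)
  (k0 : 0 < k) (kE : s2 / 2 * k ^+ 2 = p2)
  (c1 : s1 / 2 * b1 ^+ 2 - p1 + l1 * u1 = 0 /\ (s2 / 2 * b1 ^+ 2 - p2) * u1 + l2 = 0)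
  (c2 : s1 / 2 * b2 ^+ 2 - p1 + l1 * u2 = 0 /\ (s2 / 2 * b2 ^+ 2 - p2) * u2 + l2 = 0)
  (ab : b2^-1 <= a <= b1^-1) (l0 : 0 <= l).
Let w1 := weight1 b1 b2 a.
Let w2 := weight2 b1 b2 a.
Hypotheses (eqB : k * (u1 * w1 + u2 * w2 - a) - (u1 * b1 * w1 + u2 * b2 * w2 - 1) =
        r * ((k * a + l - 1) * expR l - (k * a - 1)))
  (eqD : k * (u1 * w1 + u2 * w2 - a) + (u1 * b1 * w1 + u2 * b2 * w2 - 1) =
        r * ((k * a + l + 1) * expR (- l) - (k * a + 1))).

Definition upper_threshold := a + l / k.
Local Notation b := upper_threshold.
(** Below [a] both regimes continue, with solutions [f1] and [f2]; between [a] and [b] only regime 2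
    does, with solution [g]. There the value in regime 1 is x, which makes (1 - r) x a particular
    solution; [C1] and [C2] are fixed by the smooth fit g b = b, g' b = 1. *)
Let C1 := r / 2 * (b + k^-1).
Let C2 := r / 2 * (b - k^-1).

Let f1 := expsum 0 0 w1 b1 w2 b2 a.
Let df1 := expsum 0 0 (w1 * b1) b1 (w2 * b2) b2 a.
Let ddf1 := expsum 0 0 (w1 * b1 * b1) b1 (w2 * b2 * b2) b2 a.
Let f2 := expsum 0 0 (u1 * w1) b1 (u2 * w2) b2 a.
Let df2 := expsum 0 0 (u1 * w1 * b1) b1 (u2 * w2 * b2) b2 a.
Let ddf2 := expsum 0 0 (u1 * w1 * b1 * b1) b1 (u2 * w2 * b2 * b2) b2 a.
Let g := expsum 0 (1 - r) C1 k C2 (- k) b.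
Let dg := expsum (1 - r) 0 (C1 * k) k (C2 * - k) (- k) b.
Let ddg := expsum 0 0 (C1 * k * k) k (C2 * - k * - k) (- k) b.

Let p20 : 0 < p2. Proof. exact: addr_gt0. Qed.
Let r0 : 0 < r. Proof. exact: divr_gt0. Qed.
Let r1 : r < 1. Proof. by rewrite ltr_pdivrMr// mul1r ltrDl. Qed.
Let b20 : 0 < b2. Proof. exact: lt_trans b12. Qed.
Let a0 : 0 < a.
Proof. by case/andP: ab => h _; apply: lt_le_trans h; rewrite invr_gt0. Qed.
Let ableb : a <= b. Proof. by rewrite lerDl divr_ge0// ltW. Qed.
Let w10 : 0 <= w1. Proof. by case/andP: ab => h _; exact: weight1_ge0. Qed.
Let w20 : 0 <= w2. Proof. by case/andP: ab => _ h; exact: weight2_ge0. Qed.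

Let df1P (x : R) : is_derive x 1 f1 (df1 x). Proof. exact: is_derive_expsum. Qed.
Let ddf1P (x : R) : is_derive x 1 df1 (ddf1 x). Proof. exact: is_derive_expsum. Qed.
Let df2P (x : R) : is_derive x 1 f2 (df2 x). Proof. exact: is_derive_expsum. Qed.
Let ddf2P (x : R) : is_derive x 1 df2 (ddf2 x). Proof. exact: is_derive_expsum. Qed.
Let dgP (x : R) : is_derive x 1 g (dg x). Proof. exact: is_derive_expsum. Qed.
Let ddgP (x : R) : is_derive x 1 dg (ddg x). Proof. exact: is_derive_expsum. Qed.

Let ode1 x : s1 / 2 * ddf1 x = p1 * f1 x - l1 * f2 x.
Proof.
have [h1 _] := c1; have [h2 _] := c2.
have q1 : s1 / 2 * b1 ^+ 2 = p1 - l1 * u1 by move: h1; lra.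
have q2 : s1 / 2 * b2 ^+ 2 = p1 - l1 * u2 by move: h2; lra.
rewrite /ddf1 /f1 /f2 /expsum !mul0r !add0r.
rewrite [LHS](_ : _ = s1 / 2 * b1 ^+ 2 * w1 * expR (b1 * (x - a)) +
  s1 / 2 * b2 ^+ 2 * w2 * expR (b2 * (x - a))); last by ring.
by rewrite q1 q2; ring.
Qed.

Let ode2 x : s2 / 2 * ddf2 x = p2 * f2 x - l2 * f1 x.
Proof.
have [_ h1] := c1; have [_ h2] := c2.
have q1 : s2 / 2 * b1 ^+ 2 * u1 = p2 * u1 - l2 by move: h1; lra.
have q2 : s2 / 2 * b2 ^+ 2 * u2 = p2 * u2 - l2 by move: h2; lra.
rewrite /ddf2 /f1 /f2 /expsum !mul0r !add0r.
rewrite [LHS](_ : _ = s2 / 2 * b1 ^+ 2 * u1 * w1 * expR (b1 * (x - a)) +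
  s2 / 2 * b2 ^+ 2 * u2 * w2 * expR (b2 * (x - a))); last by ring.
by rewrite q1 q2; ring.
Qed.

Let odeg x : s2 / 2 * ddg x = p2 * g x - l2 * x.
Proof.
have q : (1 - r) * p2 = l2 by rewrite /r /p2; field; rewrite gt_eqF.
rewrite /ddg /g /expsum !mul0r !add0r.
rewrite [LHS](_ : _ = s2 / 2 * k ^+ 2 * (C1 * expR (k * (x - b)) + C2 * expR (- k * (x - b)))); last by ring.
by rewrite kE -q; ring.
Qed.

Let f1a : f1 a = a.
Proof.
by rewrite /f1 /expsum subrr !mulr0 expR0 !mulr1 mul0r !add0r; exact: weightD.
Qed.

Let df1a : df1 a = 1.
Proof.
rewrite /df1 /expsum subrr !mulr0 expR0 !mulr1 !mul0r !add0r.
by rewrite -[RHS](weight_slope b12 a) [w1 * _]mulrC [w2 * _]mulrC.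
Qed.

Let kab : k * (a - b) = - l.
Proof. by rewrite /upper_threshold; field; rewrite gt_eqF. Qed.

(** [eqB] and [eqD] state the fit of value and slope at [a], combined as k times the value minus,
    respectively plus, the slope. Their sum gives the value here, their difference the slope in
    [df2a]. *)
Let f2a : f2 a = g a.
Proof.
rewrite /f2 /g /expsum subrr !mulr0 expR0 !mulr1 mulNr kab opprK !add0r mul0r add0r.
have kb : k * b = k * a + l by rewrite -[in RHS](opprK l) -kab; ring.
apply: (mulfI (x := 2 * k)); first by rewrite gt_eqF// mulr_gt0.
have -> : 2 * k * ((1 - r) * a + C1 * expR (- l) + C2 * expR l) = 2 * k * a +
   r * ((k * b + 1) * expR (- l) - (k * a + 1)) + r * ((k * b - 1) * expR l - (k * a - 1)).
  by rewrite /C1 /C2; field; rewrite gt_eqF.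
by rewrite kb -eqD -eqB; ring.
Qed.

Let df2a : df2 a = dg a.
Proof.
rewrite /df2 /dg /expsum subrr !mulr0 expR0 !mulr1 mulNr kab opprK !add0r mul0r add0r.
have kb : k * b = k * a + l by rewrite -[in RHS](opprK l) -kab; ring.
apply: (mulfI (x := 2)); first by rewrite gt_eqF.
have -> : 2 * (1 - r + 0 + C1 * k * expR (- l) + C2 * - k * expR l) = 2 +
   r * ((k * b + 1) * expR (- l) - (k * a + 1)) - r * ((k * b - 1) * expR l - (k * a - 1)).
  by rewrite /C1 /C2; field; rewrite gt_eqF.
by rewrite kb -eqD -eqB; ring.
Qed.

(** Both pieces solve the regime 2 equation, and the regime 1 value entering it is a on either side;
    so the second derivatives agree as soon as the values do. *)
Let ddf2a : ddf2 a = ddg a.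
Proof.
apply: (mulfI (x := s2 / 2)); first by rewrite gt_eqF// divr_gt0.
by rewrite ode2 odeg f1a f2a.
Qed.

Let gb : g b = b.
Proof. by rewrite /g /expsum subrr !mulr0 expR0 /C1 /C2; field; rewrite gt_eqF. Qed.

Let dgb : dg b = 1.
Proof. by rewrite /dg /expsum subrr !mulr0 expR0 /C1 /C2; field; rewrite gt_eqF. Qed.

(* With [u = k (b - x) <= k b], [ddg x] is [r k / 2] times
   [(k b + 1) e^-u + (k b - 1) e^u], which is increasing in [k b] and nonnegative
   for [k b = u]. *)
Let ddg_ge0 x : a <= x <= b -> 0 <= ddg x.
Proof.
move=> /andP[ax xb]; pose u := k * (b - x).
have u0 : 0 <= u by apply: mulr_ge0; [exact: ltW|rewrite subr_ge0].
have x0 : 0 < x by exact: lt_le_trans ax.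
have ukb : u <= k * b by rewrite ler_pM2l// gerDl oppr_le0 ltW.
have -> : ddg x = r * k / 2 * ((k * b + 1) * expR (- u) + (k * b - 1) * expR u).
  rewrite /ddg /expsum (_ : k * (x - b) = - u); last by rewrite /u; ring.
  rewrite (_ : - k * (x - b) = u); last by rewrite /u; ring.
  by rewrite /C1 /C2; field; rewrite gt_eqF.
apply: mulr_ge0; first by exact: divr_ge0 (mulr_ge0 (ltW r0) (ltW k0)) _.
pose m (z : R) := (z + 1) * expR (- z) + (z - 1) * expR z.
have dm (z : R) : is_derive z 1 m (z * (expR z - expR (- z))).
  apply: is_derive_eq; rewrite /GRing.scale/=; ring.
have m0 : m 0 = 0 by rewrite /m oppr0 expR0; ring.
have : m 0 <= m u.
  apply: (derive_ge0_le dm) => // z /andP[z0 _].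
  by rewrite mulr_ge0// subr_ge0 ler_expR; have := z0; lra.
rewrite m0 /m; move: (expR_gt0 u) (expR_gt0 (- u)) => e1 e2 h.
have : 0 <= (k * b - u) * (expR u + expR (- u)).
  by rewrite mulr_ge0 ?subr_ge0 ?addr_ge0 ?(ltW e1) ?(ltW e2).
by lra.
Qed.

Let dg_mono x y : a <= x -> x <= y -> y <= b -> dg x <= dg y.
Proof.
move=> ax xy yb; apply: (derive_ge0_le ddgP xy) => z /andP[xz zy].
by apply: ddg_ge0; rewrite (le_trans ax xz) (le_trans zy yb).
Qed.

Let g_ge x : a <= x <= b -> x <= g x.
Proof.
move=> /andP[ax xb]; have hd (z : R) : is_derive z 1 (fun y => y - g y) (1 - dg z).
  by have := is_deriveB (is_derive_id z 1) (dgP z).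
have : x - g x <= b - g b.
  apply: (derive_ge0_le hd xb) => z /andP[xz zb].
  by rewrite subr_ge0 -dgb dg_mono// (le_trans ax xz).
by rewrite gb subrr subr_le0.
Qed.

Let ddf2a_ge0 : u2 * w2 * b2 * b2 + u1 * w1 * b1 * b1 >= 0.
Proof.
have := odeg a; rewrite -ddf2a /ddf2 /expsum subrr !mulr0 expR0 !mulr1 !mul0r !add0r => h.
have ga : a <= g a by apply: g_ge; rewrite lexx.
have h1 : l2 * a <= p2 * g a.
  by apply: ler_pM => //; rewrite ?(ltW l20) ?(ltW a0)// lerDr ltW.
have h2 : 0 <= s2 / 2 * (u1 * w1 * b1 * b1 + u2 * w2 * b2 * b2) by rewrite h subr_ge0.
by rewrite addrC -(pmulr_rge0 _ (_ : 0 < s2 / 2))// divr_gt0.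
Qed.

(* The negative term of [f2] has the larger exponent, so each of [f2], [df2] and
   [ddf2] has the sign of its value at [a] on the left of [a]. *)
Let f2_signs x : x <= a -> [/\ 0 <= f2 x, 0 <= df2 x & 0 <= ddf2 x].
Proof.
move=> xa; rewrite /f2 /df2 /ddf2 /expsum !mul0r !add0r.
have e12 : expR (b2 * (x - a)) <= expR (b1 * (x - a)).
  by rewrite ler_expR ler_wnM2r ?subr_le0// ltW.
have e2 := expR_gt0 (b2 * (x - a)).
have al : 0 <= u1 * w1 by rewrite mulr_ge0// (le_trans _ u11).
have be : 0 <= - (u2 * w2) by rewrite -mulNr mulr_ge0// oppr_ge0 ltW.
have q2 : - (u2 * w2) * b2 * b2 <= u1 * w1 * b1 * b1 by have := ddf2a_ge0; lra.
have bb : 0 <= - (u2 * w2) * b2 by rewrite mulr_ge0// ltW.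
have q1 : - (u2 * w2) * b2 <= u1 * w1 * b1.
  rewrite -(ler_pM2r b10); apply: le_trans q2.
  by rewrite ler_wpM2l// ltW.
have q0 : - (u2 * w2) <= u1 * w1.
  rewrite -(ler_pM2r b10); apply: le_trans q1.
  by rewrite ler_wpM2l// ltW.
have gen p q : 0 <= p -> - q <= p ->
    0 <= p * expR (b1 * (x - a)) + q * expR (b2 * (x - a)).
  move=> p0 qp; have : p * expR (b2 * (x - a)) <= p * expR (b1 * (x - a)) by rewrite ler_wpM2l.
  have : - q * expR (b2 * (x - a)) <= p * expR (b2 * (x - a)) by rewrite ler_pM2r.
  by move: (expR _) (expR _) => ? ?; lra.
have p1' : 0 <= u1 * w1 * b1 by rewrite mulr_ge0// ltW.
have p1'' : 0 <= u1 * w1 * b1 * b1 by rewrite mulr_ge0// ltW.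
have q1' : - (u2 * w2 * b2) <= u1 * w1 * b1 by move: q1; rewrite !mulNr.
have q2' : - (u2 * w2 * b2 * b2) <= u1 * w1 * b1 * b1 by move: q2; rewrite !mulNr.
by split; exact: gen.
Qed.

Let f1_signs x : x <= a -> 0 <= f1 x /\ 0 <= df1 x <= 1.
Proof.
move=> xa.
have e b' : 0 < b' -> 0 <= expR (b' * (x - a)) <= 1.
  by move=> b'0; rewrite expR_ge0 expR_le1 pmulr_rle0// subr_le0.
have /andP[e1 e1'] := e _ b10; have /andP[e2 e2'] := e _ b20.
have x1 : 0 <= w1 * b1 by rewrite mulr_ge0// ltW.
have x2 : 0 <= w2 * b2 by rewrite mulr_ge0// ltW.
have sl : w1 * b1 + w2 * b2 = 1.
  by rewrite -[RHS](weight_slope b12 a) [w1 * _]mulrC [w2 * _]mulrC.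
rewrite /f1 /df1 /expsum !mul0r !add0r; split.
  by apply: addr_ge0; exact: mulr_ge0.
apply/andP; split; first by apply: addr_ge0; exact: mulr_ge0.
by rewrite -sl; apply: lerD; rewrite ler_piMr.
Qed.

Let df2_le1 x : x <= a -> df2 x <= 1.
Proof.
move=> xa; apply: (@le_trans _ _ (df2 a)).
  by apply: (derive_ge0_le ddf2P xa) => z /andP[_ za]; have [] := f2_signs za.
by rewrite df2a -dgb dg_mono.
Qed.

Let v (y : R) (i : 'I_2) := if i == ord0 then paste a f1 id y else paste a f2 (paste b g id) y.
Let v1 (y : R) (i : 'I_2) := if i == ord0 then paste a df1 (fun=> 1) y
  else paste a df2 (paste b dg (fun=> 1)) y.
Let th (i : 'I_2) := if i == ord0 then a else b.

Let paste_gt (f h : R -> R) c y : c <= y -> paste c f h y = h y.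
Proof. by move=> cy; rewrite /paste ltNge cy. Qed.
Let paste_lt (f h : R -> R) c y : y < c -> paste c f h y = f y.
Proof. by rewrite /paste => ->. Qed.

Let right_ge y : y <= paste b g id y \/ y < a.
Proof.
have [ya|ay] := ltP y a; [by right|left; rewrite /paste; case: ltP => // /ltW yb].
by apply: g_ge; rewrite ay.
Qed.

Let right_a : f2 a = paste b g id a.
Proof.
rewrite f2a /paste; have [//|ba] := ltP a b.
by have -> : a = b by apply/eqP; rewrite eq_le ableb ba.
Qed.

Let dright_a : df2 a = paste b dg (fun=> 1) a.
Proof.
rewrite df2a /paste; have [//|ba] := ltP a b.
by have -> : a = b by apply/eqP; rewrite eq_le ableb ba.
Qed.

Let ord_maxE : (rev_ord ord0 == ord0 :> 'I_2) = false.
Proof. by []. Qed.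

Let v_derive (y : R) i : is_derive y 1 (v ^~ i) (v1 y i).
Proof.
have id1 (z : R) : is_derive z 1 (id : R -> R) ((fun=> 1) z : R) by exact: is_derive_id.
rewrite /v /v1; case: (i == ord0).
  by apply: is_derive_paste => // _; exact: df1P.
apply: (is_derive_paste right_a dright_a) => _; first exact: df2P.
apply: (@is_derive_paste _ b g id dg (fun=> 1)) => // _; exact: dgP.
Qed.

Let v1_bounds y i : 0 <= v1 y i <= 1.
Proof.
have a1 : 0 <= df2 a by have [_ + _] := f2_signs (lexx a).
rewrite /v1; case: ifP => _; rewrite /paste; case: ltP => [/ltW ya|ay].
- by have [] := f1_signs ya.
- by rewrite ler01 lexx.
- by have [_ -> _] := f2_signs ya; rewrite df2_le1.
case: ltP => [/ltW yb|_]; last by rewrite ler01 lexx.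
by rewrite (le_trans a1) ?df2a ?dg_mono//= -dgb dg_mono.
Qed.

Let v_ge0 y i : 0 <= v y i.
Proof.
rewrite /v; case: ifP => _; rewrite {1}/paste; case: ltP => [/ltW ya|ay].
- by have [] := f1_signs ya.
- by rewrite (le_trans (ltW a0)).
- by have [] := f2_signs ya.
- by have [/(le_trans _)->//|] := right_ge y; rewrite ?ltNge ?ay// (le_trans (ltW a0)).
Qed.

Let v1_continuous i : continuous (v1 ^~ i).
Proof.
have c1c : continuous (fun _ : R => 1 : R) by exact: cst_continuous.
rewrite /v1; case: (i == ord0).
  by apply: continuous_paste => //; exact: is_derive_continuous ddf1P.
apply: (continuous_paste _ _ dright_a); first exact: is_derive_continuous ddf2P.
by apply: continuous_paste => //; exact: is_derive_continuous ddgP.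
Qed.

Let v_primitive i : has_primitive (v ^~ i).
Proof.
have n1 : b1 != 0 by rewrite gt_eqF.
have n2 : b2 != 0 by rewrite gt_eqF.
have nk : k != 0 by rewrite gt_eqF.
have idp : has_primitive (id : R -> R).
  have -> : (id : R -> R) = expsum 0 1 0 1 0 1 0.
    by apply/funext => x; rewrite /expsum; ring.
  by apply: expsum_primitive; rewrite oner_eq0.
rewrite /v; case: (i == ord0); first by apply: paste_primitive => //; exact: expsum_primitive.
apply: (paste_primitive right_a); first exact: expsum_primitive.
by apply: paste_primitive => //; apply: expsum_primitive; rewrite ?oppr_eq0.
Qed.

Lemma explicit_solution (sigma lambda : 'I_2 -> R) :
  sigma ord0 ^+ 2 = s1 -> sigma (rev_ord ord0) ^+ 2 = s2 ->
  lambda ord0 = l1 -> lambda (rev_ord ord0) = l2 ->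
  value_solution sigma lambda rho v v1 th.
Proof.
move=> sE1 sE2 lE1 lE2; split => //.
- by move=> i; rewrite /th; case: ifP => _ //; exact: lt_le_trans ableb.
- move=> y i; have [->|->] := ord2P i; rewrite /th /v /v1 ?rev_ordK ?ord_maxE ?eqxx => hy.
    rewrite !(paste_gt _ _ hy); split => //.
    (* Above [a] the gap between the two values is nonincreasing, its slope being v1 - 1 <= 0, so it
       is largest at [a]. There the equation of [f1] and f1'' >= 0 bound it by rho a / l1. *)
    rewrite lE1; have h1 : paste b g id y - y <= g a - a.
      have hd (z : R) : is_derive z 1 (fun z => z - v z (rev_ord ord0)) (1 - v1 z (rev_ord ord0)).
        by have := is_deriveB (is_derive_id z 1) (v_derive z (rev_ord ord0)).
      have : a - v a (rev_ord ord0) <= y - v y (rev_ord ord0).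
        apply: (derive_ge0_le hd hy) => z _; rewrite subr_ge0.
        by have /andP[] := v1_bounds z (rev_ord ord0).
      by rewrite /v ord_maxE (paste_gt _ _ (lexx a)) (paste_gt _ _ hy) -right_a f2a; lra.
    have : l1 * (g a - a) <= rho * a.
      have := ode1 a; rewrite f1a f2a => h.
      have : 0 <= s1 / 2 * ddf1 a.
        rewrite mulr_ge0 ?divr_ge0 ?(ltW s10)// /ddf1 /expsum subrr !mulr0 expR0 !mulr1 mul0r !add0r.
        have q1 := ltW b10; have q2 := ltW b20.
        by apply: addr_ge0; apply: mulr_ge0 => //; apply: mulr_ge0.
      by rewrite h /p1; lra.
    have : l1 * (paste b g id y - y) <= l1 * (g a - a) by rewrite ler_pM2l.
    have : rho * a <= rho * y by rewrite ler_pM2l.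
    by lra.
  have ay := le_trans ableb hy.
  rewrite !(paste_gt _ _ ay) !(paste_gt _ _ hy) subrr mulr0; split => //.
  by rewrite mulr_ge0 ?(ltW rho0)// (le_trans _ ay)// ltW.
- move=> i; split => // y; have [->|->] := ord2P i; rewrite /th /v1 /curvature ?rev_ordK ?ord_maxE ?eqxx => hy.
    rewrite sE1 lE1 /v eqxx ord_maxE !(paste_lt _ _ hy).
    have -> : 2 / s1 * ((rho + l1) * f1 y - l1 * f2 y) = ddf1 y.
      by rewrite -ode1; field; rewrite gt_eqF.
    apply: near_eq_is_derive (ddf1P y); near=> z; rewrite paste_lt//.
    near: z; exact: lt_nbhsl.
  rewrite sE2 lE2 /v eqxx ord_maxE.
  (* The regime 1 threshold lies inside the continuation region of regime 2, where v must be twice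
     differentiable; [ddf2a] provides this. *)
  have gl : is_derive y 1 (paste a df2 dg) (paste a ddf2 ddg y).
    by apply: (is_derive_paste df2a ddf2a) => _; [exact: ddf2P|exact: ddgP].
  have -> : 2 / s2 * ((rho + l2) * paste a f2 (paste b g id) y - l2 * paste a f1 id y) =
      paste a ddf2 ddg y.
    rewrite /paste hy; case: ltP => ya.
      by rewrite -/p2 -ode2; field; rewrite gt_eqF.
    by rewrite -/p2 -odeg; field; rewrite gt_eqF.
  apply: near_eq_is_derive gl; near=> z.
  rewrite /paste; case: ltP => // _; rewrite ifT//.
  near: z; exact: lt_nbhsl.
Unshelve. all: by end_near. Qed.

End ExplicitSolution.

Theorem value_solution_exists {R : realType} (sigma lambda : 'I_2 -> R) (rho : R) :
  (forall i, 0 < lambda i) -> 0 < sigma ord0 -> sigma ord0 <= sigma ord_max ->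
  0 < rho -> exists v v1 a, value_solution sigma lambda rho v v1 a.
Proof.
have mE : ord_max = rev_ord (@ord0 1) by exact: val_inj.
rewrite mE => l0 s0 s01 r0.
have s12 : sigma ord0 ^+ 2 <= sigma (rev_ord ord0) ^+ 2.
  by apply: lerXn2r => //; rewrite nnegrE ltW//; exact: lt_le_trans s01.
have s10 : 0 < sigma ord0 ^+ 2 by rewrite exprn_gt0.
have s20 : 0 < sigma (rev_ord ord0) ^+ 2 by exact: lt_le_trans s12.
have [b1 [b2 [u1 [u2 [/andP[b10 b12] u11 u20 c1 c2]]]]] :=
  characteristic_exponents s10 s12 (l0 ord0) (l0 (rev_ord ord0)) r0.
set s2 := sigma (rev_ord ord0) ^+ 2 in s20 *; set p2 := rho + lambda (rev_ord ord0).
have p20 : 0 < p2 by rewrite addr_gt0.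
(* The exponent of the homogeneous equation of regime 2 when regime 1 is stopped. *)
pose k := Num.sqrt (2 * p2 / s2).
have q0 : 0 < 2 * p2 / s2 by apply: divr_gt0 => //; exact: mulr_gt0.
have k0 : 0 < k by rewrite sqrtr_gt0.
have kE : s2 / 2 * k ^+ 2 = p2.
  by rewrite (sqr_sqrtr (ltW q0)); field; rewrite gt_eqF.
have r01 : 0 < rho / p2 < 1 by rewrite divr_gt0//= ltr_pdivrMr// mul1r ltrDl.
have [a [l [ab l00 eqB eqD]]] := free_boundaries b10 b12 u11 u20 k0 r01.
do 3 eexists; exact: (explicit_solution s10 s20 (l0 ord0) (l0 (rev_ord ord0)) r0
  b10 b12 u11 u20 k0 kE c1 c2 ab l00 eqB eqD).
Qed.

(** * Taylor estimates and difference quotients *)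

Section Taylor.
Context {R : realType}.
Implicit Types (f df ddf : R -> R) (x y e K delta : R).

Lemma mean_value_shift f df x e : (forall z : R, is_derive z 1 f (df z)) ->
  exists2 z, `|z - x| <= `|e| & f (x + e) - f x = df z * e.
Proof.
move=> fd; have [e0|e0] := leP 0 e.
  have [|z /andP[h1 h2] E] := mean_value fd (_ : x <= x + e); first by rewrite lerDl.
  exists z; last by rewrite E; congr (_ * _); ring.
  by rewrite !ger0_norm ?subr_ge0//; lra.
have [|z /andP[h1 h2] E] := mean_value fd (_ : x + e <= x); first by rewrite gerDl ltW.
exists z; last by rewrite -opprB E; ring.
by rewrite (ltr0_norm e0) ler0_norm ?subr_le0//; lra.
Qed.

Lemma taylor1 f df x e K : (forall z : R, is_derive z 1 f (df z)) ->
  (forall y e, `|df (y + e) - df y| <= K * `|e|) ->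
  `|f (x + e) - f x - df x * e| <= K * e ^+ 2.
Proof.
move=> fd lip; have [z zx E] := mean_value_shift x e fd.
rewrite E -mulrBl normrM -[in leRHS]real_normK ?num_real// expr2 mulrA ler_wpM2r//.
have K0 : 0 <= K by have := lip 0 1; rewrite normr1 mulr1; exact: le_trans.
have := lip x (z - x); rewrite subrKC => /le_trans; apply.
exact: ler_wpM2l.
Qed.

(** The second-order remainder has as derivative the first-order remainder of [df], to which
    [taylor1] applies. *)
Lemma taylor2 f df ddf x e K : (forall z : R, is_derive z 1 f (df z)) ->
  (forall z : R, is_derive z 1 df (ddf z)) ->
  (forall y e, `|ddf (y + e) - ddf y| <= K * `|e|) ->
  `|f (x + e) - f x - df x * e - ddf x / 2 * e ^+ 2| <= K * `|e| ^+ 3.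
Proof.
move=> fd dfd lip.
pose g s := f (x + s) - f x - df x * s - ddf x / 2 * s ^+ 2.
pose dg s := df (x + s) - df x - ddf x * s.
have shift (s : R) : is_derive s 1 (fun s => f (x + s)) (df (x + s)).
  apply/is_derive1P => eps eps0; have /is_derive1P/(_ _ eps0)[eta eta0 H] := fd (x + s).
  by exists eta => // h hh; rewrite addrA; exact: H.
have gd (s : R) : is_derive s 1 g (dg s).
  by apply: is_derive_eq; rewrite /dg /GRing.scale/=; field.
have [z] := mean_value_shift 0 e gd; rewrite subr0 add0r => ze.
have -> : g 0 = 0 by rewrite /g addr0; ring.
rewrite subr0 -/(g e) => ->; rewrite normrM exprSr mulrA ler_wpM2r//.
apply: (le_trans (taylor1 _ _ dfd lip)).
have K0 : 0 <= K by have := lip 0 1; rewrite normr1 mulr1; exact: le_trans.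
by rewrite ler_wpM2l// -[z ^+ 2]real_normK ?num_real// lerXn2r.
Qed.

(** Applied to a primitive, this is the average over [y - delta, y]. The window lies to the left so
    that a point below the threshold averages points below it only. *)
Definition diff_quotient delta f y := (f y - f (y - delta)) / delta.

Lemma is_derive_diff_quotient f df delta x : (forall z : R, is_derive z 1 f (df z)) ->
  is_derive x 1 (diff_quotient delta f) (diff_quotient delta df x).
Proof.
move=> fd; have shift : is_derive x 1 (fun s => f (s - delta)) (df (x - delta)).
  apply/is_derive1P => eps eps0; have /is_derive1P/(_ _ eps0)[eta eta0 H] := fd (x - delta).
  by exists eta => // h hh; rewrite (addrAC x h); exact: H.
have := is_deriveM (is_deriveB (fd x) shift) (is_derive_cst delta^-1 x 1).
move/is_derive_eq; apply.
by rewrite /diff_quotient /GRing.scale/=; ring.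
Qed.

End Taylor.

(** * Bounds on the value and its smooth approximations *)

Section Smoothing.
Context {R : realType}.
Variables (sigma lambda : 'I_2 -> R) (rho : R) (v v1 : R -> 'I_2 -> R) (a : 'I_2 -> R).
Hypotheses (lambda_gt0 : forall i, 0 < lambda i) (sigma_gt0 : forall i, 0 < sigma i)
  (rho_gt0 : 0 < rho) (sol : value_solution sigma lambda rho v v1 a).

(** Bounds both thresholds, hence the value below them: v is nondecreasing and equals a_i at a_i. *)
Definition value_bound : R := a ord0 + a ord_max.
Local Notation B := value_bound.

Let a_gt0 i : 0 < a i. Proof. by have [] := sol. Qed.
Let vd (y : R) i : is_derive y 1 (v ^~ i) (v1 y i).
Proof. by have [_ _ _ /(_ y i)[]] := sol. Qed.
Let v1_01 y i : 0 <= v1 y i <= 1.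
Proof. by have [_ _ _ /(_ y i)[]] := sol. Qed.
Let v_stop y i : a i <= y -> v y i = y.
Proof. by move=> ay; have [_ _ /(_ _ _ ay)[]] := sol. Qed.

Lemma value_ge0 y i : 0 <= v y i.
Proof. by have [] := sol. Qed.

Lemma threshold_le i : a i <= B.
Proof.
have mE : ord_max = rev_ord (@ord0 1) by exact: val_inj.
by have [->|->] := ord2P i; rewrite /B mE ?lerDl ?lerDr ltW.
Qed.

Lemma value_bound_ge0 : 0 <= B.
Proof. by apply: le_trans (threshold_le ord0); exact: ltW. Qed.

Lemma value_mono i : {homo v ^~ i : y z / y <= z}.
Proof.
move=> y z yz; apply: (derive_ge0_le (fun t => vd t i) yz) => t _.
by case/andP: (v1_01 t i).
Qed.

Lemma value_ge y i : y <= v y i.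
Proof.
have [ay|/ltW ya] := leP (a i) y; first by rewrite v_stop.
have hd (z : R) : is_derive z 1 (fun z => z - v z i) (1 - v1 z i).
  by have := is_deriveB (is_derive_id z 1) (vd z i).
have : y - v y i <= a i - v (a i) i.
  by apply: (derive_ge0_le hd ya) => z _; rewrite subr_ge0; case/andP: (v1_01 z i).
by rewrite (v_stop (lexx (a i))) subrr subr_le0.
Qed.

Lemma value_le y i : y < a i -> v y i <= B.
Proof.
move=> /ltW ya; apply: le_trans (threshold_le i).
by rewrite -[leRHS](v_stop (lexx (a i))); exact: value_mono.
Qed.

Lemma value_le_below y i : y <= B -> v y i <= B.
Proof. by have [ay|/value_le//] := leP (a i) y; rewrite v_stop. Qed.

Lemma value_regime_gap y i : `|v y (rev_ord i) - v y i| <= B.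
Proof.
have [yB|By] := leP y B.
  have := value_ge0 y i; have := value_ge0 y (rev_ord i).
  have := value_le_below i yB; have := value_le_below (rev_ord i) yB.
  by rewrite ler_norml => ? ? ? ?; apply/andP; split; lra.
have st j : v y j = y by apply: v_stop; apply: le_trans (ltW By); exact: threshold_le.
by rewrite !st subrr normr0 value_bound_ge0.
Qed.

Lemma value_lipschitz y z i : `|v y i - v z i| <= `|y - z|.
Proof.
have h t : `|v1 t i| <= 1 by have /andP[h0 h1] := v1_01 t i; rewrite ger0_norm.
by have := derive_bounded_lipschitz z y (fun t => vd t i) h; rewrite mul1r.
Qed.

Definition curvature_bound : R := \sum_i 2 / sigma i ^+ 2 * ((rho + lambda i) * B + lambda i * B).
Local Notation L := curvature_bound.

Let curvature_term_ge0 i : 0 <= 2 / sigma i ^+ 2 * ((rho + lambda i) * B + lambda i * B).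
Proof.
have l0 := ltW (lambda_gt0 i); have r0 := ltW rho_gt0.
apply: mulr_ge0; first by apply: divr_ge0 => //; exact: sqr_ge0.
by apply: addr_ge0; apply: mulr_ge0 value_bound_ge0 => //; exact: addr_ge0.
Qed.

Lemma curvature_bound_ge0 : 0 <= L.
Proof. by apply: sumr_ge0 => i _. Qed.

Lemma curvature_le y i : y < a i -> `|curvature sigma lambda rho v y i| <= L.
Proof.
move=> ya; rewrite /L (bigD1 i)//= ; apply: ler_wpDr; first by apply: sumr_ge0 => j _.
have l0 := ltW (lambda_gt0 i); have r0 := ltW rho_gt0.
have yB : y <= B by apply: ltW; apply: lt_le_trans (threshold_le i).
have s0 : 0 <= 2 / sigma i ^+ 2 by apply: divr_ge0 => //; exact: sqr_ge0.
rewrite normrM (ger0_norm s0); apply: ler_wpM2l => //.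
apply: le_trans (ler_normB _ _) _.
rewrite !normrM (ger0_norm l0) (ger0_norm (addr_ge0 r0 l0)).
rewrite !(ger0_norm (value_ge0 _ _)); apply: lerD; apply: ler_wpM2l => //;
  by [exact: addr_ge0|exact: value_le_below].
Qed.

Let v1c i : continuous (v1 ^~ i). Proof. by have [_ _ _ _ /(_ i)[]] := sol. Qed.

Let v1_lip_le y z i : y <= z -> z <= a i -> `|v1 z i - v1 y i| <= L * `|z - y|.
Proof.
rewrite le_eqVlt => /predU1P[->|yz] za; first by rewrite !subrr normr0 mulr0.
have [t||t tyz ->] := @MVT R (v1 ^~ i) (curvature sigma lambda rho v ^~ i) y z yz.
- rewrite in_itv/= => /andP[_ tz]; have [_ _ _ _ /(_ i)[_ _]] := sol; apply.
  exact: lt_le_trans za.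
- exact: continuous_subspaceT.
rewrite normrM ler_wpM2r// curvature_le//.
by move: tyz; rewrite in_itv/= => /andP[_ tz]; exact: lt_le_trans za.
Qed.

Let v1_stop y i : a i <= y -> v1 y i = 1.
Proof. by move=> ay; have [_ _ /(_ _ _ ay)[]] := sol. Qed.

(** Below the threshold the curvature is bounded, above it the derivative is constant, and the
    derivative is continuous across it. *)
Lemma value_derive_lipschitz y z i : `|v1 y i - v1 z i| <= L * `|y - z|.
Proof.
wlog yz : y z / y <= z.
  by move=> H; case: (leP y z) => [/H//|/ltW/H]; rewrite distrC [in leRHS]distrC.
rewrite distrC [in leRHS]distrC.
have [za|/ltW az] := leP z (a i); first exact: v1_lip_le.
have [/ltW ya|ay] := ltP y (a i).
  rewrite v1_stop// -(v1_stop (lexx (a i))); apply: le_trans (v1_lip_le ya _) _ => //.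
  apply: ler_wpM2l; first exact: curvature_bound_ge0.
  by rewrite !ger0_norm ?subr_ge0// lerD2r.
by rewrite !v1_stop// subrr normr0 mulr_ge0// curvature_bound_ge0.
Qed.

Section Average.
Variable V : R -> 'I_2 -> R.
Hypothesis Vd : forall (y : R) i, is_derive y 1 (V ^~ i) (v y i).

(** An antiderivative of (G - rho)v away from the threshold: constant below it, nonincreasing above
    it, and continuous across it because only the first derivative of v occurs. *)
Let energy i z := sigma i ^+ 2 / 2 * v1 z i + lambda i * (V z (rev_ord i) - V z i) - rho * V z i.
Let denergy i z := lambda i * (v z (rev_ord i) - v z i) - rho * v z i.

Let linear_part i (z : R) : is_derive z 1
  (fun z => lambda i * (V z (rev_ord i) - V z i) - rho * V z i) (denergy i z).
Proof.
have := is_deriveB (is_deriveZ (lambda i) (is_deriveB (Vd z (rev_ord i)) (Vd z i)))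
  (is_deriveZ rho (Vd z i)).
by [].
Qed.

Let energy_derive i t : t < a i -> is_derive t 1 (energy i) 0.
Proof.
move=> ta; have [_ _ _ _ /(_ i)[_ _ /(_ t ta) h]] := sol.
have e0 : sigma i ^+ 2 / 2 *: curvature sigma lambda rho v t i + denergy i t = 0.
  by rewrite /denergy /curvature /GRing.scale/=; field; rewrite gt_eqF.
have := is_derive_eq (is_deriveD (is_deriveZ (sigma i ^+ 2 / 2) h) (linear_part i t)) e0.
by congr (is_derive _ _ _ _); apply/funext => z; rewrite /energy /= /GRing.scale/= addrA.
Qed.

Let V_continuous i : continuous (V ^~ i).
Proof. by apply: (is_derive_continuous (df := v ^~ i)) => y. Qed.

Let energy_continuous i : continuous (energy i).
Proof.
move=> z; apply: cvgB.
  apply: cvgD; apply: cvgM; try exact: cvg_cst; first exact: v1c.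
  by apply: cvgB; exact: V_continuous.
by apply: cvgM; [exact: cvg_cst|exact: V_continuous].
Qed.

Let energy_const i y z : y <= z -> z <= a i -> energy i y = energy i z.
Proof.
rewrite le_eqVlt => /predU1P[->//|yz] za.
have [t||t tyz E] := @MVT R (energy i) (fun=> 0) y z yz.
- by rewrite in_itv/= => /andP[_ tz]; apply: energy_derive; exact: lt_le_trans za.
- by apply: continuous_subspaceT => t; exact: energy_continuous.
by apply/eqP; rewrite eq_sym -subr_eq0 E mul0r.
Qed.

Let energy_le_stop i y z : a i <= y -> y <= z -> energy i z <= energy i y.
Proof.
move=> ay yz; rewrite /energy !v1_stop ?(le_trans ay yz)// -!addrA lerD2l.
have hd (t : R) : is_derive t 1 (fun z => - (lambda i * (V z (rev_ord i) - V z i) - rho * V z i))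
  (- denergy i t) by exact: is_deriveN (linear_part i t).
rewrite -lerN2; apply: (derive_ge0_le hd yz) => t /andP[yt _].
rewrite oppr_ge0 subr_le0.
by have [_ _ /(_ _ _ (le_trans ay yt))[]] := sol.
Qed.

Let energy_le i y z : y <= z -> energy i z <= energy i y.
Proof.
move=> yz; have [za|/ltW az] := leP z (a i); first by rewrite (energy_const yz za).
have [/ltW ya|ay] := ltP y (a i); last exact: energy_le_stop.
by rewrite (energy_const ya (lexx _)); exact: energy_le_stop.
Qed.

Variable delta : R.
Hypothesis delta01 : 0 < delta <= 1.
Let delta0 : 0 < delta. Proof. by case/andP: delta01. Qed.

Let phi y i := diff_quotient delta (V ^~ i) y.
Let phi1 y i := diff_quotient delta (v ^~ i) y.
Let phi2 y i := diff_quotient delta (v1 ^~ i) y.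

Let phid (y : R) i : is_derive y 1 (phi ^~ i) (phi1 y i).
Proof. by apply: is_derive_diff_quotient => z. Qed.
Let phi1d (y : R) i : is_derive y 1 (phi1 ^~ i) (phi2 y i).
Proof. by apply: is_derive_diff_quotient => z. Qed.

Let K := 1 + L + B + 2 * L / delta.
Let L0 := curvature_bound_ge0.
Let B0 := value_bound_ge0.
Let Ld0 : 0 <= 2 * L / delta.
Proof. by rewrite divr_ge0 ?mulr_ge0// ltW. Qed.

Let K_ge : [/\ 1 <= K, L <= K, B <= K & 2 * L / delta <= K].
Proof.
by rewrite /K; move: L B (2 * L / delta) L0 B0 Ld0 => l b q ? ? ?; split; lra.
Qed.

Let phi1_le y i : `|phi1 y i| <= 1.
Proof.
rewrite /phi1 /diff_quotient normrM normfV (gtr0_norm delta0) ler_pdivrMr// mul1r.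
apply: le_trans (value_lipschitz _ _ _) _.
by rewrite subKr gtr0_norm.
Qed.

Let phi2_le y i : `|phi2 y i| <= L.
Proof.
rewrite /phi2 /diff_quotient normrM normfV (gtr0_norm delta0) ler_pdivrMr//.
apply: le_trans (value_derive_lipschitz _ _ _) _.
by rewrite subKr gtr0_norm.
Qed.

Let phi_mean y i : exists2 z, y - delta <= z <= y & phi y i = v z i.
Proof.
have [|z zz E] := mean_value (fun t => Vd t i) (_ : y - delta <= y).
  by rewrite gerDl oppr_le0 ltW.
by exists z => //; rewrite /phi /diff_quotient E subKr mulfK// gt_eqF.
Qed.

Let phi_gap y i : `|phi y (rev_ord i) - phi y i| <= B.
Proof.
have hd (t : R) : is_derive t 1 (fun z => V z (rev_ord i) - V z i) (v t (rev_ord i) - v t i).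
  exact: is_deriveB (Vd t _) (Vd t i).
have [|z _ E] := mean_value hd (_ : y - delta <= y).
  by rewrite gerDl oppr_le0 ltW.
have -> : phi y (rev_ord i) - phi y i = v z (rev_ord i) - v z i.
  rewrite /phi /diff_quotient -mulrBl.
  rewrite [X in X / _](_ : _ = V y (rev_ord i) - V y i - (V (y - delta) (rev_ord i) - V (y - delta) i)).
    by rewrite E subKr mulfK// gt_eqF.
  by ring.
exact: value_regime_gap.
Qed.

Let phi1_lip i y e : `|phi1 (y + e) i - phi1 y i| <= L * `|e|.
Proof.
have := derive_bounded_lipschitz y (y + e) (fun t => phi1d t i) (phi2_le ^~ i).
by rewrite addrAC subrr add0r.
Qed.

Let phi2_lip i y e : `|phi2 (y + e) i - phi2 y i| <= 2 * L / delta * `|e|.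
Proof.
rewrite /phi2 /diff_quotient -mulrBl normrM normfV (gtr0_norm delta0) mulrAC ler_pM2r ?invr_gt0//.
have h1 := value_derive_lipschitz (y + e) y i.
have h2 := value_derive_lipschitz (y - delta) (y + e - delta) i.
have e1 : y + e - y = e by ring.
have e2 : y - delta - (y + e - delta) = - e by ring.
rewrite e1 in h1; rewrite e2 normrN in h2.
rewrite (_ : _ - _ = (v1 (y + e) i - v1 y i) + (v1 (y - delta) i - v1 (y + e - delta) i)); last by ring.
by apply: le_trans (ler_normD _ _) _; rewrite -mulrA mulr2n mulrDl mul1r; exact: lerD.
Qed.

Let smooth : smooth_test K phi phi1 phi2.
Proof.
have cm (f : R -> R) : continuous f -> measurable_fun [set: R] f by exact: continuous_measurable_fun.
have [K1 KL KB Kd] := K_ge; split.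
- move=> i; split; apply: cm.
  + exact: (is_derive_continuous (phid ^~ i)).
  + exact: (is_derive_continuous (phi1d ^~ i)).
  + move=> y; apply: cvgM; last exact: cvg_cst.
    apply: cvgB; first exact: v1c.
    apply: (@continuous_comp _ _ _ (fun y => y - delta) (v1 ^~ i)); last exact: v1c.
    by apply: cvgB; [exact: cvg_id|exact: cvg_cst].
- move=> i y; split; [apply: le_trans K1; exact: phi1_le|
    apply: le_trans KL; exact: phi2_le|apply: le_trans KB; exact: phi_gap].
- by move=> i y e; apply: le_trans (phi1_lip i y e) _; exact: ler_wpM2r.
- move=> i y e; split.
    apply: (le_trans (taylor1 y e (phid ^~ i) (phi1_lip i))).
    by apply: ler_wpM2r => //; exact: sqr_ge0.
  have := derive_bounded_lipschitz y (y + e) (phid ^~ i) (phi1_le ^~ i).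
  by rewrite addrAC subrr add0r => /le_trans; apply; exact: ler_wpM2r.
- move=> i y e; apply: (le_trans (taylor2 y e (phid ^~ i) (phi1d ^~ i) (phi2_lip i))).
  by apply: ler_wpM2r => //; exact: exprn_ge0.
Qed.

(** (G - rho)phi is the difference quotient of [energy] over [y - delta, y]: nonpositive by
    monotonicity, and zero when the whole window lies below the threshold. Closeness holds because v
    is 1-Lipschitz. *)
Lemma average_near_solution : near_solution lambda sigma rho v a delta K phi phi1 phi2.
Proof.
have genE y i : gen_test lambda sigma phi phi2 y i - rho * phi y i =
    (energy i y - energy i (y - delta)) / delta.
  by rewrite /gen_test /phi /phi2 /diff_quotient /energy; field; rewrite gt_eqF.
have yd y : y - delta <= y by rewrite gerDl oppr_le0 ltW.
split; first exact: smooth.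
- move=> y i; rewrite -subr_le0 genE ler_pdivrMr// mul0r subr_le0.
  exact: energy_le.
- move=> y i /ltW ya; apply/eqP; rewrite -subr_eq0 genE.
  by rewrite (energy_const (yd y) ya) subrr mul0r.
- move=> y i; have [z /andP[z1 z2] ->] := phi_mean y i.
  apply: le_trans (value_lipschitz _ _ _) _.
  by rewrite ler0_norm ?subr_le0//; lra.
Qed.

End Average.

Lemma near_solution_exists delta : 0 < delta <= 1 ->
  exists K phi phi1 phi2, near_solution lambda sigma rho v a delta K phi phi1 phi2.
Proof.
move=> d01; have [_ _ _ _ c] := sol.
have [V Vd] := choice (fun i : 'I_2 => let: And3 _ p _ := c i in p).
do 4 eexists; apply: (@average_near_solution (fun y i => V i y)) d01 => y i.
exact: Vd.
Qed.

End Smoothing.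

(** * Integrals over [0, y] as functions of y *)

Section PartialIntegrals.
Context {R : realType}.
Implicit Types (g : R -> R) (y z c e M : R).
Local Notation mu := (@lebesgue_measure R).

Definition bounded_measurable g : Prop :=
  measurable_fun [set: R] g /\ exists M, forall z, `|g z| <= M.

Lemma bounded_measurableD g h : bounded_measurable g -> bounded_measurable h ->
  bounded_measurable (fun z => g z + h z).
Proof.
move=> [mg [M gM]] [mh [N hN]]; split; first exact: measurable_funD.
by exists (M + N) => z; rewrite (le_trans (ler_normD _ _))// lerD.
Qed.

Lemma bounded_measurableZ c g : bounded_measurable g ->
  bounded_measurable (fun z => c * g z).
Proof.
move=> [mg [M gM]]; split; first exact: measurable_funM.
by exists (`|c| * M) => z; rewrite normrM ler_wpM2l.
Qed.

Lemma bounded_measurableB g h : bounded_measurable g -> bounded_measurable h ->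
  bounded_measurable (fun z => g z - h z).
Proof.
move=> [mg [M gM]] [mh [N hN]]; split; first exact: measurable_funB.
by exists (M + N) => z; rewrite (le_trans (ler_normB _ _))// lerD.
Qed.

Lemma bounded_measurable_norm g : bounded_measurable g ->
  bounded_measurable (fun z => `|g z|).
Proof.
move=> [mg [M gM]]; split; first exact: measurableT_comp.
by exists M => z; rewrite normr_id.
Qed.

Lemma bounded_measurable_cst c : bounded_measurable (fun=> c).
Proof. by split=> //; exists `|c|. Qed.

Lemma bounded_measurable_indic (A : set R) : measurable A -> bounded_measurable (\1_A).
Proof.
move=> mA; split; first exact: measurable_indic.
by exists 1 => z; rewrite indicE normr_nat lern1 leq_b1.
Qed.

Lemma bounded_measurable_integrable g (b b' : bool) y z : bounded_measurable g ->
  mu.-integrable [set` Interval (BSide b y) (BSide b' z)] (EFin \o g).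
Proof.
move=> [mg [M gM]]; apply: measurable_bounded_integrable => //.
- by rewrite /= lebesgue_measure_itv/=; case: ifP => _ //; rewrite -EFinB ltry.
- exact: measurable_funTS.
exists M; split; first exact: num_real.
by move=> N MN t _ /=; apply: le_trans (gM t) (ltW MN).
Qed.

Definition partial_integral g y : R := Rintegral mu `[0, y] g.
Local Notation J := partial_integral.

Lemma partial_integralD g h y : bounded_measurable g -> bounded_measurable h ->
  J (fun z => g z + h z) y = J g y + J h y.
Proof. by move=> bg bh; apply: RintegralD => //; exact: bounded_measurable_integrable. Qed.

Lemma partial_integralB g h y : bounded_measurable g -> bounded_measurable h ->
  J (fun z => g z - h z) y = J g y - J h y.
Proof. by move=> bg bh; apply: RintegralB => //; exact: bounded_measurable_integrable. Qed.

Lemma partial_integralZ c g y : bounded_measurable g ->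
  J (fun z => c * g z) y = c * J g y.
Proof. by move=> bg; apply: RintegralZl => //; exact: bounded_measurable_integrable. Qed.

Lemma partial_integral_le g h y : bounded_measurable g -> bounded_measurable h ->
  (forall z, 0 <= z <= y -> g z <= h z) -> J g y <= J h y.
Proof.
by move=> bg bh gh; apply: le_Rintegral => //; exact: bounded_measurable_integrable.
Qed.

Lemma partial_integral_norm g y : bounded_measurable g ->
  `|J g y| <= J (fun z => `|g z|) y.
Proof. by move=> bg; apply: le_normr_Rintegral => //; exact: bounded_measurable_integrable. Qed.

Lemma itv_length (b b' : bool) y z : y <= z ->
  fine (mu [set` Interval (BSide b y) (BSide b' z)]) = z - y.
Proof.
rewrite /= lebesgue_measure_itv/= lte_fin; case: ltgtP => //= -> _.
by rewrite subrr.
Qed.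

Lemma partial_integral_cst c y : 0 <= y -> J (fun=> c) y = c * y.
Proof. by move=> y0; rewrite /J Rintegral_cst// itv_length// subr0. Qed.

Lemma partial_integral_increment g y z : bounded_measurable g -> 0 <= y -> y <= z ->
  J g z - J g y = Rintegral mu `]y, z] g.
Proof.
move=> bg y0 yz; rewrite /J Rintegral_itvB//; exact: bounded_measurable_integrable.
Qed.

Lemma partial_integral_near g c e y z : bounded_measurable g -> 0 <= y -> 0 <= z ->
  (forall t, Num.min y z <= t <= Num.max y z -> `|g t - c| <= e) ->
  `|J g z - J g y - c * (z - y)| <= e * `|z - y|.
Proof.
move=> bg; wlog yz : y z / y <= z.
  move=> H y0 z0 gc; have [yz|/ltW zy] := leP y z; first exact: H.
  rewrite -normrN [in leRHS]distrC.
  rewrite (_ : - (J g z - J g y - c * (z - y)) = J g y - J g z - c * (y - z)); last by ring.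
  by apply: H => // t; rewrite minC maxC; exact: gc.
rewrite min_l// max_r// => y0 z0 gc.
rewrite (ger0_norm (_ : 0 <= z - y)) ?subr_ge0//.
have cE d : d * (z - y) = Rintegral mu `]y, z] (fun=> d).
  by rewrite Rintegral_cst// itv_length.
have ig f : bounded_measurable f -> mu.-integrable `]y, z] (EFin \o f).
  by move=> ?; exact: bounded_measurable_integrable.
rewrite partial_integral_increment// !cE -RintegralB//; [|exact: ig|exact/ig/bounded_measurable_cst].
have bgc := bounded_measurableB bg (bounded_measurable_cst c).
apply: (le_trans (le_normr_Rintegral _ (ig _ bgc))) => //.
apply: le_Rintegral => //; [exact/ig/bounded_measurable_norm|exact/ig/bounded_measurable_cst|].
by move=> t; rewrite /= in_itv/= => /andP[yt tz]; apply: gc; rewrite ltW.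
Qed.

Lemma partial_integral_lipschitz g M y z : measurable_fun [set: R] g ->
  (forall t, `|g t| <= M) -> 0 <= y -> 0 <= z ->
  `|J g z - J g y| <= M * `|z - y|.
Proof.
move=> mg gM y0 z0; have bg : bounded_measurable g by split=> //; exists M.
have := @partial_integral_near g 0 M y z bg y0 z0.
by rewrite mul0r subr0; apply => t _; rewrite subr0.
Qed.

Lemma partial_integral_itv z0 e y : 0 <= e ->
  J (\1_`[z0 - e, z0 + e]%classic) y <= 2 * e.
Proof.
move=> e0; rewrite /J /Rintegral integral_indic//.
have h : fine (mu `[z0 - e, z0 + e]) = 2 * e.
  by rewrite itv_length; [ring|lra].
rewrite -h fine_le//.
- rewrite ge0_fin_numE//; apply: (@le_lt_trans _ _ (mu `[z0 - e, z0 + e])).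
    by apply: le_measure; rewrite ?inE//; exact: measurableI.
  by rewrite /= lebesgue_measure_itv/=; case: ifP => _ //; rewrite -EFinB ltry.
- rewrite ge0_fin_numE//.
  by rewrite /= lebesgue_measure_itv/=; case: ifP => _ //; rewrite -EFinB ltry.
- by apply: le_measure; rewrite ?inE//; exact: measurableI.
Qed.

End PartialIntegrals.

(** * Level sets of a strictly decreasing function *)

Section StrictlyDecreasing.
Context {R : realType}.
Variable T : R -> R.
Hypothesis Tc : continuous T.
Hypothesis T_decr : forall y z, 0 <= y -> y < z -> z <= 1 -> T z < T y.

(** By compactness T(y) - T(y + e) attains a minimum on [0, 1 - e], which is positive; a larger step
    only increases the drop. *)
Lemma decreasing_gap e : 0 < e -> exists2 m, 0 < m &
  forall y z, 0 <= y -> y + e <= z -> z <= 1 -> m <= T y - T z.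
Proof.
move=> e0; have [e1|e1] := leP e 1; last first.
  by exists 1 => // y z y0 yz z1; have : e <= 1; lra.
have c : continuous (fun y => T y - T (y + e)).
  move=> y; apply: cvgB; first exact: Tc.
  by apply: (@continuous_comp _ _ _ (fun y => y + e) T); [apply: cvgD; [exact: cvg_id|exact: cvg_cst]|exact: Tc].
have e1' : 0 <= 1 - e by rewrite subr_ge0.
have [t] := EVT_min e1' (continuous_subspaceT c).
rewrite in_itv/= => /andP[t0 t1] tmin.
exists (T t - T (t + e)); first by rewrite subr_gt0 T_decr//; lra.
move=> y z y0 yz z1; have := tmin y; rewrite in_itv/= y0 /= => /(_ _) h.
apply: le_trans (h _) _; first by lra.
rewrite lerD2l lerN2; move: yz; rewrite le_eqVlt => /predU1P[->//|yz].
by apply/ltW/T_decr => //; lra.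
Qed.

(* Uniformly in [c], the level [c] of [T] is approached only on a short interval. *)
Lemma level_itv e : 0 < e -> exists2 m, 0 < m & forall c, exists z0,
  forall z, 0 <= z <= 1 -> `|c - T z| <= m -> z0 - e <= z <= z0 + e.
Proof.
move=> e0; have [m m0 hm] := decreasing_gap e0.
exists (m / 3); first by rewrite divr_gt0.
move=> c; have [[z0 [/andP[z00 z01] cz0]]|none] :=
    pselect (exists z0, 0 <= z0 <= 1 /\ `|c - T z0| <= m / 3); last first.
  by exists 0 => z z01 cz; exfalso; apply: none; exists z.
exists z0 => z /andP[z0' z1'] cz.
move: cz cz0; rewrite !ler_norml => /andP[a1 a2] /andP[b1 b2].
apply/andP; split; rewrite leNgt; apply/negP => hlt.
- by have := hm z z0 z0' (_ : z + e <= z0) z01; lra.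
- by have := hm z0 z z00 (_ : z0 + e <= z) z1'; lra.
Qed.

End StrictlyDecreasing.

(** * Derivatives relative to [0, 1] and strict convexity *)

Section OneSidedDerivatives.
Context {R : realType}.
Implicit Types (D : set R) (g : R -> R) (y z l e : R).

Lemma quotient_on_cvgP D g y l : quotient_on D g y --> l <->
  forall e, 0 < e -> exists2 eta, 0 < eta & forall z, D z -> z != y ->
    `|z - y| < eta -> `|(g z - g y) / (z - y) - l| <= e.
Proof.
split=> [/cvgrPdist_le h e e0|h].
  have [eta /= eta0 H] := h e e0; exists eta => // z Dz zy yz.
  by rewrite distrC; apply: H => //=; rewrite distrC.
apply/cvgrPdist_le => e e0; have [eta eta0 H] := h e e0.
exists eta => //= z /= yz zy Dz; rewrite distrC; apply: H => //.
by rewrite distrC.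
Qed.

Lemma derivable_on_cvg D g y : derivable_on D g y -> quotient_on D g y --> derive_on D g y.
Proof. by []. Qed.

(** Points of [0, 1] accumulate at y from the left because y > 0; properness makes the limit in
    [derive_on] unique. *)
Lemma within_unit_proper y : 0 < y <= 1 -> ProperFilter (within `[0, 1] y^').
Proof.
move=> /andP[y0 y1]; apply: Build_ProperFilter => /= -[eta /= eta0 h].
pose z := y - Num.min (eta / 2) (y / 2).
have m0 : 0 < Num.min (eta / 2) (y / 2) by rewrite lt_min !divr_gt0.
have m1 : Num.min (eta / 2) (y / 2) <= eta / 2 by rewrite ge_min lexx.
have m2 : Num.min (eta / 2) (y / 2) <= y / 2 by rewrite ge_min lexx orbT.
apply: (h z) => /=.
- by rewrite /z subKr gtr0_norm//; lra.
- by rewrite /z lt_eqF// gtrDl oppr_lt0.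
- by rewrite in_itv/=; apply/andP; split; rewrite /z; lra.
Qed.

Lemma derive_on_eq g y l : 0 < y <= 1 -> quotient_on `[0, 1] g y --> l ->
  derivable_on `[0, 1] g y /\ derive_on `[0, 1] g y = l.
Proof.
move=> y01 gl; have F := within_unit_proper y01.
by split; [exact: cvgP gl|exact: cvg_lim gl].
Qed.

Section StrictlyConvex.
Variable f : R -> R.
Hypotheses (f_convex : strictly_convex_on `[0, 1] f)
  (f_C1 : continuously_differentiable_on `[0, 1] f).
Local Notation df := (derive_on `[0, 1] f).

Let slope y z := (f z - f y) / (z - y).

Let slope_lt y m z : 0 <= y -> y < m -> m < z -> z <= 1 ->
  slope y m < slope y z /\ slope y z < slope m z.
Proof.
move=> y0 ym mz z1; pose t := (z - m) / (z - y).
have yz : 0 < z - y by lra.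
have t01 : 0 < t < 1.
  apply/andP; split; first by rewrite divr_gt0// subr_gt0.
  by rewrite /t ltr_pdivrMr// mul1r; lra.
have mE : m = t * y + (1 - t) * z by rewrite /t; field; rewrite gt_eqF.
have Dy : (`[0, 1]%classic : set R) y by rewrite /= in_itv/=; apply/andP; split; lra.
have Dz : (`[0, 1]%classic : set R) z by rewrite /= in_itv/=; apply/andP; split; lra.
have nyz : y != z by rewrite lt_eqF//; lra.
have := f_convex Dy Dz nyz t01; rewrite -mE => fm.
have [t0 t1] := andP t01.
have my : m - y = (1 - t) * (z - y) by rewrite mE; ring.
have zm : z - m = t * (z - y) by rewrite mE; ring.
have s1 : 0 < 1 - t by lra.
rewrite /slope my zm; split.
  have tz : 0 < (1 - t) * (z - y) by exact: mulr_gt0.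
  rewrite (ltr_pdivrMr _ _ tz) mulrCA divfK ?gt_eqF//.
  by move: fm; lra.
have tz : 0 < t * (z - y) by exact: mulr_gt0.
rewrite (ltr_pdivlMr _ _ tz) mulrCA divfK ?gt_eqF//.
by move: fm; lra.
Qed.

(** Slopes of chords from y decrease as the far end approaches y. If the derivative exceeded the
    slope to m, a chord whose slope is within half the excess of the derivative would be steeper
    than that to m. *)
Let df_le_slope y m : 0 <= y -> y < m -> m <= 1 -> df y <= slope y m.
Proof.
move=> y0 ym m1; rewrite leNgt; apply/negP => lt.
have e0 : 0 < (df y - slope y m) / 2 by rewrite divr_gt0// subr_gt0.
have Dy : (`[0, 1]%classic : set R) y by rewrite /= in_itv/=; apply/andP; split; lra.
have [/(_ _ Dy)/derivable_on_cvg/quotient_on_cvgP/(_ _ e0)[eta eta0 h] _] := f_C1.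
pose z := y + Num.min (eta / 2) ((m - y) / 2).
have q0 : 0 < Num.min (eta / 2) ((m - y) / 2) by rewrite lt_min !divr_gt0// subr_gt0.
have q1 : Num.min (eta / 2) ((m - y) / 2) <= eta / 2 by rewrite ge_min lexx.
have q2 : Num.min (eta / 2) ((m - y) / 2) <= (m - y) / 2 by rewrite ge_min lexx orbT.
have zy : y < z by rewrite ltrDl.
have zm : z < m by rewrite /z; lra.
have [sl _] := slope_lt y0 zy zm m1.
have : `|slope y z - df y| <= (df y - slope y m) / 2.
  apply: h; rewrite ?gt_eqF//.
    by rewrite /= in_itv/=; apply/andP; split; lra.
  by rewrite /z addrAC subrr add0r gtr0_norm//; lra.
by rewrite ler_norml => /andP[+ _]; lra.
Qed.

Let slope_le_df m y : 0 <= m -> m < y -> y <= 1 -> slope m y <= df y.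
Proof.
move=> m0 my y1; rewrite leNgt; apply/negP => lt.
have e0 : 0 < (slope m y - df y) / 2 by rewrite divr_gt0// subr_gt0.
have Dy : (`[0, 1]%classic : set R) y by rewrite /= in_itv/=; apply/andP; split; lra.
have [/(_ _ Dy)/derivable_on_cvg/quotient_on_cvgP/(_ _ e0)[eta eta0 h] _] := f_C1.
pose z := y - Num.min (eta / 2) ((y - m) / 2).
have q0 : 0 < Num.min (eta / 2) ((y - m) / 2) by rewrite lt_min !divr_gt0// subr_gt0.
have q1 : Num.min (eta / 2) ((y - m) / 2) <= eta / 2 by rewrite ge_min lexx.
have q2 : Num.min (eta / 2) ((y - m) / 2) <= (y - m) / 2 by rewrite ge_min lexx orbT.
have zy : z < y by rewrite gtrDl oppr_lt0.
have mz : m < z by rewrite /z; lra.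
have [_ sl] := slope_lt m0 mz zy y1.
have : `|slope y z - df y| <= (slope m y - df y) / 2.
  apply: h; rewrite ?lt_eqF//.
    by rewrite /= in_itv/=; apply/andP; split; lra.
  by rewrite distrC /z subKr gtr0_norm//; lra.
have -> : slope y z = slope z y.
  by rewrite /slope -mulrNN -invrN !opprB.
by rewrite ler_norml => /andP[_ +]; lra.
Qed.

(** With m the midpoint, f'(y) <= slope(y,m) < slope(m,z) <= f'(z); strictness comes from the two
    strict chord inequalities. *)
Lemma derive_on_strictly_increasing y z : 0 <= y -> y < z -> z <= 1 -> df y < df z.
Proof.
move=> y0 yz z1; pose m := (y + z) / 2.
have ym : y < m by rewrite /m; lra.
have mz : m < z by rewrite /m; lra.
have [s1 s2] := slope_lt y0 ym mz z1.
have := df_le_slope y0 ym; have := @slope_le_df m z; lra.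
Qed.

(** Extends functions on [0, 1] to the line by their boundary values, which preserves continuity. *)
Definition unit_clamp y : R := Num.max 0 (Num.min 1 y).

Lemma unit_clamp_itv y : 0 <= unit_clamp y <= 1.
Proof. by rewrite /unit_clamp le_max lexx ge_max ler01 ge_min lexx. Qed.

Lemma unit_clampE y : 0 <= y <= 1 -> unit_clamp y = y.
Proof. by move=> /andP[y0 y1]; rewrite /unit_clamp min_r// max_r. Qed.

Lemma derive_on_clamp_continuous : continuous (df \o unit_clamp).
Proof.
move=> y; have [_ /subspace_continuousP c] := f_C1.
have D : (`[0, 1]%classic : set R) (unit_clamp y) by rewrite /= in_itv/= unit_clamp_itv.
apply: (cvg_comp _ _ _ (c _ D)) => A /= [eta /= eta0 h].
have cc : continuous unit_clamp.
  move=> t; apply: continuous_max; first exact: cvg_cst.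
  by apply: continuous_min; [exact: cvg_cst|exact: cvg_id].
have /cvgrPdist_lt/(_ eta eta0) : unit_clamp t @[t --> y] --> unit_clamp y by exact: cc.
apply: filterS => t /= yt.
by apply: h => //=; rewrite in_itv/= unit_clamp_itv.
Qed.

End StrictlyConvex.
End OneSidedDerivatives.

(** * The integrated value: derivatives and generator *)

Section ValueIntegral.
Context {R : realType}.
Variables (sigma lambda : 'I_2 -> R) (rho : R) (v v1 : R -> 'I_2 -> R) (a : 'I_2 -> R).
Hypotheses (lambda_gt0 : forall i, 0 < lambda i) (sigma_gt0 : forall i, 0 < sigma i)
  (rho_gt0 : 0 < rho) (sol : value_solution sigma lambda rho v v1 a).
Variable theta : R -> R.
Hypotheses (theta_continuous : continuous theta)
  (theta_bounded : exists M, forall z, `|theta z| <= M)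
  (theta_decr : forall y z, 0 <= y -> y < z -> z <= 1 -> theta z < theta y).
Local Notation J := partial_integral.
Local Notation L := (curvature_bound sigma lambda rho a).

Let v_derive (y : R) i : is_derive y 1 (v ^~ i) (v1 y i).
Proof. by have [_ _ _ /(_ y i)[]] := sol. Qed.
Let v1_bounds y i : 0 <= v1 y i <= 1.
Proof. by have [_ _ _ /(_ y i)[]] := sol. Qed.
Let v1_continuous i : continuous (v1 ^~ i).
Proof. by have [_ _ _ _ /(_ i)[]] := sol. Qed.
Let v_continuous i : continuous (v ^~ i).
Proof. by apply: (is_derive_continuous (df := v1 ^~ i)) => y. Qed.
Let v1_stop y i : a i <= y -> v1 y i = 1.
Proof. by move=> ay; have [_ _ /(_ _ _ ay)[]] := sol. Qed.
Let L0 : 0 <= L. Proof. exact: (curvature_bound_ge0 lambda_gt0 rho_gt0 sol). Qed.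
Let v1_lip y z i : `|v1 y i - v1 z i| <= L * `|y - z|.
Proof. exact: (value_derive_lipschitz lambda_gt0 rho_gt0 sol). Qed.

(** The second derivative of v off the threshold. The value at the threshold, where it may jump, is
    a convention. *)
Definition value_second (i : 'I_2) (t : R) : R :=
  if t < a i then curvature sigma lambda rho v t i else 0.
Local Notation v2 := value_second.

Let v2_le i t : `|v2 i t| <= L.
Proof.
rewrite /v2; case: ifP => [ta|_]; last by rewrite normr0.
exact: (curvature_le lambda_gt0 rho_gt0 sol ta).
Qed.

Let L' (i : 'I_2) := 2 / sigma i ^+ 2 * (rho + lambda i + lambda i).

Let L'0 i : 0 <= L' i.
Proof.
have l0 := ltW (lambda_gt0 i); have r0 := ltW rho_gt0.
by rewrite /L' mulr_ge0 ?addr_ge0// divr_ge0// exprn_ge0// ltW.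
Qed.

Let curvature_lip i s t :
  `|curvature sigma lambda rho v s i - curvature sigma lambda rho v t i| <= L' i * `|s - t|.
Proof.
have l0 := ltW (lambda_gt0 i); have r0 := ltW rho_gt0.
have s0 : 0 <= 2 / sigma i ^+ 2 by rewrite divr_ge0// exprn_ge0// ltW.
rewrite /curvature -mulrBr normrM (ger0_norm s0) /L' -mulrA ler_wpM2l//.
have -> : (rho + lambda i) * v s i - lambda i * v s (rev_ord i) -
  ((rho + lambda i) * v t i - lambda i * v t (rev_ord i)) =
  (rho + lambda i) * (v s i - v t i) - lambda i * (v s (rev_ord i) - v t (rev_ord i)) by ring.
apply: (le_trans (ler_normB _ _)); rewrite !normrM (ger0_norm l0) (ger0_norm (addr_ge0 r0 l0)).
rewrite [leRHS]mulrDl; apply: lerD; apply: ler_wpM2l; rewrite ?addr_ge0//;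
  exact: (value_lipschitz sol).
Qed.

(** Lipschitz unless [s] and [t] may be separated by the threshold, in which case the difference is
    bounded by 2 L. The boolean marks this case by a condition on [t] and the distance alone, as
    [near_level] needs it; [v1_increment] follows the same pattern. *)
Let v2_increment i s t : `|v2 i s - v2 i t| <=
  L' i * `|s - t| + 2 * L * (`|t - a i| <= `|s - t|)%R%:R.
Proof.
have c0 : 0 <= L' i * `|s - t| by rewrite mulr_ge0.
have [_|far] := leP `|t - a i| `|s - t|.
  rewrite mulr1; apply: ler_wpDl => //; apply: le_trans (ler_normB _ _) _.
  by rewrite mulr2n mulrDl mul1r lerD.
rewrite mulr0 addr0.
have [ta|at'] := ltP t (a i).
  rewrite (ltr0_norm (_ : t - a i < 0)) ?subr_lt0// in far.
  have sa : s < a i by have := ler_norm (s - t); lra.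
  by rewrite /v2 ta sa curvature_lip.
rewrite (ger0_norm (_ : 0 <= t - a i)) ?subr_ge0// in far.
have sa : a i <= s by have := ler_norm (- (s - t)); rewrite normrN; lra.
by rewrite /v2 !ltNge at' sa subrr normr0.
Qed.

Let v1_increment i t h : `|v1 (t + h) i - v1 t i - v2 i t * h| <=
  L' i * h ^+ 2 + 2 * L * `|h| * (`|t - a i| <= `|h|)%R%:R.
Proof.
have c0 : 0 <= L' i * h ^+ 2 by apply: mulr_ge0 => //; exact: sqr_ge0.
have [_|far] := leP `|t - a i| `|h|.
  rewrite mulr1; apply: ler_wpDl => //; apply: le_trans (ler_normB _ _) _.
  rewrite mulr2n mulrDl mul1r mulrDl; apply: lerD; last by rewrite normrM ler_wpM2r.
  by have := v1_lip (t + h) t i; rewrite addrAC subrr add0r.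
rewrite mulr0 addr0.
have [ta|at'] := ltP t (a i); last first.
  rewrite (ger0_norm (_ : 0 <= t - a i)) ?subr_ge0// in far.
  have sa : a i <= t + h by have := ler_norm (- h); rewrite normrN; lra.
  by rewrite /v2 ltNge at' /= !v1_stop// subrr mul0r subr0 normr0.
rewrite (ltr0_norm (_ : t - a i < 0)) ?subr_lt0// in far.
have hh := ler_norm h.
have [z zt E] : exists2 z, `|z - t| <= `|h| &
    v1 (t + h) i - v1 t i = curvature sigma lambda rho v z i * h.
  have d (z : R) : z < a i -> is_derive z 1 (v1 ^~ i) (curvature sigma lambda rho v z i).
    by have [_ _ _ _ /(_ i)[_ _]] := sol; apply.
  have cs (p q : R) : {within `[p, q], continuous (v1 ^~ i)} by exact: continuous_subspaceT.
  have [h0|h0] := leP 0 h.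
    have th : t <= t + h by rewrite lerDl.
    have [s||z] := @MVT_segment R (v1 ^~ i) (curvature sigma lambda rho v ^~ i) _ _ th.
    - by rewrite in_itv/= => /andP[_ ?]; apply: d; lra.
    - exact: cs.
    rewrite in_itv/= => /andP[z1 z2] E; exists z; last by rewrite E; congr (_ * _); ring.
    by rewrite !ger0_norm ?subr_ge0//; lra.
  have th : t + h <= t by rewrite gerDl ltW.
  have [s||z] := @MVT_segment R (v1 ^~ i) (curvature sigma lambda rho v ^~ i) _ _ th.
  - by rewrite in_itv/= => /andP[_ ?]; apply: d; lra.
  - exact: cs.
  rewrite in_itv/= => /andP[z1 z2] E; exists z; last by rewrite -opprB E; ring.
  by rewrite (ltr0_norm h0) ler0_norm ?subr_le0//; lra.
rewrite /v2 ta E -mulrBl normrM -[in leRHS]real_normK ?num_real// expr2 mulrA ler_wpM2r//.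
by apply: le_trans (curvature_lip _ _ _) _; exact: ler_wpM2l.
Qed.

Let shift_continuous x : continuous (fun z => x - theta z).
Proof. by move=> z; apply: cvgB; [exact: cvg_cst|exact: theta_continuous]. Qed.

Let value_integrand_continuous x i : continuous (fun z => v (x - theta z) i).
Proof.
move=> z; apply: (@continuous_comp _ _ _ (fun z => x - theta z) (v ^~ i)).
  exact: shift_continuous.
exact: v_continuous.
Qed.

Let bm_v x i : bounded_measurable (fun z => v (x - theta z) i).
Proof.
split; first by apply: continuous_measurable_fun; exact: value_integrand_continuous.
have [M hM] := theta_bounded; exists (`|v 0 i| + (`|x| + M)) => z.
rewrite -[v (x - theta z) i](subrK (v 0 i)) addrC; apply: le_trans (ler_normD _ _) _.
rewrite lerD2l; apply: (le_trans (value_lipschitz sol _ _ _)).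
by rewrite subr0; apply: le_trans (ler_normB _ _) _; rewrite lerD2l.
Qed.

Let bm_v1 x i : bounded_measurable (fun z => v1 (x - theta z) i).
Proof.
split.
  apply: continuous_measurable_fun => z.
  apply: (@continuous_comp _ _ _ (fun z => x - theta z) (v1 ^~ i)); last exact: v1_continuous.
  exact: shift_continuous.
by exists 1 => z; have /andP[h0 h1] := v1_bounds (x - theta z) i; rewrite ger0_norm.
Qed.

Let bm_v2 x i : bounded_measurable (fun z => v2 i (x - theta z)).
Proof.
split; last by exists L.
have [mv _] := bm_v x i; have [mv' _] := bm_v x (rev_ord i).
apply: measurable_fun_ifT => //.
  apply: measurable_fun_ltr => //.
  by apply: continuous_measurable_fun; exact: shift_continuous.
by apply: measurable_funM => //; apply: measurable_funB; exact: measurable_funM.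
Qed.

Definition value_integral (x y : R) (i : 'I_2) : R := J (fun z => v (x - theta z) i) y.
Definition value_integral1 (x y : R) (i : 'I_2) : R := J (fun z => v1 (x - theta z) i) y.
Definition value_integral2 (x y : R) (i : 'I_2) : R := J (fun z => v2 i (x - theta z)) y.

Let J_le_cst (g : R -> R) (c y : R) : bounded_measurable g -> 0 <= y <= 1 -> 0 <= c ->
  (forall z, `|g z| <= c) -> `|J g y| <= c.
Proof.
move=> bg /andP[y0 y1] c0 gc; apply: (le_trans (partial_integral_norm _ bg)).
apply: (@le_trans _ _ (J (fun=> c) y)).
  apply: partial_integral_le => //; first exact: bounded_measurable_norm.
  exact: bounded_measurable_cst.
by rewrite partial_integral_cst// ler_piMr.
Qed.

Lemma value_integral_derive (x : R) y i : 0 <= y <= 1 ->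
  is_derive x 1 (fun x => value_integral x y i) (value_integral1 x y i).
Proof.
move=> y01; apply/is_derive1P => e e0.
exists (e / (L + 1)) => [|h hh]; first by rewrite divr_gt0// ltr_wpDl.
rewrite /value_integral -partial_integralB// mulrC -partial_integralZ//.
have bvb := bounded_measurableB (bm_v (x + h) i) (bm_v x i).
have bv1 := bounded_measurableZ h (bm_v1 x i).
rewrite -partial_integralB//; apply: (@le_trans _ _ (L * h ^+ 2)).
  apply: J_le_cst => //; first exact: bounded_measurableB.
    by apply: mulr_ge0 => //; exact: sqr_ge0.
  move=> z; rewrite (addrAC x h) [h * _]mulrC.
  apply: (@taylor1 _ (v ^~ i) (v1 ^~ i)) => // s e'.
  by have := v1_lip (s + e') s i; rewrite addrAC subrr add0r.
rewrite -[h ^+ 2]real_normK ?num_real// expr2 mulrA ler_wpM2r//.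
have hh' : `|h| * (L + 1) < e by rewrite -ltr_pdivlMr// ltr_wpDl.
by have := normr_ge0 h; lra.
Qed.

(** By [level_itv], the z for which x - theta(z) is within m of the threshold lie in one interval,
    whose place depends on x but whose length does not. *)
Let near_level i (e0 : R) : 0 < e0 -> exists2 m, 0 < m & forall x, exists z0,
  forall z r, 0 <= z <= 1 -> r <= m ->
    (`|x - theta z - a i| <= r)%R%:R <= \1_`[z0 - e0, z0 + e0]%classic z :> R.
Proof.
move=> e00; have [m m0 hm] := level_itv theta_continuous theta_decr e00.
exists m => // x; have [z0 h] := hm (x - a i).
exists z0 => z r z01 rm; have [lt|//] := leP `|x - theta z - a i| r; last first.
rewrite indicE mem_set// /= in_itv/=; apply: h => //.
by apply: le_trans rm; rewrite addrAC.
Qed.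

Let J_le_level (g : R -> R) (y c1 c2 e0 z0 : R) : bounded_measurable g -> 0 <= y <= 1 ->
  0 <= c1 -> 0 <= c2 -> 0 < e0 ->
  (forall z, 0 <= z <= 1 -> `|g z| <= c1 + c2 * \1_`[z0 - e0, z0 + e0]%classic z) ->
  `|J g y| <= c1 + c2 * (2 * e0).
Proof.
move=> bg /andP[y0 y1] c10 c20 e00 gc; apply: (le_trans (partial_integral_norm _ bg)).
have bi : bounded_measurable (\1_(`[z0 - e0, z0 + e0]%classic : set R)).
  exact: bounded_measurable_indic.
have bz := bounded_measurableZ c2 bi; have bc := bounded_measurable_cst c1.
apply: (@le_trans _ _ (J (fun z => c1 + c2 * \1_`[z0 - e0, z0 + e0]%classic z) y)).
  apply: partial_integral_le => //; first exact: bounded_measurable_norm.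
    exact: bounded_measurableD.
  by move=> z /andP[z0' zy]; apply: gc; rewrite z0' (le_trans zy).
rewrite partial_integralD// partial_integralZ// partial_integral_cst//.
apply: lerD; first by rewrite ler_piMr.
by rewrite ler_wpM2l// partial_integral_itv// ltW.
Qed.

(** The integrand fails to be differentiable in x only where x - theta(z) meets the threshold. For
    small h, the z affected by the increment h lie in a short interval, and the integrand being
    Lipschitz, they contribute at most a small multiple of |h|. *)
Lemma value_integral1_derive (x : R) y i : 0 <= y <= 1 ->
  is_derive x 1 (fun x => value_integral1 x y i) (value_integral2 x y i).
Proof.
move=> y01; apply/is_derive1P => e e0.
have d0 : 0 < 8 * L + 1 by rewrite ltr_wpDl// mulr_ge0.
have d1 : 0 < 2 * L' i + 1 by rewrite ltr_wpDl// mulr_ge0.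
(* Half the length of the exceptional interval: its contribution 2 L (2 e1) |h| is then at most e
   |h|/2. *)
pose e1 := e / (8 * L + 1); have e10 : 0 < e1 by exact: divr_gt0.
have e1E : e1 * (8 * L + 1) = e by rewrite /e1 divfK// gt_eqF.
have [m m0 hm] := near_level i e10.
exists (Num.min m (e / (2 * L' i + 1))) => [|h].
  by rewrite lt_min m0 divr_gt0.
rewrite lt_min => /andP[hm' hh].
rewrite /value_integral1 -partial_integralB// mulrC -partial_integralZ//.
have bvb := bounded_measurableB (bm_v1 (x + h) i) (bm_v1 x i).
have bv2 := bounded_measurableZ h (bm_v2 x i).
rewrite -partial_integralB//; have [z0 hz0] := hm x.
have h0 := normr_ge0 h.
apply: (@le_trans _ _ (L' i * h ^+ 2 + 2 * L * `|h| * (2 * e1))).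
  apply: (@J_le_level _ y _ _ e1 z0) => //.
  - exact: bounded_measurableB.
  - by apply: mulr_ge0 => //; exact: sqr_ge0.
  - by rewrite !mulr_ge0.
  move=> z z01; rewrite (addrAC x h) [h * _]mulrC.
  apply: (le_trans (v1_increment _ _ _)); rewrite lerD2l ler_wpM2l ?mulr_ge0//.
  by apply: hz0 => //; exact: ltW.
rewrite -[h ^+ 2]real_normK ?num_real// expr2 mulrA.
have a1 : L' i * `|h| <= e / 2.
  have : `|h| * (2 * L' i + 1) < e by rewrite -ltr_pdivlMr.
  lra.
have a2 : 2 * L * (2 * e1) <= e / 2 by lra.
have := ler_wpM2r h0 a1; have := ler_wpM2r h0 a2.
by rewrite mulrAC [2 * L * `|h| * _]mulrAC; lra.
Qed.

(** Again [near_level]: a change of x moves the integrand slightly except for z in a short interval,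
    where it is bounded; a change of y moves the integral by at most L |y' - y|. *)
Lemma value_integral2_continuous x y i e : 0 <= y <= 1 -> 0 < e ->
  exists2 eta, 0 < eta & forall x' y', 0 <= y' <= 1 -> `|x' - x| < eta ->
    `|y' - y| < eta -> `|value_integral2 x' y' i - value_integral2 x y i| <= e.
Proof.
move=> y01 e0.
have d0 : 0 < 16 * L + 1 by rewrite ltr_wpDl// mulr_ge0.
have d1 : 0 < 4 * L' i + 1 by rewrite ltr_wpDl// mulr_ge0.
have d2 : 0 < 2 * L + 1 by rewrite ltr_wpDl// mulr_ge0.
pose e1 := e / (16 * L + 1); have e10 : 0 < e1 by exact: divr_gt0.
have e1E : e1 * (16 * L + 1) = e by rewrite /e1 divfK// gt_eqF.
have [m m0 hm] := near_level i e10.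
exists (Num.min m (Num.min (e / (4 * L' i + 1)) (e / (2 * L + 1)))).
  by rewrite !lt_min m0 !divr_gt0.
move=> x' y' y'01; rewrite !lt_min => /and3P[xm xe _] /and3P[_ _ ye].
have /andP[y0 y1] := y01; have /andP[y'0 y'1] := y'01.
have [mv2 _] := bm_v2 x' i.
have a0 := partial_integral_lipschitz mv2 (fun z => v2_le i (x' - theta z)) y0 y'0.
have [z0 hz0] := hm x.
have a1 : `|value_integral2 x' y i - value_integral2 x y i| <=
    L' i * `|x' - x| + 2 * L * (2 * e1).
  rewrite /value_integral2 -partial_integralB//.
  apply: (@J_le_level _ y _ _ e1 z0) => //.
  - exact: bounded_measurableB.
  - by rewrite mulr_ge0.
  - by rewrite mulr_ge0.
  move=> z z01; have xx : x' - theta z - (x - theta z) = x' - x by ring.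
  apply: (le_trans (v2_increment _ _ _)); rewrite xx lerD2l ler_wpM2l ?mulr_ge0//.
  by apply: hz0 => //; exact: ltW.
have b1 : `|x' - x| * (4 * L' i + 1) < e by rewrite -ltr_pdivlMr.
have b2 : `|y' - y| * (2 * L + 1) < e by rewrite -ltr_pdivlMr.
rewrite -(subrK (value_integral2 x' y i) (value_integral2 x' y' i)) -addrA.
apply: (le_trans (ler_normD _ _)); rewrite /value_integral2 in a0 a1 *.
have := normr_ge0 (x' - x); have := normr_ge0 (y' - y).
move: a0 a1 b1 b2; move: `|_ - _| `|_ - _| `|_ - _| `|_ - _| => p q r s; lra.
Qed.

Lemma value_integral_quotient x y i : 0 <= y <= 1 ->
  quotient_on `[0, 1] (fun y => value_integral x y i) y --> v (x - theta y) i.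
Proof.
move=> /andP[y0 y1]; apply/quotient_on_cvgP => e e0.
have := @value_integrand_continuous x i y => /cvgrPdist_le/(_ e e0)[eta /= eta0 h].
exists eta => // z; rewrite /= in_itv/= => /andP[z0 z1] zy yz.
have zy0 : 0 < `|z - y| by rewrite normr_gt0 subr_eq0.
have -> : (value_integral x z i - value_integral x y i) / (z - y) - v (x - theta y) i =
    (value_integral x z i - value_integral x y i - v (x - theta y) i * (z - y)) / (z - y).
  by field; rewrite subr_eq0.
rewrite normrM normfV ler_pdivrMr//; apply: partial_integral_near => // t.
rewrite distrC => tt; apply: h => /=; apply: le_lt_trans yz.
move: tt; have [yz|/ltW zy'] := leP y z.
  by move=> /andP[t1 t2]; rewrite distrC !ger0_norm ?subr_ge0//; lra.
by move=> /andP[t1 t2]; rewrite ger0_norm ?subr_ge0// ler0_norm ?subr_le0//; lra.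
Qed.

Lemma value_integrand_jointly_continuous i :
  continuous (fun p : R * R => v (p.1 - theta p.2) i).
Proof.
move=> p; apply: (@continuous_comp _ _ _ (fun p : R * R => p.1 - theta p.2) (v ^~ i)).
  apply: cvgB; first exact: cvg_fst.
  by apply: (@continuous_comp _ _ _ snd theta); [exact: cvg_snd|exact: theta_continuous].
exact: v_continuous.
Qed.

(** (G - rho)v at t with the second derivative [v2]: zero below the threshold, nonpositive above
    it. *)
Let generator_defect i t := sigma i ^+ 2 / 2 * v2 i t +
  lambda i * (v t (rev_ord i) - v t i) - rho * v t i.

Lemma value_integral_generator x y i :
  sigma i ^+ 2 / 2 * value_integral2 x y i +
    lambda i * (value_integral x y (rev_ord i) - value_integral x y i) -
    rho * value_integral x y i =
  J (fun z => generator_defect i (x - theta z)) y.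
Proof.
have b2 := bounded_measurableZ (sigma i ^+ 2 / 2) (bm_v2 x i).
have bg := bounded_measurableB (bm_v x (rev_ord i)) (bm_v x i).
have bl := bounded_measurableZ (lambda i) bg.
have br := bounded_measurableZ rho (bm_v x i).
rewrite /generator_defect partial_integralB//; last exact: bounded_measurableD.
by rewrite partial_integralD// !partial_integralZ// partial_integralB.
Qed.

Let defect_bounded x i : bounded_measurable (fun z => generator_defect i (x - theta z)).
Proof.
apply: bounded_measurableB; last exact: bounded_measurableZ.
apply: bounded_measurableD; apply: bounded_measurableZ => //.
exact: bounded_measurableB.
Qed.

Let defect_below i t : t < a i -> generator_defect i t = 0.
Proof. by move=> ta; rewrite /generator_defect /v2 ta /curvature; field; rewrite gt_eqF. Qed.

Let defect_le0 i t : generator_defect i t <= 0.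
Proof.
have [/defect_below ->//|at'] := ltP t (a i).
rewrite /generator_defect /v2 ltNge at' /= mulr0 add0r subr_le0.
by have [_ _ /(_ _ _ at')[]] := sol.
Qed.

Lemma value_integral_generator_le0 x y i : 0 <= y ->
  sigma i ^+ 2 / 2 * value_integral2 x y i +
    lambda i * (value_integral x y (rev_ord i) - value_integral x y i) -
    rho * value_integral x y i <= 0.
Proof.
move=> y0; rewrite value_integral_generator.
have := @partial_integral_le _ _ (fun=> 0) y (defect_bounded x i) (bounded_measurable_cst 0).
by rewrite partial_integral_cst// mul0r; apply.
Qed.

(** As theta decreases, x - theta(z) <= x - theta(y) for z <= y, so the defect vanishes on all of
    [0, y]. *)
Lemma value_integral_generator_eq0 x y i : 0 <= y <= 1 -> x - theta y < a i ->
  sigma i ^+ 2 / 2 * value_integral2 x y i +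
    lambda i * (value_integral x y (rev_ord i) - value_integral x y i) -
    rho * value_integral x y i = 0.
Proof.
move=> /andP[y0 y1] xa; rewrite value_integral_generator.
have -> : J (fun z => generator_defect i (x - theta z)) y = J (fun=> 0) y.
  apply: eq_Rintegral => z; rewrite inE/= in_itv/= => /andP[z0 zy]; apply: defect_below.
  apply: le_lt_trans xa; rewrite lerD2l lerN2.
  by move: zy; rewrite le_eqVlt => /predU1P[->//|zy]; apply/ltW/theta_decr.
by rewrite partial_integral_cst// mul0r.
Qed.

End ValueIntegral.

(** * The Hamilton-Jacobi-Bellman equation *)

Theorem proposition4p2 (R : realType) (d : measure_display)
  (T : measurableType d) (P : probability T R)
  (W : R -> T -> R) (eps : R -> T -> 'I_2) (X : R -> R -> T -> R)
  (lambda sigma : 'I_2 -> R) (rho c : R) (f : R -> R)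
  (Pcomplete : measure_is_complete P)
  (lambda_gt0 : forall i, 0 < lambda i)
  (sigma_gt0 : 0 < sigma ord0)
  (sigma_le : sigma ord0 <= sigma ord_max)
  (rho_gt0 : 0 < rho) (c_gt0 : 0 < c)
  (WBM : brownian_motion P W)
  (epsMC : markov_chain P (regime_rates lambda) eps)
  (W_eps_indep : independent_systems P
     <<s events measurable W `[0, +oo[ >>
     <<s events [set: set 'I_2] eps `[0, +oo[ >>)
  (eps0_gt0 : forall i, (0 < P [set w | eps 0%R w = i])%E)
  (X_sde : forall x, regime_switching_diffusion P W eps sigma x (X x))
  (f_ge0 : forall y, 0 <= f y)
  (f_incr : {homo f : a b / a <= b})
  (f0 : f 0 = 0)
  (f_convex : strictly_convex_on `[0, 1] f)
  (f_C1 : continuously_differentiable_on `[0, 1] f) :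
  let theta (y : R) : R := c - derive_on `[0, 1] f y / rho in
  let u (x : R) (i : 'I_2) (y : R) : \bar R :=
    stopping_value P W eps rho (X x) i (theta y) in
  let F (x y : R) (i : 'I_2) : R :=
    Rintegral lebesgue_measure `[0, y] (fun z => fine (u x i z)) - f y / rho in
  hjb_classical_solution sigma lambda rho c f F /\
  (forall x i, F x 0 i = 0).
Proof.
move=> theta u F.
have ord_maxE : ord_max = rev_ord (@ord0 1) by exact: val_inj.
have sigma_pos i : 0 < sigma i.
  by have [->//|->] := ord2P i; rewrite -ord_maxE; exact: lt_le_trans sigma_le.
have [v [v1 [a sol]]] := value_solution_exists lambda_gt0 sigma_gt0 sigma_le rho_gt0.
have uE x i y : u x i y = (v (x - theta y) i)%:E.
  apply: (@verification _ _ _ _ W eps lambda sigma rho v a (value_bound a)) => //.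
  - exact: (value_bound_ge0 sol).
  - exact: (value_ge0 sol).
  - exact: (value_ge sol).
  - by move=> z j az; have [_ _ /(_ _ _ az)[]] := sol.
  - by move=> z j; exact: (value_le sol).
  - exact: (near_solution_exists lambda_gt0 sigma_pos rho_gt0 sol).
(* [derive_on] is meaningful on [0, 1] only; the clamp extends theta continuously to the line and
   leaves it unchanged on [0, 1]. *)
pose Th z := theta (unit_clamp z).
have TE z : 0 <= z <= 1 -> Th z = theta z by move=> z01; rewrite /Th unit_clampE.
have theta_decr y z : 0 <= y -> y < z -> z <= 1 -> theta z < theta y.
  move=> y0 yz z1; rewrite /theta ltrD2l ltrN2 ltr_pM2r ?invr_gt0//.
  exact: (derive_on_strictly_increasing f_convex f_C1).
have T_decr y z : 0 <= y -> y < z -> z <= 1 -> Th z < Th y.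
  by move=> y0 yz z1; rewrite !TE ?theta_decr//; apply/andP; split; lra.
have T_continuous : continuous Th.
  move=> z; apply: cvgB; first exact: cvg_cst.
  apply: cvgM; last exact: cvg_cst.
  exact: (derive_on_clamp_continuous f_C1).
have T_bounded : exists M, forall z, `|Th z| <= M.
  exists (`|theta 0| + `|theta 1|) => z; rewrite /Th.
  have /andP[z0 z1] := unit_clamp_itv z; move: (unit_clamp z) z0 z1 => t t0 t1.
  have h0 : theta t <= theta 0.
    by move: t0; rewrite le_eqVlt => /predU1P[<-//|t0]; apply/ltW/theta_decr.
  have h1 : theta 1 <= theta t.
    by move: t1; rewrite le_eqVlt => /predU1P[->//|t1]; apply/ltW/theta_decr.
  have := ler_norm (theta 0); have := ler_norm (- theta 1); rewrite normrN => n1 n0.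
  have := normr_ge0 (theta 0); have := normr_ge0 (theta 1) => p1 p0.
  by rewrite ler_norml; apply/andP; split; lra.
pose I x y i := value_integral v Th x y i.
pose I1 x y i := value_integral1 v1 Th x y i.
pose I2 x y i := value_integral2 sigma lambda rho v a Th x y i.
have FE x y i : 0 <= y <= 1 -> F x y i = I x y i - f y / rho.
  move=> /andP[y0 y1]; congr (_ - _); apply: eq_Rintegral => z.
  rewrite inE/= in_itv/= => /andP[z0 zy].
  by rewrite uE /= TE// z0 (le_trans zy).
have Fx (x y : R) i : 0 <= y <= 1 -> is_derive x 1 (fun x' => F x' y i) (I1 x y i).
  move=> y01; have -> : (fun x' => F x' y i) = (fun x' => I x' y i - f y / rho).
    by apply/funext => x'; rewrite FE.
  have dv := value_integral_derive lambda_gt0 rho_gt0 sol T_continuous T_bounded x i y01.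
  by have := is_derive_eq (is_deriveB dv (is_derive_cst (f y / rho) x 1)) (subr0 _).
have F_xE x y i : 0 <= y <= 1 -> F_x F x y i = I1 x y i.
  by move=> y01; rewrite /F_x derive1E; have [_ ->] := Fx x y i y01.
have Fxx (x y : R) i : 0 <= y <= 1 -> is_derive x 1 (fun x' => F_x F x' y i) (I2 x y i).
  move=> y01; have -> : (fun x' => F_x F x' y i) = (fun x' => I1 x' y i).
    by apply/funext => x'; rewrite F_xE.
  exact: (value_integral1_derive lambda_gt0 sigma_pos rho_gt0 sol T_continuous T_bounded T_decr).
have F_xxE x y i : 0 <= y <= 1 -> F_xx F x y i = I2 x y i.
  by move=> y01; rewrite /F_xx derive1E; have [_ ->] := Fxx x y i y01.
pose df := derive_on `[0, 1] f.
have Fy x y i : 0 < y <= 1 ->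
    quotient_on `[0, 1] (fun y' => F x y' i) y --> v (x - Th y) i - df y / rho.
  move=> /andP[y0 y1]; apply/quotient_on_cvgP => e e0.
  have y01 : 0 <= y <= 1 by rewrite ltW.
  have Dy : (`[0, 1]%classic : set R) y by rewrite /= in_itv.
  have e2 : 0 < e / 2 by rewrite divr_gt0.
  have er : 0 < e / 2 * rho by rewrite mulr_gt0.
  have quo := value_integral_quotient sol T_continuous T_bounded y01.
  have /quotient_on_cvgP/(_ _ e2)[eta1 eta10 h1] := quo x i.
  have [/(_ _ Dy)/derivable_on_cvg/quotient_on_cvgP/(_ _ er)[eta2 eta20 h2] _] := f_C1.
  exists (Num.min eta1 eta2); first by rewrite lt_min eta10.
  move=> z Dz zy; rewrite lt_min => /andP[z1 z2].
  have z01 : 0 <= z <= 1 by move: Dz; rewrite /= in_itv.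
  have := h1 z Dz zy z1; have := h2 z Dz zy z2.
  rewrite !FE// -/df; move: (df y) => l q1 q2.
  have zy0 : z - y != 0 by rewrite subr_eq0.
  rewrite (_ : (I x z i - f z / rho - (I x y i - f y / rho)) / (z - y) - (v (x - Th y) i - l / rho) =
    ((I x z i - I x y i) / (z - y) - v (x - Th y) i) -
    ((f z - f y) / (z - y) - l) / rho); last by field; rewrite zy0 gt_eqF.
  apply: (le_trans (ler_normB _ _)); rewrite [leRHS]splitr; apply: lerD => //.
  by rewrite normrM normfV (gtr0_norm rho_gt0) ler_pdivrMr.
have F_yE x y i : 0 < y <= 1 -> derivable_on `[0, 1] (fun y' => F x y' i) y /\
    F_y F x y i = v (x - Th y) i - df y / rho.
  by move=> y01; apply: derive_on_eq => //; exact: Fy.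
have w01 (y : R) : 0 < y <= 1 -> 0 <= y <= 1 by move=> /andP[/ltW -> ->].
split; last first.
  move=> x i; rewrite FE ?lexx ?ler01// f0 mul0r subr0 /I /value_integral /partial_integral.
  by rewrite set_itv1 Rintegral_set1.
split.
- move=> x y i y01; split; last by have [] := F_yE x y i y01.
    by have [] := Fx x y i (w01 _ y01).
  by have [] := Fxx x y i (w01 _ y01).
- move=> i; apply/subspace_continuousP => -[x y] /= y01.
  apply/cvgrPdist_le => e e0.
  have [eta eta0 h] := value_integral2_continuous lambda_gt0 sigma_pos rho_gt0 sol
    T_continuous T_bounded T_decr x i (w01 _ y01) e0.
  have := nbhsx_ballx (x, y) eta eta0; apply: filterS => -[x' y'] [/= bx by'] y'01.
  rewrite -[leLHS]/(`|F_xx F x y i - F_xx F x' y' i|) !F_xxE ?w01// distrC; apply: h; rewrite ?w01//.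
    by rewrite distrC.
  by rewrite distrC.
- move=> i.
  (* On the strip F_y agrees with a function that is continuous on the whole plane, thanks to the
     clamp. *)
  apply: (@subspace_eq_continuous _ _ _
      (fun p : R * R => v (p.1 - Th p.2) i - (df \o unit_clamp) p.2 / rho)).
    move=> [x y]; rewrite inE/= => y01; have [_ E] := F_yE x y i y01.
    by apply: etrans (esym E); rewrite /= unit_clampE// w01.
  apply: continuous_subspaceT => p; apply: cvgB.
    exact: (value_integrand_jointly_continuous sol T_continuous).
  apply: cvgM; last exact: cvg_cst.
  apply: (@continuous_comp _ _ _ snd (df \o unit_clamp)); first exact: cvg_snd.
  exact: (derive_on_clamp_continuous f_C1).
move=> x y i y01; have y01' := w01 _ y01; have /andP[y0 y1] := y01'.
have [_ ->] := F_yE x y i y01.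
(* The term -f(y)/rho of F contributes +f(y) through -rho F, which cancels the running cost. *)
have -> : generator sigma lambda F x y i - rho * F x y i - f y =
    sigma i ^+ 2 / 2 * I2 x y i + lambda i * (I x y (rev_ord i) - I x y i) - rho * I x y i.
  by rewrite /generator F_xxE// !FE//; field; rewrite gt_eqF.
have -> : x - c - (v (x - Th y) i - df y / rho) = x - Th y - v (x - Th y) i.
  by rewrite TE// /theta -/df; ring.
(* Below the threshold the first entry vanishes and the second is nonpositive because v dominates
   the payoff; from the threshold on the second vanishes and the first is nonpositive. *)
have [xa|ax] := ltP (x - Th y) (a i).
  have -> := value_integral_generator_eq0 lambda_gt0 sigma_pos rho_gt0 sol
    T_continuous T_bounded T_decr y01' xa.
  by rewrite max_l// subr_le0 (value_ge sol).
have -> : v (x - Th y) i = x - Th y by have [_ _ /(_ _ _ ax)[]] := sol.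
rewrite subrr max_r//.
exact: (value_integral_generator_le0 lambda_gt0 sigma_pos rho_gt0 sol T_continuous T_bounded).
Qed.
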